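(* Let $\mathcal{M}$ be a finite von Neumann algebra equipped with a fixed normal faithful tracial state $\tau$, let $N>1$ be an integer, and let $u_1,\dots,u_N$ be unitaries in $\mathcal{M}$. Then the following assertions are equivalent: (1) the operators $u_1,\dots,u_N$ are free Haar unitaries (with respect to $\tau$); (2) the following equality holds: $$\left\|\sum_{i=1}^N u_i \otimes (u_i^{\mathrm{op}})^* + u_i^*\otimes u_i^{\mathrm{op}}\right\|_{\mathcal{M}\overline{\otimes}\mathcal{M}^{\mathrm{op}}} = 2\sqrt{2N - 1}.$$
   Context: $\mathcal{M}^{\mathrm{op}}$ is the opposite von Neumann algebra of $\mathcal{M}$ (same underlying space and involution, reversed product), and $x^{\mathrm{op}}$ denotes $x\in\mathcal{M}$ viewed in $\mathcal{M}^{\mathrm{op}}$. $\mathcal{M}\overline{\otimes}\mathcal{M}^{\mathrm{op}}$ is the von Neumann algebra tensor product with its operator norm. A unitary $u\in\mathcal{M}$ is a Haar unitary if $\tau(u^k)=0$ for every nonzero integer $k$. Unitaries $u_1,\dots,u_N$ are free Haar unitaries if each is a Haar unitary and they are freely independent (in the sense of Voiculescu, for the $*$-algebras they generate) with respect to $\tau$; equivalently, $\tau(w(u_1,\dots,u_N))=0$ for every nontrivial reduced word $w$ in the free group $\mathbb{F}_N$, where $w(u_1,\dots,u_N)$ is obtained by substituting $u_i$ for the $i$-th free generator. *)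

(* Defs.v *)
From HB Require Import structures.
From mathcomp Require Import all_boot all_order all_algebra sesquilinear complex.
From mathcomp Require Import all_classical all_reals topology normedtype.

Set Implicit Arguments.
Unset Strict Implicit.
Unset Printing Implicit Defensive.

Import Order.TTheory GRing.Theory Num.Theory.
Import numFieldNormedType.Exports.

Local Open Scope classical_set_scope.
Local Open Scope ring_scope.

(* The inner product is linear in its first argument. *)
HB.mixin Record isHilbert (R : realType) H & CompleteNormedModule R[i] H := {
  hdot : {dot H for Num.conj};
  hdotE : forall x, hdot x x = `|x| ^+ 2
}.

#[short(type="hilbertType")]
HB.structure Definition Hilbert (R : realType) :=
  {H of CompleteNormedModule R[i] H & isHilbert R H}.

Section ConjugateSpace.
Context (R : realType) (H : hilbertType R).

(* The conjugate Hilbert space: same vectors, sum and norm as H; scalars act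
   through their conjugates, and the inner product is conjugated. *)
Definition conjsp : Type := H.

HB.instance Definition _ := PseudoMetricNormedZmod.copy conjsp H.
HB.instance Definition _ := Complete.copy conjsp H.

Definition conj_scale (c : R[i]) (x : conjsp) : conjsp :=
  (Num.conj c : R[i]) *: (x : H).

Fact conj_scaleA a b v : conj_scale a (conj_scale b v) = conj_scale (a * b) v.
Proof. by rewrite /conj_scale scalerA rmorphM. Qed.

Fact conj_scale1 : left_id 1 conj_scale.
Proof. by move=> v; rewrite /conj_scale rmorph1 scale1r. Qed.

Fact conj_scaleDr : right_distributive conj_scale +%R.
Proof. by move=> c u v; exact: scalerDr. Qed.

Fact conj_scaleDl v : {morph conj_scale^~ v : a b / a + b >-> a + b}.
Proof. by move=> c d; rewrite /conj_scale rmorphD scalerDl. Qed.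

HB.instance Definition _ := GRing.Zmodule_isLmodule.Build R[i] conjsp
  conj_scaleA conj_scale1 conj_scaleDr conj_scaleDl.

Fact conj_normrZ (c : R[i]) (x : conjsp) : `|c *: x| = `|c| * `|x|.
Proof.
by rewrite -[LHS]/(`|(Num.conj c : R[i]) *: (x : H)|) normrZ norm_conjC.
Qed.

HB.instance Definition _ :=
  PseudoMetricNormedZmod_Lmodule_isNormedModule.Build R[i] conjsp conj_normrZ.

Definition conj_dot (x y : conjsp) : R[i] := hdot (y : H) (x : H).

Fact conj_dot_bilinear :
  bilinear_for ( *%R : R[i] -> R[i] -> R[i]) (Num.conj \; *%R) conj_dot.
Proof.
split=> v c x y; rewrite /conj_dot.
- have -> : (c *: x + y : conjsp) = (Num.conj c : R[i]) *: (x : H) + (y : H) by [].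
  by rewrite linearDr linearZr/= conjCK.
- have -> : (c *: x + y : conjsp) = (Num.conj c : R[i]) *: (x : H) + (y : H) by [].
  by rewrite linearDl linearZl_LR.
Qed.

HB.instance Definition _ := bilinear_isBilinear.Build R[i] conjsp conjsp R[i]
  ( *%R) (Num.conj \; *%R) conj_dot conj_dot_bilinear.

Fact conj_dot_herm (x y : conjsp) :
  conj_dot x y = (-1) ^+ false * Num.conj (conj_dot y x).
Proof. exact: hermC. Qed.

HB.instance Definition _ := isHermitianSesquilinear.Build R[i] conjsp
  false Num.conj conj_dot conj_dot_herm.

Fact conj_dot_gt0 (x : conjsp) : x != 0 -> 0 < conj_dot x x.
Proof. exact: (neq0_dnorm_gt0 (s := hdot) (x : H)). Qed.

HB.instance Definition _ := isDotProduct.Build R[i] conjsp conj_dot conj_dot_gt0.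

Fact conj_dotE (x : conjsp) : conj_dot x x = `|x| ^+ 2.
Proof. exact: (hdotE (x : H)). Qed.

HB.instance Definition _ := isHilbert.Build R conjsp conj_dotE.

End ConjugateSpace.

Section Operators.
Context (R : realType).

Definition bounded_op (H K : hilbertType R) (a : H -> K) : Prop :=
  linear a /\ exists C : R[i], forall x, `|a x| <= C * `|x|.

Definition opnorm (H K : hilbertType R) (a : H -> K) : R :=
  sup [set complex.Re `|a x| | x in [set x | `|x| <= 1]].

Context (H : hilbertType R).
Implicit Types (a b u : H -> H) (M S : set (H -> H)) (tau : (H -> H) -> R[i]).

Definition is_adjoint a b : Prop := forall x y, hdot (a x) y = hdot x (b y).

(* 0 when a has no adjoint *)
Definition adj a : H -> H := xget 0 [set b | is_adjoint a b].

Definition unitary_op u : Prop := adj u \o u = id /\ u \o adj u = id.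

(* u ^ k for an integer k, negative powers being powers of the adjoint *)
Definition opexpz u (k : int) : H -> H :=
  match k with Posz n => iter n u | Negz n => iter n.+1 (adj u) end.

Definition commutant S : set (H -> H) :=
  [set b | bounded_op b /\ forall a, S a -> a \o b = b \o a].

(* A von Neumann algebra on H: a self-adjoint set of bounded operators equal
   to its bicommutant. *)
Definition von_neumann M : Prop :=
  (forall a, M a -> exists2 b, M b & is_adjoint a b) /\
  commutant (commutant M) = M.

(* The identity is a finite projection: every isometry of M is unitary. *)
Definition finite_vN M : Prop :=
  forall v, M v -> adj v \o v = id -> v \o adj v = id.

Definition op_le a b : Prop := forall x, 0 <= hdot (b x - a x) x.

Definition op_directed S : Prop :=
  forall a b, S a -> S b -> exists c, [/\ S c, op_le a c & op_le b c].

Definition op_lub_in M S b : Prop :=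
  [/\ M b, forall a, S a -> op_le a b
    & forall c, M c -> (forall a, S a -> op_le a c) -> op_le b c].

(* tau preserves suprema of bounded increasing nets of positive elements *)
Definition normal_functional M tau : Prop :=
  forall S s, S !=set0 -> S `<=` [set a | M a /\ op_le 0 a] ->
    op_directed S -> op_lub_in M S s -> supremums (tau @` S) (tau s).

(* Only the values of tau on M matter. *)
Record normal_faithful_tracial_state M tau : Prop := {
  trace_linear : forall (c : R[i]) a b, M a -> M b ->
    tau (c *: a + b) = c * tau a + tau b;
  trace_ge0 : forall a, M a -> 0 <= tau (adj a \o a);
  trace_id : tau id = 1;
  trace_faithful : forall a, M a -> tau (adj a \o a) = 0 -> a = 0;
  trace_comp : forall a b, M a -> M b -> tau (a \o b) = tau (b \o a);
  trace_normal : normal_functional M tau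
}.

Definition haar_unitary tau u : Prop :=
  unitary_op u /\ forall k : int, k != 0 -> tau (opexpz u k) = 0.

Definition unital_star_algebra S : Prop :=
  [/\ S id,
      forall (c : R[i]) a b, S a -> S b -> S (c *: a + b),
      forall a b, S a -> S b -> S (a \o b)
    & forall a, S a -> S (adj a)].

(* Voiculescu's freeness: an alternating product of centered elements is
   centered. *)
Definition free_family tau (I : Type) (A : I -> set (H -> H)) : Prop :=
  forall (n : nat) (i : nat -> I) (a : nat -> (H -> H)),
    (0 < n)%N ->
    (forall k, (k < n)%N -> A (i k) (a k) /\ tau (a k) = 0) ->
    (forall k, (k.+1 < n)%N -> i k <> i k.+1) ->
    tau (\big[comp/id]_(0 <= k < n) a k) = 0.

Definition free_haar_unitaries tau (I : Type) (u : I -> H -> H) : Prop :=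
  (forall i, haar_unitary tau (u i)) /\
  free_family tau (fun i => smallest unital_star_algebra [set u i]).

(* The opposite algebra acts on the conjugate space: a^op is the adjoint of a,
   seen as an operator on conjsp H. This is linear in a (scalars being
   conjugated twice), preserves adjoints and reverses products. *)
Definition op_elt (a : H -> H) : conjsp H -> conjsp H := adj a.

Definition opposite M : set (conjsp H -> conjsp H) := op_elt @` M.

End Operators.

(* The Hilbert space tensor product of H and K, which is determined up to a
   unique unitary compatible with the bilinear maps. *)
Record hilbert_tensor (R : realType) (H K : hilbertType R) := HilbertTensor {
  ht_space :> hilbertType R;
  ht : {bilinear H -> K -> ht_space};
  ht_dot : forall h h' k k',
    hdot (ht h k) (ht h' k') = hdot h h' * hdot k k';
  ht_dense :
    closure [set \sum_(p <- s) ht p.1 p.2 | s in [set: seq (H * K)]] = setT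
}.

(* a (x) b: the unique bounded operator with the given values on pure
   tensors. *)
Definition op_tensor (R : realType) (H K : hilbertType R)
    (L : hilbert_tensor H K) (a : H -> H) (b : K -> K) : L -> L :=
  xget 0 [set T : L -> L | bounded_op T /\
            forall h k, T (ht L h k) = ht L (a h) (b k)].
Arguments op_tensor {R H K} L a b.

(* The von Neumann algebra tensor product, acting on L; its norm is the
   operator norm of L. *)
Definition vN_tensor (R : realType) (H K : hilbertType R)
    (L : hilbert_tensor H K) (M : set (H -> H)) (P : set (K -> K)) :
    set (L -> L) :=
  commutant (commutant
    [set T | exists a b, [/\ M a, P b & T = op_tensor L a b]]).
Arguments vN_tensor {R H K} L M P.

Section AdjointFacts.
Context (R : realType) (H : hilbertType R).
Implicit Types (a b : H -> H) (M : set (H -> H)).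

Lemma adjE a b : is_adjoint a b -> adj a = b.
Proof.
move=> ab; apply: xget_unique => // c; rewrite /= => ac; apply/funext => y.
apply/eqP; rewrite -subr_eq0; apply: contraT => cb.
have := neq0_dnorm_gt0 (s := hdot) (c y - b y) cb.
set z := c y - b y.
have -> : hdot z z = hdot z (c y) - hdot z (b y) by exact: linearBr.
by rewrite -ac -ab subrr ltxx.
Qed.

Lemma is_adjointC a b : is_adjoint a b -> is_adjoint b a.
Proof.
have dotC x y : hdot x y = Num.conj (hdot y x).
  by rewrite [LHS](hermC hdot) expr0 mul1r.
by move=> ab x y; rewrite dotC -ab -dotC.
Qed.

End AdjointFacts.

Section OppositeFacts.
Context (R : realType) (H : hilbertType R).
Implicit Types (a b : H -> H) (M : set (H -> H)).

Lemma op_elt_comp M a b : von_neumann M -> M a -> M b ->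
  op_elt (a \o b) = op_elt b \o op_elt a.
Proof.
move=> [Mstar _] /Mstar[a' _ aa'] /Mstar[b' _ bb'].
rewrite /op_elt (adjE aa') (adjE bb').
by apply: (adjE (H := H) (b := b' \o a')) => x y /=; rewrite aa' bb'.
Qed.

Lemma op_elt_linear M (c : R[i]) a b : von_neumann M -> M a -> M b ->
  op_elt (c *: a + b) = c *: op_elt a + op_elt b.
Proof.
move=> [Mstar _] /Mstar[a' _ aa'] /Mstar[b' _ bb'].
rewrite /op_elt (adjE aa') (adjE bb').
pose ab' : H -> H := fun y => (Num.conj c : R[i]) *: a' y + b' y.
apply: (adjE (H := H) (b := ab')) => x y.
transitivity (c * hdot (a x) y + hdot (b x) y).
  by rewrite -[(c *: a + b) x]/(c *: a x + b x) linearDl linearZl_LR.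
by rewrite /ab' aa' bb' linearDr linearZr/= conjCK.
Qed.

Lemma op_elt_adj M a : von_neumann M -> M a -> adj (op_elt a) = op_elt (adj a).
Proof.
move=> [Mstar _] /Mstar[a' _ aa'].
rewrite /op_elt (adjE aa') (adjE (is_adjointC aa')).
apply: adjE => x y.
exact: esym (aa' y x).
Qed.

Lemma bounded_op_conj a :
  bounded_op (a : conjsp H -> conjsp H) <-> bounded_op a.
Proof.
split=> -[alin [C aC]]; (split; last by exists C) => c x y.
- have E : a ((Num.conj (Num.conj c) : R[i]) *: (x : H) + y) =
      (Num.conj (Num.conj c) : R[i]) *: (a x : H) + a y.
    exact: (alin (Num.conj c) x y).
  by rewrite conjCK in E.
- exact: (alin (Num.conj c) x y).
Qed.

Lemma commutant_conj (S : set (H -> H)) :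
  commutant (S : set (conjsp H -> conjsp H)) = commutant S.
Proof. by apply/seteqP; split=> a [/bounded_op_conj]. Qed.

Lemma opposite_von_neumann M : von_neumann M -> von_neumann (opposite M).
Proof.
move=> MvN; have [Mstar Mcc] := MvN.
have -> : opposite M = M.
  apply/seteqP; split=> [_ [a /Mstar[b Mb ab] <-]|a /Mstar[b Mb ab]].
    by rewrite /op_elt (adjE ab).
  by exists b => //; rewrite /op_elt (adjE (is_adjointC ab)).
split; last by rewrite 2!commutant_conj.
move=> a /Mstar[b Mb ab]; exists b => // x y.
exact: esym (is_adjointC ab y x).
Qed.

End OppositeFacts.

Section TensorFacts.
Context (R : realType) (H K : hilbertType R) (L : hilbert_tensor H K).
Implicit Types (M : set (H -> H)) (P : set (K -> K)) (S T : L -> L).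

Lemma vN_tensor_mem M P a b : M a -> P b -> vN_tensor L M P (op_tensor L a b).
Proof.
move=> Ma Pb; split; last first.
  by move=> S [_ +]; move/(_ (op_tensor L a b)) => -> //; exists a, b.
rewrite /op_tensor; case: xgetP => [T _ []//|_]; split.
  by move=> c x y /=; rewrite scaler0 addr0.
by exists 0 => x; rewrite normr0 mul0r.
Qed.

Lemma vN_tensorD M P S T :
  vN_tensor L M P S -> vN_tensor L M P T -> vN_tensor L M P (S + T).
Proof.
move=> [[Slin [C SC]] Scomm] [[Tlin [D TD]] Tcomm]; split.
  split=> [c x y|].
    rewrite -[RHS]/(c *: (S x + T x) + (S y + T y)) scalerDr addrACA.
    by rewrite -Slin -Tlin.
  exists (C + D) => x; rewrite mulrDl (le_trans (ler_normD _ _))//.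
  exact: lerD.
move=> A cA; have [[Alin _] _] := cA; apply/funext => x /=.
rewrite -[LHS]/(A (S x + T x)) -[S x]scale1r Alin scale1r.
by rewrite -[A (S x)]/((A \o S) x) -[A (T x)]/((A \o T) x) Scomm// Tcomm.
Qed.

End TensorFacts.

(* Main.v *)
(* Write q = 2N - 1, t(w) = tau(w(u)) for words w, and let T be the operator
   of the theorem; S_n is the sum of w (x) w^conj over reduced words w of length
   n, so that T S_n = S_{n+1} + q S_{n-1}.  As <(w (x) w^conj)(x (x) x), x (x) x>
   = |<w x, x>|^2 >= 0, moments of T dominate numbers of walks in the 2N-regular
   tree, and ||T|| >= 2 sqrt q always.

   If t vanishes on nontrivial reduced words, then the l2-bound 2 sqrt q for the
   random walk on the tree bounds sum_s f(s) s(u), over words s of length n, by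
   sup|f| (2 sqrt q)^n, first in L^2(tau) and then, tau being faithful, in B(H).
   Hence <T^n v, v> = O((2 sqrt q)^n) for finite tensors v, and ||T|| <= 2 sqrt q.

   Conversely let ||T|| <= 2 sqrt q.  The recursion gives ||S_n|| = O(n q^(n/2)),
   and hence Phi(n) = sum_{|w| = n} |t(w)|^2 = O(n q^(n/2)), as tau is bounded by
   suprema of vector states.  Applying |tau(D)|^2 <= tau(D* D) to
   D = sum_{|w| = n} conj(t(w)) w improves this to Phi(n) = o(n q^(n/2)).
   Conjugation invariance turns such a bound into one for the sums Psi(n) over
   cyclically reduced words: q^(-l/2) Psi(l) tends to 0 on average.  Finally, the
   average of |t((g w g^-1)(h w h^-1)^-1)| over g, h of length n is at least
   |t(w)|^2.  When g and h have distinct first letters these products are distinct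
   cyclically reduced words, so that by Cauchy-Schwarz their contribution is at
   most of order (q^(-l/2) Psi(l))^(1/2); a common first letter cancels, reducing
   n.  Hence t(w) = 0. *)

Require Import Defs.
From mathcomp Require Import all_boot all_order all_algebra sesquilinear complex.
From mathcomp Require Import all_classical all_reals topology normedtype.
From mathcomp Require Import ring lra zify.

Set Implicit Arguments.
Unset Strict Implicit.
Unset Printing Implicit Defensive.

Import Order.TTheory GRing.Theory Num.Theory.
Import numFieldNormedType.Exports.

Local Open Scope classical_set_scope.
Local Open Scope ring_scope.
Local Open Scope complex_scope.

(** * Complex moduli and inner products *)

(** The passage from L^2(tau) to B(H) is made inside the given algebra: positivity of k = B^2 - x* x
    under the trace is tested on b = |k| - k, a norm limit of polynomials in k, and faithfulness
    forces b = 0. The square roots this takes come from an explicit iteration. Normality of tau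
    enters through the two-element net {0, a}, which gives tau a >= 0 for every a in M that is
    positive as a form.

    The factor n in ||S_n|| = O(n q^(n/2)) is that of a double root: the recursion has
    characteristic equation x^2 - T x + q = 0, with T^2 - 4q <= 0. This factor has to be beaten:
    Phi(n) = O(n q^(n/2)) only bounds the averages of q^(-l/2) Psi(l), and the little o is what
    makes them vanish.

    The lower bound for ||T|| pairs moments with a tent-shaped weight, in place of a count of walks;
    the upper bound for the walk is a Schur test with weight q^(-|g|/2). The l2-norms on the free
    group are handled through finite sets of reduced words. *)

Section ComplexModulus.
Context (R : realType).
Implicit Types (z w : R[i]) (c : R).

(** Norms over [R[i]] take values in [R[i]]; [cmod], and later [nm], are their real parts, so that
    inequalities are handled in the real field [R]. *)
Definition cmod z : R := complex.Re `|z|.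

Lemma cmodE z : `|z| = (cmod z)%:C.
Proof. by rewrite /cmod normc_def. Qed.

Lemma cmod_ge0 z : 0 <= cmod z.
Proof. by rewrite -ler0c -cmodE. Qed.

Lemma cmod_sqr z : cmod z ^+ 2 = complex.Re z ^+ 2 + complex.Im z ^+ 2.
Proof. by apply: (@complexI R); rewrite rmorphXn/= -cmodE -add_Re2_Im2. Qed.

Lemma cmodM z w : cmod (z * w) = cmod z * cmod w.
Proof. by apply: (@complexI R); rewrite rmorphM/= -!cmodE normrM. Qed.

Lemma cmodD z w : cmod (z + w) <= cmod z + cmod w.
Proof. by rewrite -lecR rmorphD/= -!cmodE ler_normD. Qed.

Lemma cmodN z : cmod (- z) = cmod z.
Proof. by rewrite /cmod normrN. Qed.

Lemma cmod0 : cmod 0 = 0.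
Proof. by rewrite /cmod normr0. Qed.

Lemma cmod1 : cmod 1 = 1.
Proof. by rewrite /cmod normr1. Qed.

Lemma cmod_conj z : cmod (Num.conj z) = cmod z.
Proof. by rewrite /cmod norm_conjC. Qed.

Lemma cmod_real c : cmod c%:C = `|c|.
Proof. by rewrite /cmod normc_def/= expr0n addr0 sqrtr_sqr. Qed.

Lemma Re_le_md z : complex.Re z <= cmod z.
Proof.
apply: le_trans (ler_norm _) _; rewrite -(ler_pXn2r (n := 2)) ?nnegrE ?cmod_ge0//.
by rewrite cmod_sqr real_normK ?num_real// lerDl sqr_ge0.
Qed.

Lemma cmod_eq0 z : cmod z = 0 -> z = 0.
Proof. by move=> z0; apply/eqP; rewrite -normr_eq0 cmodE z0. Qed.

Lemma mulJ z : Num.conj z * z = (cmod z ^+ 2)%:C.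
Proof. by rewrite mulrC -normCK cmodE rmorphXn. Qed.

Lemma cmod_sum (I : Type) (r : seq I) (P : pred I) (F : I -> R[i]) :
  cmod (\sum_(i <- r | P i) F i) <= \sum_(i <- r | P i) cmod (F i).
Proof.
elim/big_ind2 : _ => [|x1 x2 y1 y2 h1 h2|//]; first by rewrite cmod0.
exact: le_trans (cmodD _ _) (lerD h1 h2).
Qed.

Lemma ReD z w : complex.Re (z + w) = complex.Re z + complex.Re w.
Proof. by case: z w => ? ? [? ?]. Qed.

Lemma ReN z : complex.Re (- z) = - complex.Re z.
Proof. by case: z. Qed.

Lemma ReB z w : complex.Re (z - w) = complex.Re z - complex.Re w.
Proof. by rewrite ReD ReN. Qed.

Lemma Re_conj z : complex.Re (Num.conj z) = complex.Re z.
Proof. by case: z. Qed.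

Lemma Re_realM c z : complex.Re (c%:C * z) = c * complex.Re z.
Proof. by case: z => ? ? /=; rewrite mul0r subr0. Qed.

Lemma Re_sum (I : Type) (r : seq I) (P : pred I) (F : I -> R[i]) :
  complex.Re (\sum_(i <- r | P i) F i) = \sum_(i <- r | P i) complex.Re (F i).
Proof. by elim/big_rec2 : _ => // i x y _ <-; rewrite ReD. Qed.

Lemma conj_realc c : Num.conj (c%:C) = c%:C :> R[i].
Proof. exact: conjc_real. Qed.

Lemma ge0_realc z : 0 <= z -> z = (complex.Re z)%:C.
Proof. by move=> /ger0_Im; case: z => a b /= ->. Qed.

Lemma sumr_CS (I : Type) (r : seq I) (P : pred I) (F G : I -> R) :
  (\sum_(i <- r | P i) F i * G i) ^+ 2 <=
  (\sum_(i <- r | P i) F i ^+ 2) * (\sum_(i <- r | P i) G i ^+ 2).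
Proof.
(* Nonnegativity of both sums of squares rides along, since the induction step uses it. *)
suff H : [&& (\sum_(i <- r | P i) F i * G i) ^+ 2 <=
  (\sum_(i <- r | P i) F i ^+ 2) * (\sum_(i <- r | P i) G i ^+ 2),
  0 <= \sum_(i <- r | P i) F i ^+ 2 & 0 <= \sum_(i <- r | P i) G i ^+ 2].
  by case/and3P: H.
elim: r => [|i r /and3P[IH HF HG]]; first by rewrite !big_nil expr0n mulr0 lexx.
rewrite !big_cons; case: (P i); last by rewrite IH HF HG.
set S := \sum_(j <- _ | _) _ in IH *; set A := \sum_(j <- _ | _) _ in IH HF *.
set B := \sum_(j <- _ | _) _ in IH HG *; set f := F i; set g := G i.
rewrite ?addr_ge0 ?sqr_ge0 ?andbT//.
(* AM-GM: (A g^2 + B f^2)^2 >= 4 A B f^2 g^2 >= (2 S f g)^2. *)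
have h1 : 2 * S * (f * g) <= A * g ^+ 2 + B * f ^+ 2.
  have h0 : 0 <= A * g ^+ 2 + B * f ^+ 2.
    by apply: addr_ge0; apply: mulr_ge0; rewrite ?HF ?HG ?sqr_ge0.
  apply: le_trans (ler_norm _) _.
  rewrite -(ler_pXn2r (n := 2)) ?nnegrE// real_normK ?num_real//.
  have : 4 * (S ^+ 2 * (f * g) ^+ 2) <= 4 * (A * B * (f * g) ^+ 2).
    by rewrite ler_pM2l// ler_wpM2r ?sqr_ge0.
  have := sqr_ge0 (A * g ^+ 2 - B * f ^+ 2).
  nra.
nra.
Qed.

End ComplexModulus.

Section HilbertBasics.
Context (R : realType) (H : hilbertType R).
Implicit Types (x y z : H) (c : R[i]).

Definition ip x y : R[i] := hdot x y.
Definition nm x : R := complex.Re `|x|.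

Lemma ipDl x y z : ip (x + y) z = ip x z + ip y z.
Proof. exact: linearDl. Qed.

Lemma ipZl c x y : ip (c *: x) y = c * ip x y.
Proof. exact: linearZl_LR. Qed.

Lemma ipC x y : ip x y = Num.conj (ip y x).
Proof. by rewrite /ip [LHS](hermC hdot) expr0 mul1r. Qed.

Lemma ipDr x y z : ip x (y + z) = ip x y + ip x z.
Proof. by rewrite ipC ipDl rmorphD/= -!ipC. Qed.

Lemma ipZr c x y : ip x (c *: y) = Num.conj c * ip x y.
Proof. by rewrite ipC ipZl rmorphM/= -!ipC. Qed.

Lemma ip0l x : ip 0 x = 0.
Proof. exact: linear0l. Qed.

Lemma ip0r x : ip x 0 = 0.
Proof. exact: linear0r. Qed.

Lemma ipNl x y : ip (- x) y = - ip x y.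
Proof. exact: linearNl. Qed.

Lemma ipNr x y : ip x (- y) = - ip x y.
Proof. exact: linearNr. Qed.

Lemma ipBl x y z : ip (x - y) z = ip x z - ip y z.
Proof. by rewrite ipDl ipNl. Qed.

Lemma ipBr x y z : ip x (y - z) = ip x y - ip x z.
Proof. by rewrite ipDr ipNr. Qed.

Lemma ip_suml (I : Type) (r : seq I) (P : pred I) (F : I -> H) y :
  ip (\sum_(i <- r | P i) F i) y = \sum_(i <- r | P i) ip (F i) y.
Proof. by elim/big_rec2 : _ => [|i u v _ <-]; rewrite ?ip0l ?ipDl. Qed.

Lemma ip_sumr (I : Type) (r : seq I) (P : pred I) (F : I -> H) y :
  ip y (\sum_(i <- r | P i) F i) = \sum_(i <- r | P i) ip y (F i).
Proof. by elim/big_rec2 : _ => [|i u v _ <-]; rewrite ?ip0r ?ipDr. Qed.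

Lemma nmE x : `|x| = (nm x)%:C.
Proof. by rewrite /nm -ge0_realc. Qed.

Lemma nm_ge0 x : 0 <= nm x.
Proof. by rewrite -ler0c -nmE. Qed.

Lemma ipxx x : ip x x = (nm x ^+ 2)%:C.
Proof. by rewrite /ip hdotE nmE rmorphXn. Qed.

Lemma nm_sqr x : nm x ^+ 2 = complex.Re (ip x x).
Proof. by rewrite ipxx. Qed.

Lemma nm0 : nm 0 = 0.
Proof. by rewrite /nm normr0. Qed.

Lemma nm_eq0 x : nm x = 0 -> x = 0.
Proof. by move=> x0; apply/eqP; rewrite -normr_eq0 nmE x0. Qed.

Lemma nmD x y : nm (x + y) <= nm x + nm y.
Proof. by rewrite -lecR rmorphD/= -!nmE ler_normD. Qed.

Lemma nmN x : nm (- x) = nm x.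
Proof. by rewrite /nm normrN. Qed.

Lemma nmB x y : nm (x - y) <= nm x + nm y.
Proof. by rewrite -(nmN y) nmD. Qed.

Lemma nmZ c x : nm (c *: x) = cmod c * nm x.
Proof. by apply: (@complexI R); rewrite rmorphM/= -cmodE -!nmE normrZ. Qed.

Lemma nm_sum (I : Type) (r : seq I) (P : pred I) (F : I -> H) :
  nm (\sum_(i <- r | P i) F i) <= \sum_(i <- r | P i) nm (F i).
Proof.
elim/big_ind2 : _ => [|x1 x2 y1 y2 h1 h2|//]; first by rewrite nm0.
exact: le_trans (nmD _ _) (lerD h1 h2).
Qed.

Lemma nm_le x (c : R) : 0 <= c -> nm x ^+ 2 <= c ^+ 2 -> nm x <= c.
Proof. by move=> c0; rewrite ler_pXn2r ?nnegrE ?nm_ge0. Qed.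

Lemma cauchy_schwarz x y : cmod (ip x y) <= nm x * nm y.
Proof.
have [y0|y0] := eqVneq (nm y) 0.
  by rewrite (nm_eq0 y0) ip0r cmod0 nm0 mulr0.
have yp : 0 < nm y ^+ 2 by rewrite exprn_gt0// lt_neqAle eq_sym y0 nm_ge0.
pose c := ip x y / (nm y ^+ 2)%:C.
have key : 0 <= nm (x - c *: y) ^+ 2 by rewrite sqr_ge0.
have E : nm (x - c *: y) ^+ 2 = nm x ^+ 2 - cmod (ip x y) ^+ 2 / nm y ^+ 2.
  rewrite nm_sqr ipBl !ipBr ipZl ipZr ipZl ipZr !ipxx.
  have -> : c * (Num.conj c * (nm y ^+ 2)%:C) = c * Num.conj (ip x y).
    congr (_ * _); rewrite /c rmorphM/= fmorphV/= conj_realc mulfVK//.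
    by apply: contraTneq yp => /(@complexI R) ->; rewrite ltxx.
  rewrite -ipC subrr subr0 /c.
  have -> : Num.conj (ip x y / (nm y ^+ 2)%:C) * ip x y =
      (cmod (ip x y) ^+ 2 / nm y ^+ 2)%:C.
    rewrite [RHS]rmorphM/= fmorphV/= rmorphM/= fmorphV/= conj_realc.
    by rewrite mulrAC mulJ.
  by rewrite -rmorphB.
rewrite -(ler_pXn2r (n := 2)) ?nnegrE ?cmod_ge0 ?mulr_ge0 ?nm_ge0//.
by rewrite exprMn -ler_pdivrMr// -subr_ge0 -E.
Qed.

Lemma Re_ip_le x y : complex.Re (ip x y) <= nm x * nm y.
Proof. exact: le_trans (Re_le_md _) (cauchy_schwarz x y). Qed.

Lemma ip_eq x y : (forall z, ip x z = ip y z) -> x = y.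
Proof.
move=> e; apply/eqP; rewrite -subr_eq0; apply/eqP/nm_eq0/eqP.
by rewrite -sqrf_eq0 nm_sqr ipBl e subrr.
Qed.

Lemma nmD_sqr x y :
  nm (x + y) ^+ 2 = nm x ^+ 2 + 2 * complex.Re (ip x y) + nm y ^+ 2.
Proof.
rewrite !nm_sqr ipDl !ipDr !ReD (ipC y x) Re_conj; ring.
Qed.

Lemma nmB_sqr x y :
  nm (x - y) ^+ 2 = nm x ^+ 2 - 2 * complex.Re (ip x y) + nm y ^+ 2.
Proof. by rewrite nmD_sqr nmN ipNr ReN mulrN. Qed.

End HilbertBasics.

(** * Bounded operators and completeness *)

Section LinearMaps.
Context (R : realType) (H K : hilbertType R).
Implicit Types (a b : H -> K).

Lemma lin0 a : linear a -> a 0 = 0.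
Proof. by move=> l; have := l (-1) 0 0; rewrite !scaleN1r oppr0 addr0 addNr. Qed.

Lemma linD a x y : linear a -> a (x + y) = a x + a y.
Proof. by move=> l; have := l 1 x y; rewrite !scale1r. Qed.

Lemma linZ a c x : linear a -> a (c *: x) = c *: a x.
Proof. by move=> l; have := l c x 0; rewrite (lin0 l) !addr0. Qed.

Lemma linN a x : linear a -> a (- x) = - a x.
Proof. by move=> l; rewrite -scaleN1r linZ// scaleN1r. Qed.

Lemma linB a x y : linear a -> a (x - y) = a x - a y.
Proof. by move=> l; rewrite linD// linN. Qed.

Lemma lin_sum a (I : Type) (r : seq I) (P : pred I) (F : I -> H) :
  linear a -> a (\sum_(i <- r | P i) F i) = \sum_(i <- r | P i) a (F i).
Proof.
by move=> l; elim/big_rec2 : _ => [|i u v _ <-]; rewrite ?(lin0 l) ?linD.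
Qed.

(** The constant C in [bounded_op] is complex, but its product with a norm dominates a norm, hence
    is nonnegative, and C may be replaced by its modulus. *)
Lemma bounded_opP a :
  bounded_op a <->
  linear a /\ exists2 C : R, 0 <= C & forall x, nm (a x) <= C * nm x.
Proof.
split=> -[al [C aC]]; split => //.
- exists (cmod C) => [|x]; first exact: cmod_ge0.
  have := aC x; rewrite !nmE => h.
  have h0 : 0 <= C * (nm x)%:C by apply: le_trans h; rewrite ler0c nm_ge0.
  rewrite -lecR rmorphM/= (le_trans h)// -(ger0_norm h0) normrM cmodE.
  by rewrite (ger0_norm (x := (nm x)%:C)) ?ler0c ?nm_ge0.
- by exists C%:C => x; rewrite !nmE -rmorphM/= lecR.
Qed.

End LinearMaps.

Section Completeness.
Context (R : realType) (H : hilbertType R).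

Definition lim_to (s : nat -> H) (l : H) :=
  forall e : R, 0 < e -> exists n0, forall n, (n0 <= n)%N -> nm (l - s n) <= e.

Lemma lim_exists (s : nat -> H) :
  (forall e : R, 0 < e -> exists n0, forall n m, (n0 <= n)%N -> (n0 <= m)%N ->
     nm (s n - s m) <= e) ->
  exists l, lim_to s l.
Proof.
move=> hs.
have cs : cauchy (s @ \oo).
  apply: cauchy_exP => e e0.
  have er : e = (complex.Re e)%:C by apply: ge0_realc; exact: ltW.
  have e1 : 0 < complex.Re e by rewrite -ltcR -er.
  have [n0 hn0] := hs _ (divr_gt0 e1 (ltr0n _ 2)).
  exists (s n0); exists n0 => // n hn.
  rewrite -ball_normE/= nmE er ltcR (le_lt_trans (hn0 n0 n _ _))//.
  lra.
have /cvg_ex[l hl] : cvg (s @ \oo) by exact: cauchy_cvg.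
exists l => e e0.
have e0' : 0 < e%:C :> R[i] by rewrite ltcR.
move/cvgrPdist_le: hl => /(_ _ e0')[n0 _ h].
by exists n0 => n hn; have := h n hn; rewrite /= nmE lecR.
Qed.

End Completeness.

(** * Square roots of positive operators *)

Section Sqrt.
Context (R : realType) (H : hilbertType R).
Implicit Types (a b x : H -> H) (v w : H).

(** The scalar model of the operator iteration: nondecreasing and bounded by 1, hence Cauchy, with
    increments that majorise those of the operators. *)
Fixpoint sqrt_bound (n : nat) : R :=
  if n is n'.+1 then (1 + sqrt_bound n' ^+ 2) / 2 else 0.

Lemma sqrt_bound_ge0 n : 0 <= sqrt_bound n.
Proof.
by elim: n => //= n IH; rewrite divr_ge0// addr_ge0// exprn_ge0.
Qed.

Lemma sqrt_bound_le1 n : sqrt_bound n <= 1.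
Proof.
elim: n => //= n IH; have := sqrt_bound_ge0 n; nra.
Qed.

Lemma sqrt_bound_nd :
  {homo sqrt_bound : m n / (m <= n)%N >-> m <= n}.
Proof.
apply: homo_leq (@lexx _ R) le_trans _ => n /=.
have := sqr_ge0 (1 - sqrt_bound n); nra.
Qed.

Lemma sqrt_bound_cauchy (e : R) : 0 < e ->
  exists n0, forall n, (n0 <= n)%N -> sqrt_bound n - sqrt_bound n0 <= e.
Proof.
move=> e0.
have hs : has_sup (range sqrt_bound).
  split; first by exists (sqrt_bound 0), 0%N.
  by exists 1 => _ [n _ <-]; exact: sqrt_bound_le1.
have [_ [n0 _ <-] hn0] := sup_adherent e0 hs.
exists n0 => n _; rewrite lerBlDr.
have : sqrt_bound n <= sup (range sqrt_bound).
  by apply: sup_upper_bound => //; exists n.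
lra.
Qed.

(* If [r] is the limit of this iteration then [(1 - r)^2 = 1 - x]; all iterates
   are polynomials in [x] with nonnegative coefficients, so that they are
   controlled in norm by their values at [x = 1]. *)
Fixpoint sqrt_iter x (n : nat) : H -> H :=
  if n is n'.+1 then
    fun v => (2^-1 : R[i]) *: (x v + sqrt_iter x n' (sqrt_iter x n' v))
  else 0.

Variable x : H -> H.
Hypothesis xlin : linear x.
Hypothesis xcontr : forall v, nm (x v) <= nm v.
Hypothesis xsa : forall v w, ip (x v) w = ip v (x w).

Local Notation r := (sqrt_iter x).

Lemma sqrt_iter_lin n : linear (r n).
Proof.
elim: n => [|n IH] c u v /=; first by rewrite scaler0 addr0.
rewrite !IH xlin scalerA mulrC -scalerA -scalerDr; congr (_ *: _).
by rewrite scalerDr addrACA.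
Qed.

Lemma sqrt_iter_comm c : linear c -> (forall v, c (x v) = x (c v)) ->
  forall n v, c (r n v) = r n (c v).
Proof.
move=> cl cx; elim=> [|n IH] v /=; first exact: lin0.
by rewrite linZ// linD// cx !IH.
Qed.

Lemma sqrt_iter_sa n v w : ip (r n v) w = ip v (r n w).
Proof.
elim: n v w => [|n IH] v w /=; first by rewrite ip0l ip0r.
rewrite ipZl ipZr fmorphV/= conjC_nat ipDl ipDr xsa !IH//.
Qed.

Lemma cmod_half : cmod (2^-1 : R[i]) = 2^-1.
Proof.
have -> : (2^-1 : R[i]) = (2^-1 : R)%:C by rewrite fmorphV/= rmorph_nat.
by rewrite cmod_real ger0_norm// invr_ge0.
Qed.

Lemma sqrt_iter_nm n v : nm (r n v) <= sqrt_bound n * nm v.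
Proof.
elim: n v => [|n IH] v /=; first by rewrite nm0 mul0r.
rewrite nmZ cmod_half mulrC mulrAC ler_pM2r ?invr_gt0//.
apply: le_trans (nmD _ _) _; rewrite mulrDl mul1r lerD//.
apply: le_trans (IH _) _; rewrite expr2 -mulrA.
by rewrite ler_wpM2l ?sqrt_bound_ge0.
Qed.

(** The identity a^2 - b^2 = (a - b) a + b (a - b) holds for operator iterates and scalar iterates
    alike, so the bound propagates from one increment to the next. *)
Lemma sqrt_iter_stepS n v :
  nm (r n.+1 v - r n v) <= (sqrt_bound n.+1 - sqrt_bound n) * nm v.
Proof.
elim: n v => [|n IH] v.
  rewrite [r 0 v]/= [sqrt_bound 0]/= !subr0.
  exact: sqrt_iter_nm.
have -> : r n.+2 v - r n.+1 v =
    (2^-1 : R[i]) *: ((r n.+1 (r n.+1 v) - r n (r n.+1 v)) +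
                      (r n (r n.+1 v) - r n (r n v))).
  have E k : r k.+1 v = (2^-1 : R[i]) *: (x v + r k (r k v)) by [].
  rewrite {1}E [in X in _ - X]E -scalerBr; congr (_ *: _).
  by rewrite opprD addrACA subrr add0r subrKA.
rewrite nmZ cmod_half -(linB _ _ (@sqrt_iter_lin n)).
have h1 := IH (r n.+1 v).
have h2 := sqrt_iter_nm n (r n.+1 v - r n v).
have h3 := IH v.
have h4 := sqrt_iter_nm n.+1 v.
have h5 := nmD (r n.+1 (r n.+1 v) - r n (r n.+1 v)) (r n (r n.+1 v - r n v)).
have d0 : 0 <= sqrt_bound n.+1 - sqrt_bound n.
  by rewrite subr_ge0; apply: sqrt_bound_nd.
have s0 := sqrt_bound_ge0 n.
have -> : sqrt_bound n.+2 - sqrt_bound n.+1 =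
   ((sqrt_bound n.+1 - sqrt_bound n) * sqrt_bound n.+1
   + sqrt_bound n * (sqrt_bound n.+1 - sqrt_bound n)) / 2.
  have -> : sqrt_bound n.+2 = (1 + sqrt_bound n.+1 ^+ 2) / 2 by [].
  have : sqrt_bound n.+1 = (1 + sqrt_bound n ^+ 2) / 2 by [].
  move: (sqrt_bound n.+1) (sqrt_bound n) => t1 t0 E; nra.
set tn := sqrt_bound n in d0 s0 h1 h2 h3 *.
set tn1 := sqrt_bound n.+1 in d0 h1 h3 h4 *.
have k1 := ler_wpM2l d0 h4.
have k2 := ler_wpM2l s0 h3.
nra.
Qed.

Lemma sqrt_iter_step n m v : (n <= m)%N ->
  nm (r m v - r n v) <= (sqrt_bound m - sqrt_bound n) * nm v.
Proof.
elim: m => [|m IH]; first by rewrite leqn0 => /eqP ->; rewrite !subrr mul0r nm0.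
rewrite leq_eqVlt => /orP[/eqP ->|]; first by rewrite !subrr mul0r nm0.
rewrite ltnS => /IH h.
rewrite -(subrKA (r m v)) -(subrKA (sqrt_bound m)) mulrDl.
exact: le_trans (nmD _ _) (lerD (sqrt_iter_stepS _ _) h).
Qed.

Lemma sqrt_iter_contr n v : nm (r n v) <= nm v.
Proof.
apply: le_trans (sqrt_iter_nm _ _) _.
by rewrite ler_piMl ?nm_ge0// sqrt_bound_le1.
Qed.

Lemma sqrt_iter_cauchy (e : R) : 0 < e -> exists n0, forall n m v,
  (n0 <= n)%N -> (n0 <= m)%N -> nm (r n v - r m v) <= e * nm v.
Proof.
move=> e0; have [n0 hn0] := sqrt_bound_cauchy (divr_gt0 e0 (ltr0n _ 2)).
exists n0 => n m v hn hm.
have aux k : (n0 <= k)%N -> nm (r k v - r n0 v) <= e / 2 * nm v.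
  move=> hk; apply: le_trans (sqrt_iter_step _ hk) _.
  by rewrite ler_wpM2r ?nm_ge0// hn0.
rewrite -(subrKA (r n0 v)) (le_trans (nmD _ _))// -(nmN (r n0 v - _)) opprB.
have := aux n hn; have := aux m hm; have := nm_ge0 v; nra.
Qed.

Lemma sqrt_lim : exists s : H -> H, forall e : R, 0 < e ->
  exists n0, forall n, (n0 <= n)%N -> forall v, nm (s v - r n v) <= e * nm v.
Proof.
have hc v : exists l, lim_to (fun n => r n v) l.
  apply: lim_exists => e e0.
  have v0 : 0 < nm v + 1 by rewrite ltr_wpDl ?nm_ge0.
  have [n0 hn0] := sqrt_iter_cauchy (divr_gt0 e0 v0).
  exists n0 => n m hn hm; apply: le_trans (hn0 n m v hn hm) _.
  by rewrite mulrAC ler_pdivrMr// ler_pM2l// lerDl.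
have [s hs] := choice hc.
exists s => e e0.
have [n0 hn0] := sqrt_iter_cauchy e0.
exists n0 => n hn v; apply/ler_addgt0Pr => d d0.
have [n1 hn1] := hs v d d0.
have := hn0 (maxn n0 n1) n v (leq_maxl _ _) hn.
have := hn1 _ (leq_maxr n0 n1).
have := nmD (s v - r (maxn n0 n1) v) (r (maxn n0 n1) v - r n v).
rewrite subrKA; lra.
Qed.

Lemma le0_eq (y : H) : (forall e : R, 0 < e -> nm y <= e) -> y = 0.
Proof.
move=> h; apply: nm_eq0; apply/eqP; rewrite eq_le nm_ge0 andbT.
by apply/ler_addgt0Pr => e e0; rewrite add0r h.
Qed.

(** Operator-norm limits of self-adjoint contractions from A. Linearity, contractivity and
    self-adjointness pass to s, and expressions in s can be approximated within A. *)
Definition uniform_limit (A : set (H -> H)) (s : H -> H) :=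
  forall e : R, 0 < e -> exists a, [/\ A a, linear a,
    forall v, nm (a v) <= nm v, forall v w, ip (a v) w = ip v (a w)
    & forall v, nm (s v - a v) <= e * nm v].

(** The equation reads (1 - s)^2 = 1 - x. What commutes with x commutes with s, because the iterates
    are polynomials in x. *)
Lemma contraction_sqrt (A : set (H -> H)) :
  (forall (c : R[i]) a b, A a -> A b -> A (c *: a + b)) ->
  (forall a b, A a -> A b -> A (a \o b)) -> A 0 -> A x ->
  exists s : H -> H, [/\ uniform_limit A s, 
    forall v, s v + s v = x v + s (s v)
    & forall (c : H -> H), bounded_op c -> (forall v, c (x v) = x (c v)) ->
      forall v, c (s v) = s (c v)].
Proof.
move=> AD AM A0 Ax; have [s hs] := sqrt_lim.
have Ar n : A (r n).
  elim: n => //= n IH.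
  have -> : (fun v => (2^-1 : R[i]) *: (x v + r n (r n v))) =
      (2^-1 : R[i]) *: ((1 : R[i]) *: x + (r n \o r n)) + 0.
    apply/funext => v.
    rewrite -[RHS]/((2^-1 : R[i]) *: ((1 : R[i]) *: x v + r n (r n v)) + 0).
    by rewrite scale1r addr0.
  by apply: (AD) => //; apply: (AD) => //; apply: (AM).
have sn v : nm (s v) <= nm v.
  apply/ler_addgt0Pr => d d0.
  have v0 : 0 < nm v + 1 by rewrite ltr_wpDl ?nm_ge0.
  have [n0 hn0] := hs _ (divr_gt0 d0 v0).
  have h1 := hn0 n0 (leqnn _) v.
  have h2 : d / (nm v + 1) * nm v <= d.
    by rewrite mulrAC ler_pdivrMr// ler_pM2l// lerDl.
  have := nmD (s v - r n0 v) (r n0 v); rewrite subrK => h3.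
  have := sqrt_iter_contr n0 v; lra.
exists s; split.
- move=> e e0; have [n0 hn0] := hs e e0; exists (r n0); split.
  + exact: Ar.
  + exact: sqrt_iter_lin.
  + exact: sqrt_iter_contr.
  + exact: sqrt_iter_sa.
  + exact: hn0.
- move=> v; apply/eqP; rewrite -subr_eq0; apply/eqP/le0_eq => e e0.
  have v0 : 0 < nm v + 1 by rewrite ltr_wpDl ?nm_ge0.
  have e1 : 0 < e / 4 / (nm v + 1) by rewrite !divr_gt0.
  have [n0 hn0] := hs _ e1.
  have b w : nm w <= nm v -> e / 4 / (nm v + 1) * nm w <= e / 4.
    move=> wv; rewrite mulrAC ler_pdivrMr// ler_pM2l ?divr_gt0//.
    by rewrite (le_trans wv)// lerDl.
  have E : r n0.+1 v + r n0.+1 v = x v + r n0 (r n0 v).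
    rewrite /= -scalerDl.
    have -> : (2^-1 + 2^-1 : R[i]) = 1 by field.
    by rewrite scale1r.
  (* Subtracting the relation [E] between consecutive iterates leaves four errors of size at most e
     / 4, the last one under the contraction [r n0]. *)
  have -> : s v + s v - (x v + s (s v)) =
     ((s v - r n0.+1 v) + (s v - r n0.+1 v)) - (s (s v) - r n0 (s v)) -
     (r n0 (s v) - r n0 (r n0 v)).
    rewrite [X in _ = X - _ - _]addrACA -(opprD (r n0.+1 v)) E.
    rewrite -[RHS]addrA -(opprD (s (s v) - _)) subrKA -[RHS]addrA -opprD.
    by congr (_ - _); rewrite addrACA subrr addr0.
  rewrite -(linB _ _ (@sqrt_iter_lin n0)).
  have h1 := le_trans (hn0 n0.+1 (leqnSn _) v) (b v (lexx _)).
  have h2 := le_trans (hn0 n0 (leqnn _) (s v)) (b _ (sn v)).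
  have h3 := le_trans (hn0 n0 (leqnn _) v) (b _ (lexx _)).
  have h4 := le_trans (sqrt_iter_contr n0 (s v - r n0 v)) h3.
  apply: le_trans (nmB _ _) _; apply: le_trans (lerD (nmB _ _) (lexx _)) _.
  have := nmD (s v - r n0.+1 v) (s v - r n0.+1 v); lra.
- move=> c /bounded_opP[cl [C C0 hC]] cx v.
  apply/eqP; rewrite -subr_eq0; apply/eqP/le0_eq => e e0.
  pose D := C * nm v + nm (c v) + 1.
  have D0 : 0 < D by rewrite ltr_wpDl// addr_ge0 ?nm_ge0// mulr_ge0 ?nm_ge0.
  have [n0 hn0] := hs _ (divr_gt0 e0 D0).
  have -> : c (s v) - s (c v) = c (s v - r n0 v) - (s (c v) - r n0 (c v)).
    by rewrite linB// (sqrt_iter_comm cl cx) opprB addrA subrK.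
  apply: le_trans (nmB _ _) _.
  have h1 := le_trans (hC _) (ler_wpM2l C0 (hn0 n0 (leqnn _) v)).
  have h2 := hn0 n0 (leqnn _) (c v).
  apply: le_trans (lerD h1 h2) _.
  have -> : C * (e / D * nm v) + e / D * nm (c v) = e / D * (D - 1).
    by rewrite /D; ring.
  rewrite mulrAC ler_pdivrMr// ler_pM2l//; lra.
Qed.

End Sqrt.

(** * Traces on von Neumann algebras *)

Section VonNeumann.
Context (R : realType) (H : hilbertType R) (M : set (H -> H)).
Hypothesis hM : von_neumann M.
Implicit Types (a b : H -> H) (v w : H).

Lemma vn_bounded a : M a -> bounded_op a.
Proof. by rewrite -hM.2 => -[]. Qed.

Lemma vn_lin a : M a -> linear a.
Proof. by case/vn_bounded. Qed.

Lemma vn_adj a : M a -> M (adj a).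
Proof. by move=> /hM.1[b Mb ab]; rewrite (adjE ab). Qed.

Lemma vn_adjP a : M a -> forall v w, ip (a v) w = ip v (adj a w).
Proof. by move=> /hM.1[b Mb ab] v w; rewrite (adjE ab); exact: ab. Qed.

Lemma vn_adjP' a : M a -> forall v w, ip (adj a v) w = ip v (a w).
Proof. by move=> Ma v w; rewrite ipC -vn_adjP// -ipC. Qed.

Lemma adj_eq a b : (forall v w, ip (a v) w = ip v (b w)) -> adj a = b.
Proof. by move=> ab; apply: adjE. Qed.

Lemma vn_adjK a : M a -> adj (adj a) = a.
Proof. by move=> Ma; apply: adj_eq; exact: vn_adjP'. Qed.

Lemma vn_id : M id.
Proof.
rewrite -hM.2; split.
  by split=> //; exists 1 => v; rewrite mul1r.
by move=> b _; apply/funext.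
Qed.

Lemma vn_comp a b : M a -> M b -> M (a \o b).
Proof.
move=> Ma Mb; have [al [C C0 hC]] := (bounded_opP _).1 (vn_bounded Ma).
have [bl [D D0 hD]] := (bounded_opP _).1 (vn_bounded Mb).
move: (Ma) (Mb); rewrite -{1 2 3}hM.2 => -[_ ca] [_ cb].
split.
  apply/bounded_opP; split; first by move=> c v w /=; rewrite bl al.
  exists (C * D) => [|v]; first exact: mulr_ge0.
  by rewrite -mulrA (le_trans (hC _))// ler_wpM2l.
move=> c cM; apply/funext => v /=.
by rewrite -[c (a _)]/((c \o a) _) ca// /= -[c (b _)]/((c \o b) _) cb.
Qed.

Lemma vn_linear (c : R[i]) a b : M a -> M b -> M (c *: a + b).
Proof.
move=> Ma Mb; have [al [C C0 hC]] := (bounded_opP _).1 (vn_bounded Ma).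
have [bl [D D0 hD]] := (bounded_opP _).1 (vn_bounded Mb).
move: (Ma) (Mb); rewrite -{1 2 3}hM.2 => -[_ ca] [_ cb].
split.
  apply/bounded_opP; split.
    move=> d v w; rewrite -[LHS]/(c *: a (d *: v + w) + b (d *: v + w)).
    rewrite -[RHS]/(d *: (c *: a v + b v) + (c *: a w + b w)).
    rewrite bl al !scalerDr !scalerA (mulrC d c) addrACA//.
  exists (cmod c * C + D) => [|v]; first by rewrite addr_ge0// mulr_ge0// cmod_ge0.
  rewrite mulrDl (le_trans (nmD _ _))// lerD// nmZ -mulrA.
  by rewrite ler_wpM2l ?cmod_ge0.
move=> d dM; have dl : linear d by case: dM => -[].
apply/funext => v; rewrite -[LHS]/(d (c *: a v + b v)).
rewrite -[RHS]/(c *: a (d v) + b (d v)) dl.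
by rewrite -[d (a _)]/((d \o a) _) ca// -[d (b _)]/((d \o b) _) cb.
Qed.

Lemma vn_zero : M 0.
Proof.
have := vn_linear (-1) vn_id vn_id.
have -> // : (-1 : R[i]) *: (id : H -> H) + id = 0.
by apply/funext => v; rewrite -[LHS]/((-1 : R[i]) *: v + v) scaleN1r addNr.
Qed.

(** Norm closedness is read off the bicommutant: an operator commuting with M commutes with the
    approximants, hence with s up to arbitrarily small error. *)
Lemma vn_limit s :
  linear s ->
  (forall e : R, 0 < e -> exists2 a, M a & forall v, nm (s v - a v) <= e * nm v) ->
  M s.
Proof.
move=> sl hs.
rewrite -hM.2; split.
  apply/bounded_opP; split => //.
  have [a Ma ha] := hs 1 ltr01.
  have [_ [C C0 hC]] := (bounded_opP _).1 (vn_bounded Ma).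
  exists (1 + C) => [|v]; first by rewrite addr_ge0.
  rewrite -(subrK (a v) (s v)) mulrDl (le_trans (nmD _ _))// lerD// ha.
move=> b cb; have /bounded_opP[bl [D D0 hD]] := cb.1.
apply/funext => v /=; apply/eqP; rewrite -subr_eq0; apply/eqP/le0_eq => e e0.
pose K := D * nm v + nm (b v) + 1.
have K0 : 0 < K by rewrite ltr_wpDl// addr_ge0 ?nm_ge0// mulr_ge0 ?nm_ge0.
have [a Ma ha] := hs _ (divr_gt0 e0 K0).
have ab w : a (b w) = b (a w) by rewrite -[LHS]/((a \o b) w) cb.2.
have -> : b (s v) - s (b v) = b (s v - a v) - (s (b v) - a (b v)).
  by rewrite linB// ab opprB addrA subrK.
apply: le_trans (nmB _ _) _.
apply: le_trans (lerD (le_trans (hD _) (ler_wpM2l D0 (ha v))) (ha (b v))) _.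
have -> : D * (e / K * nm v) + e / K * nm (b v) = e / K * (K - 1).
  by rewrite /K; ring.
rewrite mulrAC ler_pdivrMr// ler_pM2l//; lra.
Qed.

Lemma vn_adj_id : adj (id : H -> H) = id.
Proof. by apply: adj_eq. Qed.

Lemma vn_adj_comp a b : M a -> M b -> adj (a \o b) = adj b \o adj a.
Proof. by move=> Ma Mb; apply: adj_eq => v w /=; rewrite !vn_adjP. Qed.

Lemma vn_adj_linear (c : R[i]) a b : M a -> M b ->
  adj (c *: a + b) = Num.conj c *: adj a + adj b.
Proof.
move=> Ma Mb; apply: adj_eq => v w.
rewrite -[LHS]/(ip (c *: a v + b v) w).
rewrite -[RHS]/(ip v (Num.conj c *: adj a w + adj b w)).
by rewrite ipDl ipZl ipDr ipZr conjCK !vn_adjP.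
Qed.

Lemma vn_star_algebra : unital_star_algebra M.
Proof.
by split; [exact: vn_id | exact: vn_linear | exact: vn_comp | exact: vn_adj].
Qed.

End VonNeumann.

Section Trace.
Context (R : realType) (H : hilbertType R) (M : set (H -> H)).
Hypothesis hM : von_neumann M.
Variable tau : (H -> H) -> R[i].
Hypothesis htau : normal_faithful_tracial_state M tau.
Implicit Types (a b k : H -> H) (v w : H).

Let M0 := vn_zero hM.
Let M1 := vn_id hM.

Lemma tauD a b : M a -> M b -> tau (a + b) = tau a + tau b.
Proof.
move=> Ma Mb; have := trace_linear htau 1 Ma Mb.
by rewrite scale1r mul1r.
Qed.

Lemma tau0 : tau 0 = 0.
Proof.
have := tauD M0 M0; rewrite addr0 => /eqP.
by rewrite -subr_eq0 opprD addrA subrr add0r oppr_eq0 => /eqP.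
Qed.

Lemma tauZ (c : R[i]) a : M a -> tau (c *: a) = c * tau a.
Proof.
move=> Ma; have := trace_linear htau c Ma M0.
by rewrite tau0 !addr0.
Qed.

(** [trace_ge0] only speaks of products b* b. For an operator that is positive as a form, normality
    is applied to the directed set {0, a}: its supremum is a, so tau a is an upper bound of tau 0 =
    0. *)
Lemma tau_pos a : M a -> (forall v, 0 <= ip (a v) v) -> 0 <= tau a.
Proof.
move=> Ma a0.
have := trace_normal htau (S := [set b | b = 0 \/ b = a]) (s := a).
have h0 b v : hdot (b v - (0 : H -> H) v) v = ip (b v) v.
  by rewrite -[(0 : H -> H) v]/(0 : H) subr0.
case; last by move=> u _; rewrite -tau0; apply: u; exists 0 => //; left.
- by exists 0; left.
- move=> b [->|->]; split => // v; rewrite h0//.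
  by rewrite -[(0 : H -> H) v]/(0 : H) ip0l.
- have le00 v : 0 <= ip 0 v :> R[i] by rewrite ip0l.
  have le0a : op_le 0 a by move=> v; rewrite h0.
  have leaa b : op_le b b by move=> v; rewrite subrr; exact: le00.
  move=> b c [->|->] [->|->].
  + by exists 0; split => //; left.
  + by exists a; split => //; right.
  + by exists a; split => //; right.
  + by exists a; split => //; right.
- split=> // [b [->|->]|c _ h].
  + by move=> v; rewrite h0.
  + by move=> v; rewrite subrr -[hdot _ _]/(ip 0 v) ip0l.
  + by apply: h; right.
Qed.

(** Positivity of tau at (c + a)* (c + a), for arbitrary c: the values 1 and i yield [tau_adj], the
    value - tau a yields [tau_CS]. *)
Lemma tau_shift_ge0 (c : R[i]) a : M a ->
  0 <= (cmod c ^+ 2)%:C +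
       (Num.conj c * tau a + (c * tau (adj a) + tau (adj a \o a))).
Proof.
move=> Ma; have Ma' := vn_adj hM Ma.
have Mc : M (c *: id + a) := vn_linear hM c M1 Ma.
have E : adj (c *: id + a) \o (c *: id + a) =
    (Num.conj c * c) *: id + (Num.conj c *: a + (c *: adj a + (adj a \o a))).
  rewrite (vn_adj_linear hM)// (vn_adj_id H); apply/funext => v.
  rewrite -[LHS]/(Num.conj c *: (c *: v + a v) + adj a (c *: v + a v)).
  rewrite -[RHS]/((Num.conj c * c) *: v +
    (Num.conj c *: a v + (c *: adj a v + adj a (a v)))).
  have l := vn_lin hM Ma'.
  by rewrite (linD _ _ l) (linZ _ _ l) scalerDr scalerA !addrA.
have := trace_ge0 htau Mc; rewrite E.
have Mx := vn_comp hM Ma' Ma.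
have M2 := vn_linear hM c Ma' Mx.
have M3 := vn_linear hM (Num.conj c) Ma M2.
by rewrite !(trace_linear htau)// (trace_id htau) mulr1 mulJ.
Qed.

Lemma tau_adj a : M a -> tau (adj a) = Num.conj (tau a).
Proof.
move=> Ma; have key (c : R[i]) : complex.Im (Num.conj c * tau a + c * tau (adj a)) = 0.
  have := ger0_Im (tau_shift_ge0 c Ma).
  have /ge0_realc -> := trace_ge0 htau Ma.
  set z := Num.conj c * _; set w := c * _; clearbody z w.
  by case: z w => ? ? [? ?] /=; rewrite addr0 add0r.
have := key 1; have := key 'i.
rewrite rmorph1 !mul1r; clear key.
case: (tau a) (tau (adj a)) => x y [x' y'] /=.
move=> h1 h2.
by apply/eqP; rewrite eq_complex/=; apply/andP; split; apply/eqP; lra.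
Qed.

Lemma tau_CS a : M a -> cmod (tau a) ^+ 2 <= complex.Re (tau (adj a \o a)).
Proof.
move=> Ma; have := tau_shift_ge0 (- tau a) Ma.
rewrite tau_adj// rmorphN/= !mulNr (mulrC (tau a)) !mulJ cmodN lecE => /andP[_].
by rewrite !ReD !ReN/=; lra.
Qed.

(** The form of K^2 - a* a is nonnegative, so [tau_pos] bounds the right side of [tau_CS] by K^2. *)
Lemma tau_bounded a (K : R) : M a -> 0 <= K ->
  (forall v, nm (a v) <= K * nm v) -> cmod (tau a) <= K.
Proof.
move=> Ma K0 aK; rewrite -(ler_pXn2r (n := 2)) ?nnegrE ?cmod_ge0//.
apply: le_trans (tau_CS Ma) _.
have Mx := vn_comp hM (vn_adj hM Ma) Ma.
have Mb : M ((-1) *: (adj a \o a) + (K ^+ 2)%:C *: id).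
  by apply: vn_linear => //; rewrite -[_ *: id]addr0; apply: vn_linear.
have : 0 <= tau ((-1) *: (adj a \o a) + (K ^+ 2)%:C *: id).
  apply: tau_pos => // v.
  rewrite -[X in ip X]/((-1) *: adj a (a v) + (K ^+ 2)%:C *: v).
  rewrite ipDl !ipZl (vn_adjP' hM)// !ipxx mulN1r addrC -rmorphM -rmorphB/=.
  rewrite ler0c subr_ge0 -exprMn lerXn2r ?nnegrE ?mulr_ge0 ?nm_ge0//.
rewrite (trace_linear htau)//; last first.
  by rewrite -[_ *: id]addr0; apply: vn_linear.
rewrite tauZ// (trace_id htau) mulr1 mulN1r lecE => /andP[_].
by rewrite ReD ReN/=; lra.
Qed.

End Trace.

(** * From positivity under the trace to positivity on the Hilbert space *)

Section UniformLimit.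
Context (R : realType) (H : hilbertType R) (A : set (H -> H)) (s : H -> H).
Hypothesis hs : uniform_limit A s.

Lemma uniform_limit_contr v : nm (s v) <= nm v.
Proof.
apply/ler_addgt0Pr => d d0.
have v0 : 0 < nm v + 1 by rewrite ltr_wpDl ?nm_ge0.
have [a [_ _ ac _ sa]] := hs (divr_gt0 d0 v0).
have h2 : d / (nm v + 1) * nm v <= d.
  by rewrite mulrAC ler_pdivrMr// ler_pM2l// lerDl.
have := nmD (s v - a v) (a v); rewrite subrK => h3.
have := sa v; have := ac v; lra.
Qed.

Lemma uniform_limit_lin : linear s.
Proof.
move=> c u w; apply/eqP; rewrite -subr_eq0; apply/eqP/le0_eq => e e0.
pose K := nm (c *: u + w) + cmod c * nm u + nm w + 1.
have K0 : 0 < K.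
  by rewrite ltr_wpDl// !addr_ge0 ?mulr_ge0 ?nm_ge0 ?cmod_ge0.
have [a [_ al _ _ sa]] := hs (divr_gt0 e0 K0).
have -> : s (c *: u + w) - (c *: s u + s w) =
   (s (c *: u + w) - a (c *: u + w)) - (c *: (s u - a u) + (s w - a w)).
  rewrite al scalerBr [in RHS]addrACA -opprD opprB [RHS]addrA.
  by rewrite -(addrA (s _)) addNr addr0.
apply: le_trans (nmB _ _) _.
apply: le_trans (lerD (sa _) (nmD _ _)) _; rewrite nmZ.
apply: le_trans (lerD (lexx _) (lerD (ler_wpM2l (cmod_ge0 c) (sa u)) (sa w))) _.
set X := nm (c *: u + w).
have -> : e / K * X + (cmod c * (e / K * nm u) + e / K * nm w) = e / K * (K - 1).
  by rewrite /K -/X; ring.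
rewrite mulrAC ler_pdivrMr// ler_pM2l//; lra.
Qed.

Lemma uniform_limit_sa v w : ip (s v) w = ip v (s w).
Proof.
apply/eqP; rewrite -subr_eq0; apply/eqP/cmod_eq0/eqP.
rewrite eq_le cmod_ge0 andbT; apply/ler_addgt0Pr => e e0; rewrite add0r.
pose K := 2 * (nm v * nm w) + 1.
have K0 : 0 < K by rewrite ltr_wpDl// !mulr_ge0 ?nm_ge0.
have [a [_ _ _ aa sa]] := hs (divr_gt0 e0 K0).
have -> : ip (s v) w - ip v (s w) = ip (s v - a v) w - ip v (s w - a w).
  by rewrite ipBl ipBr aa opprB addrA subrK.
apply: le_trans (cmodD _ _) _; rewrite cmodN.
apply: le_trans (lerD (cauchy_schwarz _ _) (cauchy_schwarz _ _)) _.
apply: le_trans (lerD (ler_wpM2r (nm_ge0 _) (sa v))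
                      (ler_wpM2l (nm_ge0 _) (sa w))) _.
have -> : e / K * nm v * nm w + nm v * (e / K * nm w) = e / K * (K - 1).
  by rewrite /K; ring.
rewrite mulrAC ler_pdivrMr// ler_pM2l//; lra.
Qed.

End UniformLimit.

Lemma subB2 (V : zmodType) (v p q : V) : v - p - (p - q) = v - (p + p) + q.
Proof. by rewrite opprB (addrC q) addrA opprD addrA. Qed.

Section Positivity.
Context (R : realType) (H : hilbertType R) (M : set (H -> H)).
Hypothesis hM : von_neumann M.
Variable tau : (H -> H) -> R[i].
Hypothesis htau : normal_faithful_tracial_state M tau.
Variable A : set (H -> H).
Hypothesis hA : unital_star_algebra A.
Hypothesis AM : A `<=` M.
Implicit Types (a b k : H -> H) (v w : H).

Let A0 : A 0.
Proof.
have [A1 Al _ _] := hA; have := Al (-1) _ _ A1 A1.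
have -> // : (-1 : R[i]) *: (id : H -> H) + id = 0.
by apply/funext => v; rewrite -[LHS]/((-1 : R[i]) *: v + v) scaleN1r addNr.
Qed.

(** Used twice: with B = A for a first root s, which is a norm limit of A and may lie outside it,
    and then with B = M for a root built from s. *)
Lemma sa_sqrt (B : set (H -> H)) x : unital_star_algebra B -> B `<=` M ->
  B x -> (forall v, nm (x v) <= nm v) -> (forall v w, ip (x v) w = ip v (x w)) ->
  exists s, [/\ M s, uniform_limit B s,
    forall v, s v + s v = x v + s (s v)
    & forall c, M c -> (forall v, c (x v) = x (c v)) ->
      forall v, c (s v) = s (c v)].
Proof.
move=> [B1 Bl Bc _] BM Bx xc xa.
have B0 : B 0.
  have := Bl (-1) _ _ B1 B1.
  have -> // : (-1 : R[i]) *: (id : H -> H) + id = 0.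
  by apply/funext => v; rewrite -[LHS]/((-1 : R[i]) *: v + v) scaleN1r addNr.
have [s [ls s2 sc]] := contraction_sqrt (vn_lin hM (BM _ Bx)) xc xa Bl Bc B0 Bx.
exists s; split => //.
- apply: (vn_limit hM (uniform_limit_lin ls)) => e e0.
  by have [a [Ba _ _ _ sa]] := ls e e0; exists a => //; exact: BM.
- by move=> c Mc; apply: sc; exact: (vn_bounded hM).
Qed.

Lemma contraction_pos k : A k -> (forall v, nm (k v) <= nm v) ->
  (forall v w, ip (k v) w = ip v (k w)) ->
  (forall b, A b -> 0 <= complex.Re (tau (adj b \o (k \o b)))) ->
  forall v, 0 <= complex.Re (ip (k v) v).
Proof.
move=> Ak kc ka kpos; have [A1 Al Ac As] := hA.
have Mk := AM Ak; have kl := vn_lin hM Mk.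
(* Chosen so that (1 - s)^2 = 1 - x = k^2. *)
pose x : H -> H := (-1) *: (k \o k) + id.
have xE v : x v = v - k (k v).
  by rewrite -[LHS]/((-1) *: k (k v) + v) scaleN1r addrC.
have Ax : A x by apply: (Al) => //; exact: Ac.
have xc v : nm (x v) <= nm v.
  rewrite xE; apply: nm_le; first exact: nm_ge0.
  rewrite nmB_sqr -ka -nm_sqr.
  have : nm (k (k v)) ^+ 2 <= nm (k v) ^+ 2 by rewrite lerXn2r ?nnegrE ?nm_ge0.
  have := sqr_ge0 (nm (k v)); lra.
have xa v w : ip (x v) w = ip v (x w) by rewrite !xE ipBl ipBr !ka.
have [s [Ms ls s2 sc]] := sa_sqrt hA AM Ax xc xa.
have sl := uniform_limit_lin ls; have scn := uniform_limit_contr ls.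
have ssa := uniform_limit_sa ls.
(* A second root, (1 - s')^2 = 1 - s, exhibits 1 - s as the square of a self-adjoint operator. *)
have [s' [Ms' ls' s2' sc']] :=
  sa_sqrt (vn_star_algebra hM) (@subset_refl _ M) Ms scn ssa.
have s'sa := uniform_limit_sa ls'; have s'l := uniform_limit_lin ls'.
have ks v : k (s v) = s (k v).
  by apply: sc => // w; rewrite !xE linB.
pose z : H -> H := (-1) *: s' + id.
pose y v : H := v - s v.
have zE v : z v = v - s' v.
  by rewrite -[LHS]/((-1) *: s' v + v) scaleN1r addrC.
have zz v : z (z v) = y v.
  by rewrite !zE linB// /y subB2 s2' opprD addrA subrK.
have yy v : y (y v) = k (k v).
  rewrite /y (linB _ _ sl) subB2 s2 opprD addrA subrK xE.
  by rewrite opprB addrC subrK.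
have za v w : ip (z v) w = ip v (z w) by rewrite !zE ipBl ipBr s'sa.
pose b : H -> H := (-1) *: (s + k) + id.
have bE v : b v = y v - k v.
  rewrite -[LHS]/((-1) *: (s v + k v) + v) scaleN1r opprD.
  by rewrite addrC addrA.
have Msk : M (s + k) by rewrite -[s]scale1r; apply: vn_linear.
have Mb : M b by apply: vn_linear => //; exact: vn_id.
have Mz : M z by apply: vn_linear => //; exact: vn_id.
have ba v w : ip (b v) w = ip v (b w).
  by rewrite !bE /y !ipBl !ipBr ssa ka.
have ky v : k (y v) = y (k v) by rewrite /y linB// ks.
have yl u w : y (u - w) = y u - y w.
  by rewrite /y (linB _ _ sl) !opprD !opprK !addrA (addrAC u).
have kb v : k (b v) = - y (b v).
  by rewrite !bE linB// yl ky yy opprB.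
have Mzb : M (z \o b) := vn_comp hM Mz Mb.
have Mbkb : M (b \o (k \o b)) by do 2 apply: vn_comp => //.
have E : adj (z \o b) \o (z \o b) = (-1) *: (b \o (k \o b)).
  rewrite (vn_adj_comp hM)// (adj_eq ba) (adj_eq za).
  apply/funext => v.
  rewrite -[LHS]/(b (z (z (b v)))) -[RHS]/((-1) *: b (k (b v))).
  by rewrite zz kb (linN _ (vn_lin hM Mb)) scaleN1r opprK.
have pos : 0 <= complex.Re (tau (b \o (k \o b))).
  apply/ler_addgt0Pr => e e0.
  (* b may lie outside A, so bn = 1 - a - k replaces it, with a in A close to s. As bn k bn - b k b
     = bn k (s - a) + (s - a) k b and b, bn have norm at most 3, precision e / 6 suffices. *)
  have [a [Aa al ac aa sa]] := ls _ (divr_gt0 e0 (ltr0n _ 6)).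
  pose bn : H -> H := (-1) *: (1 *: a + k) + id.
  have bnE v : bn v = b v + (s v - a v).
    rewrite -[LHS]/((-1) *: (1 *: a v + k v) + v) scale1r.
    rewrite bE /y scaleN1r [RHS]addrACA subrK -(opprD (k v)) addrC.
    by rewrite (addrC (a v)).
  have Abn : A bn by apply: (Al) => //; apply: (Al).
  have Mbn := AM Abn.
  have bna v w : ip (bn v) w = ip v (bn w).
    by rewrite !bnE (ipDl (b v)) (ipDr v (b w)) ipBl ipBr ba ssa aa.
  have := kpos _ Abn; rewrite (adj_eq bna) => h.
  have bnn v : nm (bn v) <= 3 * nm v.
    rewrite -[bn v]/((-1) *: (1 *: a v + k v) + v) scale1r scaleN1r.
    apply: le_trans (nmD _ _) _; rewrite nmN.
    have := nmD (a v) (k v); have := ac v; have := kc v; lra.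
  have bnb v : nm (b v) <= 3 * nm v.
    rewrite bE /y; apply: le_trans (nmB _ _) _.
    have := nmB v (s v); have := scn v; have := kc v; lra.
  have Mbnkbn : M (bn \o (k \o bn)) by do 2 apply: vn_comp => //.
  have Md : M ((-1) *: (b \o (k \o b)) + (bn \o (k \o bn))).
    exact: vn_linear.
  suff /(tau_bounded hM htau Md (ltW e0)) :
      forall v, nm (((-1) *: (b \o (k \o b)) + (bn \o (k \o bn))) v) <= e * nm v.
    rewrite (trace_linear htau)// mulN1r => h2.
    have := Re_le_md (- tau (b \o (k \o b)) + tau (bn \o (k \o bn))).
    by rewrite ReD ReN; lra.
  move=> v; rewrite -[X in nm X]/((-1) *: b (k (b v)) + bn (k (bn v))).
  have -> : (-1 : R[i]) *: b (k (b v)) + bn (k (bn v)) =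
      bn (k (s v - a v)) + (s (k (b v)) - a (k (b v))).
    rewrite scaleN1r (bnE v) (linD _ _ kl) (linD _ _ (vn_lin hM Mbn)).
    by rewrite (bnE (k (b v))) -(addrA (b (k (b v)))) addKr addrC.
  apply: le_trans (nmD _ _) _.
  have h1 := bnn (k (s v - a v)).
  have h2 := kc (s v - a v).
  have h3 := sa v.
  have h4 := sa (k (b v)).
  have h5 := kc (b v); have h6 := bnb v; have h7 := nm_ge0 v.
  have h8 : e / 6%:R * nm (k (b v)) <= e / 6%:R * (3 * nm v).
    by rewrite ler_wpM2l ?(le_trans h5 h6)// divr_ge0// ltW.
  lra.
have t0 : tau (adj (z \o b) \o (z \o b)) = 0.
  have p := trace_ge0 htau Mzb.
  rewrite (ge0_realc p) E (tauZ hM htau)// mulN1r ReN.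
  move: p; rewrite E (tauZ hM htau)// mulN1r lecE ReN/= => /andP[_ p].
  by have -> : complex.Re (tau (b \o (k \o b))) = 0; [lra|rewrite oppr0].
have zb0 v : z (b v) = 0.
  by have := trace_faithful htau Mzb t0 => /(congr1 (fun f => f v)).
have bv0 v : b v = 0.
  apply: nm_eq0; apply/eqP; rewrite -sqrf_eq0 nm_sqr -ba.
  have -> : b (b v) = 0.
    have yb : y (b v) = 0 by rewrite -zz zb0 lin0//; exact: (vn_lin hM Mz).
    by rewrite bE kb yb oppr0 subr0.
  by rewrite ip0l.
move=> v; have : k v = z (z v).
  by rewrite zz; apply/esym/eqP; rewrite -subr_eq0 -bE bv0.
by move=> ->; rewrite za -nm_sqr sqr_ge0.
Qed.

(** The bridge from L^2(tau) to H: the hypothesis says tau(b* k b) >= 0 for k = B^2 - x* x, and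
    [contraction_pos] makes the form of k nonnegative. Test elements from A suffice because the
    square roots involved are limits of polynomials in k. *)
Lemma tau_norm_bound x (B : R) : A x -> 0 <= B ->
  (forall b, A b -> complex.Re (tau (adj (x \o b) \o (x \o b))) <=
     B ^+ 2 * complex.Re (tau (adj b \o b))) ->
  forall v, nm (x v) <= B * nm v.
Proof.
move=> Ax B0 hx; have [A1 Al Ac As] := hA.
have Mx := AM Ax; have Mx' := vn_adj hM Mx.
pose k0 : H -> H := (-1) *: (adj x \o x) + ((B ^+ 2)%:C *: id + 0).
have k0E v : k0 v = (B ^+ 2)%:C *: v - adj x (x v).
  rewrite -[LHS]/((-1) *: adj x (x v) + ((B ^+ 2)%:C *: v + 0)).
  by rewrite addr0 scaleN1r addrC.
have Ak0 : A k0 by apply: (Al); [apply: (Ac) => //; exact: As | exact: Al].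
have [_ [K K0 hK]] := (bounded_opP _).1 (vn_bounded hM (AM Ak0)).
have K1 : 0 < K + 1 by rewrite ltr_wpDl.
(* Scaled into a contraction, as [contraction_pos] asks; K + 1 is positive even when K = 0. *)
pose k : H -> H := ((K + 1)^-1)%:C *: k0 + 0.
have kE v : k v = ((K + 1)^-1)%:C *: k0 v.
  by rewrite -[LHS]/(((K + 1)^-1)%:C *: k0 v + 0) addr0.
have Ak : A k by apply: (Al).
have k0a v w : ip (k0 v) w = ip v (k0 w).
  rewrite !k0E ipBl ipBr ipZl ipZr conj_realc.
  by rewrite (vn_adjP' hM Mx) -(vn_adjP hM Mx).
have ka v w : ip (k v) w = ip v (k w).
  by rewrite !kE ipZl ipZr conj_realc k0a.
have kc v : nm (k v) <= nm v.
  rewrite kE nmZ cmod_real ger0_norm ?invr_ge0 ?(ltW K1)// ler_pdivrMl//.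
  by apply: le_trans (hK v) _; rewrite ler_wpM2r ?nm_ge0// lerDl.
have kpos b : A b -> 0 <= complex.Re (tau (adj b \o (k \o b))).
  move=> Ab; have Mb := AM Ab; have Mb' := vn_adj hM Mb.
  have Mxb := vn_comp hM Mx Mb.
  have M2 := vn_comp hM (vn_adj hM Mxb) Mxb.
  have M3 := vn_comp hM Mb' Mb.
  have -> : adj b \o (k \o b) = ((K + 1)^-1)%:C *:
      ((-1) *: (adj (x \o b) \o (x \o b)) + (B ^+ 2)%:C *: (adj b \o b)).
    rewrite (vn_adj_comp hM)//; apply/funext => v.
    rewrite -[LHS]/(adj b (k (b v))).
    rewrite -[RHS]/(((K + 1)^-1)%:C *:
      ((-1) *: adj b (adj x (x (b v))) + (B ^+ 2)%:C *: adj b (b v))).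
    have l := vn_lin hM Mb'.
    rewrite kE k0E (linZ _ _ l) (linB _ _ l) (linZ _ _ l) scaleN1r.
    by congr (_ *: _); exact: addrC.
  have M4 : M ((B ^+ 2)%:C *: (adj b \o b)).
    rewrite -[_ *: _]addr0; apply: vn_linear => //; exact: vn_zero.
  rewrite (tauZ hM htau); last exact: vn_linear.
  rewrite (trace_linear htau)// (tauZ hM htau)// Re_realM.
  rewrite mulr_ge0// ?invr_ge0 ?(ltW K1)//.
  by rewrite ReD mulN1r ReN Re_realM; have := hx b Ab; lra.
move=> v; apply: nm_le; first by rewrite mulr_ge0 ?nm_ge0.
have := contraction_pos Ak kc ka kpos v.
rewrite kE ipZl Re_realM pmulr_rge0 ?invr_gt0//.
rewrite k0E ipBl ipZl (vn_adjP' hM Mx) ReB Re_realM -!nm_sqr.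
by rewrite exprMn; lra.
Qed.

End Positivity.

(** * Reduced words *)

Section Words.
Variable I : finType.

(* (i, true) stands for the i-th generator and (i, false) for its inverse *)
Definition letter : finType := (I * bool)%type.
Implicit Types (a b : letter) (w v : seq letter).

Definition linv a : letter := (a.1, ~~ a.2).
Definition winv w : seq letter := rev (map linv w).

Lemma linvK : involutive linv.
Proof. by case=> i b; rewrite /linv /= negbK. Qed.

Lemma linv_neq a : linv a != a.
Proof. by case: a => i [] ; rewrite /linv xpair_eqE eqxx. Qed.

Lemma winvK : involutive winv.
Proof.
by move=> w; rewrite /winv map_rev revK -map_comp map_id_in// => a _ /=; exact: linvK.
Qed.

Lemma winv_cons a w : winv (a :: w) = rcons (winv w) (linv a).
Proof. by rewrite /winv /= rev_cons. Qed.

Lemma size_winv w : size (winv w) = size w.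
Proof. by rewrite size_rev size_map. Qed.

Definition ok a w := if w is b :: _ then a != linv b else true.

Fixpoint reduced w := if w is a :: w' then ok a w' && reduced w' else true.


Lemma ok_cat a w v : ok a (w ++ v) = if w is [::] then ok a v else ok a w.
Proof. by case: w. Qed.

Lemma reduced_cat_cons w a v :
  reduced (w ++ a :: v) = reduced (rcons w a) && reduced (a :: v).
Proof.
elim: w => [|b w IH]; first by rewrite andbA.
rewrite /= IH ok_cat -cats1 ok_cat -andbA; congr (_ && _).
Qed.

Lemma reduced_rcons2 w a b :
  reduced (rcons (rcons w a) b) = reduced (rcons w a) && (a != linv b).
Proof. by rewrite -!cats1 -catA /= reduced_cat_cons -cats1/= andbT. Qed.

Lemma reduced_winv w : reduced (winv w) = reduced w.
Proof.
elim: w => //= a w IH; rewrite winv_cons; case: w IH => //= b w.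
by rewrite winv_cons reduced_rcons2 => ->; rewrite linvK andbC (eq_sym a).
Qed.

(** The suffix x serves two purposes: empty, it gives the sphere of radius n; otherwise it gives the
    prefixes g of length n for which g x is reduced. *)
Fixpoint sphere_pre x (n : nat) : seq (seq letter) :=
  if n is n'.+1 then
    flatten [seq [seq a :: w | a <- enum letter & ok a (w ++ x)]
            | w <- sphere_pre x n']
  else [:: [::]].

Definition sphere := sphere_pre [::].

Lemma mem_sphere_pre x n w : reduced x ->
  (w \in sphere_pre x n) = reduced (w ++ x) && (size w == n).
Proof.
move=> rx; elim: n w => [|n IH] w /=.
  by rewrite inE; case: w => [|a w]; rewrite ?rx//= andbF.
apply/flatten_mapP/idP => [[v]|].
  rewrite IH => /andP[rv /eqP sv] /mapP[a]; rewrite mem_filter => /andP[av _] ->.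
  by rewrite /= av rv sv eqxx.
case: w => [|a w]/=; first by rewrite andbF.
rewrite eqSS => /andP[/andP[aw rw] sw]; exists w; first by rewrite IH rw.
by apply: map_f; rewrite mem_filter aw mem_enum.
Qed.

Lemma mem_sphere n w : (w \in sphere n) = reduced w && (size w == n).
Proof. by rewrite mem_sphere_pre// cats0. Qed.

Lemma sphere_pre_uniq x n : uniq (sphere_pre x n).
Proof.
elim: n => //= n IH; set F := fun w => _.
have hF w v : w \in F v -> behead w = v by move=> /mapP[a _ ->].
have : forall w, uniq (F w).
  by move=> w; rewrite /F map_inj_uniq; [exact: filter_uniq (enum_uniq _)|by move=> a b []].
elim: (sphere_pre x n) IH => //= v s IH /andP[vs us] uF.
rewrite cat_uniq uF IH// andbT /=; apply/hasPn => w /flatten_mapP[v' v's /hF wv'].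
by apply/negP => /hF wv; move: vs; rewrite -wv wv' v's.
Qed.

Lemma big_sphere_pre (T : nmodType) x n (F : seq letter -> T) :
  \sum_(w <- sphere_pre x n.+1) F w =
  \sum_(w <- sphere_pre x n) \sum_(a | ok a (w ++ x)) F (a :: w).
Proof.
rewrite big_flatten big_map; apply: eq_bigr => w _.
by rewrite big_map big_filter big_enum_cond.
Qed.

Lemma big_sphere_pre_exch (T : nmodType) x n (F : seq letter -> T) :
  \sum_(w <- sphere_pre x n.+1) F w =
  \sum_a \sum_(w <- sphere_pre x n | ok a (w ++ x)) F (a :: w).
Proof. by rewrite big_sphere_pre (exchange_big_dep predT). Qed.

Lemma big_sphere (T : nmodType) n (F : seq letter -> T) :
  \sum_(w <- sphere n.+1) F w = \sum_(w <- sphere n) \sum_(a | ok a w) F (a :: w).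
Proof. by rewrite /sphere big_sphere_pre; apply: eq_bigr => w _; rewrite cats0. Qed.

Lemma card_letter : #|letter| = (2 * #|I|)%N.
Proof. by rewrite card_prod card_bool mulnC. Qed.

Definition branching : nat := #|letter|.-1.
Local Notation q := branching.

Lemma card_neq a : #|[pred b | b != a]| = q.
Proof. by rewrite /branching -(cardC1 a). Qed.

Lemma card_ok a w : #|[pred b | ok b (a :: w)]| = q.
Proof. by rewrite -(card_neq (linv a)); apply: eq_card. Qed.

(** A nonempty suffix already restricts the first letter added to q choices, whereas a full sphere
    starts with q + 1. *)
Lemma size_sphere_pre x n : x != [::] -> size (sphere_pre x n) = (q ^ n)%N.
Proof.
case: x => // a x _; elim: n => //= n IH.
rewrite size_flatten /shape -map_comp sumnE big_map expnSr -IH.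
rewrite -sum1_size big_distrl/=; apply: eq_bigr => w _.
rewrite mul1n size_map -sum1_size big_filter big_enum_cond sum1_card.
by case: w => [|b w] /=; rewrite ?(card_ok a x) ?(card_ok b (w ++ a :: x)).
Qed.

End Words.

Lemma ler_sum_sub (R : numDomainType) (T : eqType) (s1 s2 : seq T) (F : T -> R) :
  (forall x, 0 <= F x) -> uniq s1 -> {subset s1 <= s2} ->
  \sum_(x <- s1) F x <= \sum_(x <- s2) F x.
Proof.
move=> F0; elim: s1 s2 => [|x s1 IH] s2 /=.
  by move=> _ _; rewrite big_nil sumr_ge0.
move=> /andP[xs us] sub; rewrite big_cons.
have xs2 : x \in s2 by apply: sub; rewrite mem_head.
rewrite (perm_big _ (perm_to_rem xs2)) big_cons lerD2l; apply: IH => // y ys1.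
have : y \in s2 by apply: sub; rewrite inE ys1 orbT.
rewrite (perm_mem (perm_to_rem xs2)) inE => /orP[/eqP yx|//].
by rewrite -yx ys1 in xs.
Qed.

(** * Characters of the free group of subcritical growth *)

Lemma sqrt_le (R : realType) (x y : R) : 0 <= y -> x <= y ^+ 2 -> Num.sqrt x <= y.
Proof.
by move=> y0 xy; rewrite -[leRHS]ger0_norm// -sqrtr_sqr; exact: ler_wsqrtr.
Qed.

Lemma archi_false (R : realType) (a B : R) :
  0 < a -> ~ (forall k : nat, a * k%:R <= B).
Proof.
move=> a0 h; have B0 : 0 <= B by have := h 0%N; rewrite mulr0.
have := archi_boundP (divr_ge0 B0 (ltW a0)).
by rewrite ltr_pdivrMr// mulrC ltNge h.
Qed.

Section Rho.
Variables (R : realType) (I : finType).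
Local Notation q := (branching I).
Local Notation rho := (Num.sqrt (q%:R : R)).

Lemma rho2 : rho ^+ 2 = q%:R.
Proof. by rewrite sqr_sqrtr ?ler0n. Qed.

Hypothesis I2 : (2 <= #|I|)%N.

Lemma q_ge3 : 3 <= (q%:R : R).
Proof. by rewrite (ler_nat R 3) /branching card_letter; move: #|I| I2; lia. Qed.

(** This value is what the constant 3 in [sum_rho] rests on: the induction there needs 3 <= 2
    rho. *)
Lemma rho_gt : 3 / 2 <= rho.
Proof.
have := rho2; have := q_ge3; have := sqrtr_ge0 (q%:R : R); nra.
Qed.

Lemma rho_gt0 : 0 < rho.
Proof. by have := rho_gt; lra. Qed.

Lemma rhoX_gt0 n : 0 < rho ^+ n.
Proof. by rewrite exprn_gt0// rho_gt0. Qed.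

End Rho.

Section Character.
Variables (R : realType) (I : finType).
Local Notation letter := (letter I).
Local Notation q := (branching I).
Variable t : seq letter -> R[i].
Implicit Types (v w : seq letter).

Local Notation m w := (cmod (t w)).

Definition Phi n : R := \sum_(w <- sphere I n) m w ^+ 2.

Definition cyc (w : seq letter) :=
  if w is a :: w' then last a w' != linv a else true.

Definition Psi n : R := \sum_(w <- sphere I n | cyc w) m w ^+ 2.

Lemma Phi_ge0 n : 0 <= Phi n.
Proof. by apply: sumr_ge0 => w _; exact: sqr_ge0. Qed.

Lemma Psi_ge0 n : 0 <= Psi n.
Proof. by apply: sumr_ge0 => w _; exact: sqr_ge0. Qed.

(** Cauchy-Schwarz over pairs: the weights contribute at most (sum f^2)^2 and, phi being injective
    on pairs, the values at phi v w form part of the sum over T. *)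
Lemma pair_CS (s T : seq (seq letter)) (P : rel (seq letter))
    (f : seq letter -> R) (phi : seq letter -> seq letter -> seq letter)
    (Q : pred (seq letter)) :
  uniq s ->
  {in s &, forall v w, P v w -> (phi v w \in T) && Q (phi v w)} ->
  {in s & s, forall v w, {in s & s, forall v' w', phi v w = phi v' w' -> v = v' /\ w = w'}} ->
  \sum_(v <- s) \sum_(w <- s | P v w) f v * f w * m (phi v w) <=
  (\sum_(w <- s) f w ^+ 2) * Num.sqrt (\sum_(w <- T | Q w) m w ^+ 2).
Proof.
move=> us hT inj.
set F2 := \sum_(w <- s) f w ^+ 2; set S := \sum_(w <- T | Q w) _.
have S0 : 0 <= S by apply: sumr_ge0 => w _; exact: sqr_ge0.
have F0 : 0 <= F2 by apply: sumr_ge0 => w _; exact: sqr_ge0.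
pose pairs := [seq p <- [seq (v, w) | v <- s, w <- s] | P p.1 p.2].
have sumE (G : seq letter * seq letter -> R) :
    \sum_(v <- s) \sum_(w <- s | P v w) G (v, w) = \sum_(p <- pairs) G p.
  rewrite big_filter [RHS]big_mkcond big_allpairs_dep/=.
  by apply: eq_bigr => v _; rewrite big_mkcond.
rewrite (sumE (fun p => f p.1 * f p.2 * m (phi p.1 p.2))).
apply: le_trans (ler_norm _) _.
rewrite -(ler_pXn2r (n := 2)) ?nnegrE ?mulr_ge0 ?sqrtr_ge0//.
rewrite real_normK ?num_real// exprMn sqr_sqrtr//.
apply: le_trans (sumr_CS _ _ _ _) _; apply: ler_pM.
- by apply: sumr_ge0 => p _; exact: sqr_ge0.
- by apply: sumr_ge0 => p _; exact: sqr_ge0.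
- rewrite -(sumE (fun p => (f p.1 * f p.2) ^+ 2)) expr2 mulr_suml.
  apply: ler_sum => v _; rewrite mulr_sumr [leRHS](bigID (P v))/=.
  rewrite -[leLHS]addr0; apply: lerD.
    by apply: ler_sum => w _; rewrite exprMn.
  by apply: sumr_ge0 => w _; rewrite mulr_ge0 ?sqr_ge0.
- rewrite -[leRHS]big_filter -[leLHS](big_map (fun p => phi p.1 p.2) xpredT (fun x => m x ^+ 2)).
  apply: ler_sum_sub => [x||x]; first by rewrite sqr_ge0.
  + rewrite map_inj_in_uniq; last first.
      move=> [v w] [v' w']; rewrite !mem_filter/= => /andP[_ /allpairsP[[v1 w1]/= [h1 h2 [-> ->]]]].
      move=> /andP[_ /allpairsP[[v2 w2]/= [h3 h4 [-> ->]]]] e.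
      by have [-> ->] := inj _ _ h1 h2 _ _ h3 h4 e.
    apply: filter_uniq; apply: allpairs_uniq => //.
    by move=> [a b] [c d] _ _ [-> ->].
  + move=> /mapP[[v w]]; rewrite mem_filter/= => /andP[Pvw /allpairsP[[v1 w1]/= [h1 h2 [e1 e2]]]] ->.
    rewrite mem_filter; subst v1 w1.
    by have /andP[-> ->] := hT _ _ h1 h2 Pvw.
Qed.

Hypothesis t_trace : forall v w, t (v ++ w) = t (w ++ v).
Hypothesis t_cancel : forall a w, t (a :: linv a :: w) = t w.
(** For D = sum f(w) w this is |tau(D)|^2 <= tau(D* D) with absolute values taken inside the double
    sum. *)
Hypothesis t_pd : forall (s : seq (seq letter)) (f : seq letter -> R[i]),
  cmod (\sum_(w <- s) f w * t w) ^+ 2 <=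
  \sum_(v <- s) \sum_(w <- s) cmod (f v) * cmod (f w) * m (winv v ++ w).
Hypothesis t_nil : t [::] = 1.
Hypothesis t_le1 : forall w, m w <= 1.

Definition hd_neq (v w : seq letter) :=
  if v is a :: _ then if w is b :: _ then a != b else true else true.

Lemma t_cancel_common a v w : t (winv (a :: v) ++ a :: w) = t (winv v ++ w).
Proof.
rewrite winv_cons -cats1 -catA t_trace /= -{2}(linvK a) t_cancel.
by rewrite t_trace.
Qed.

Lemma winv_cat_inj n (v w v' w' : seq letter) : size v = n -> size v' = n ->
  winv v ++ w = winv v' ++ w' -> v = v' /\ w = w'.
Proof.
move=> sv sv' /eqP; rewrite eqseq_cat ?size_winv ?sv// => /andP[/eqP e /eqP ->].
by rewrite -(winvK v) e winvK.
Qed.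

Lemma reduced_winv_cat v w : reduced v -> reduced w -> hd_neq v w ->
  reduced (winv v ++ w).
Proof.
case: v => // a v rv rw; case: w rw => [|b w] rw /= ab.
  by rewrite cats0 reduced_winv.
rewrite reduced_cat_cons rw andbT winv_cons reduced_rcons2 -winv_cons.
rewrite reduced_winv rv/=.
by apply: contraNneq ab => /(can_inj (@linvK _)) ->.
Qed.

Definition Qf n (f : seq letter -> R) : R :=
  \sum_(v <- sphere I n) \sum_(w <- sphere I n) f v * f w * m (winv v ++ w).

(** Pairs with distinct first letters give distinct reduced words v^-1 w of length 2n, treated by
    [pair_CS]. A common first letter cancels and leaves pairs of length n - 1; splitting f by first
    letter preserves the total l2-weight, so the bounds add up over j. *)
Lemma Qf_bound n f : (forall w, 0 <= f w) ->
  Qf n f <= (\sum_(w <- sphere I n) f w ^+ 2) *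
            \sum_(0 <= j < n.+1) Num.sqrt (Phi (2 * j)).
Proof.
elim: n f => [|n IH] f f0.
  rewrite /Qf /Phi !big_seq1/= !t_nil cmod1 mulr1 expr1n sqrtr1.
  by rewrite mulr1 expr2.
have off : \sum_(v <- sphere I n.+1) \sum_(w <- sphere I n.+1 | hd_neq v w)
    f v * f w * m (winv v ++ w) <=
    (\sum_(w <- sphere I n.+1) f w ^+ 2) * Num.sqrt (Phi (2 * n.+1)).
  rewrite /Phi; apply: pair_CS; first exact: sphere_pre_uniq.
  - move=> v w; rewrite !mem_sphere => /andP[rv /eqP sv] /andP[rw /eqP sw] vw.
    rewrite size_cat size_winv sv sw mul2n -addnn eqxx !andbT.
    exact: reduced_winv_cat.
  - move=> v w; rewrite mem_sphere => /andP[_ /eqP sv] _ v' w'.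
    by rewrite mem_sphere => /andP[_ /eqP sv'] _; apply: winv_cat_inj sv sv'.
(* The part of f on words beginning with a, that letter removed. *)
pose fa a w := if ok a w then f (a :: w) else 0.
have diag : \sum_(v <- sphere I n.+1) \sum_(w <- sphere I n.+1 | ~~ hd_neq v w)
    f v * f w * m (winv v ++ w) = \sum_a Qf n (fa a).
  rewrite /sphere big_sphere_pre_exch; apply: eq_bigr => a _.
  rewrite /Qf [RHS](bigID (fun v => ok a (v ++ [::])))/= [X in _ = _ + X]big1 ?addr0.
    apply: eq_bigr => v av; rewrite big_mkcond big_sphere_pre_exch/=.
    rewrite (bigD1 a)//= [X in _ + X]big1 ?addr0; last first.
      by move=> b ba; rewrite big1// => w _; rewrite eq_sym ba.
    rewrite eqxx/= big_mkcond; apply: eq_bigr => w _.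
    rewrite /fa; move: av; rewrite !cats0 => ->; case: ifP => aw.
      by rewrite t_cancel_common.
    by rewrite mulr0 mul0r.
  move=> v /negbTE av; rewrite big1// => w _; move: av.
  by rewrite cats0 /fa => ->; rewrite !mul0r.
have -> : Qf n.+1 f = \sum_(v <- sphere I n.+1) \sum_(w <- sphere I n.+1 | hd_neq v w)
    f v * f w * m (winv v ++ w) + \sum_a Qf n (fa a).
  rewrite -diag -big_split/=; apply: eq_bigr => v _.
  by rewrite (bigID (hd_neq v)).
rewrite big_nat_recr//= mulrDr addrC; apply: lerD => //.
have -> : \sum_(w <- sphere I n.+1) f w ^+ 2 =
    \sum_a \sum_(w <- sphere I n) fa a w ^+ 2.
  rewrite /sphere big_sphere_pre_exch; apply: eq_bigr => a _; rewrite big_mkcond.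
  by apply: eq_bigr => w _; rewrite /fa cats0; case: ifP => //; rewrite expr0n.
rewrite mulr_suml; apply: ler_sum => a _; apply: IH => w.
by rewrite /fa; case: ifP.
Qed.

(** For f the conjugate of t, the left side of [t_pd] is Phi(n)^2 and the l2-weight in [Qf_bound] is
    Phi(n). The gain is in the square root: from Phi(2j) = O(j rho^(2j)) follows Phi(n) = O(n^(1/2)
    rho^n). *)
Lemma Phi_le_sum n : Phi n <= \sum_(0 <= j < n.+1) Num.sqrt (Phi (2 * j)).
Proof.
set S := \sum_(0 <= j < _) _.
have S0 : 0 <= S by rewrite sumr_ge0// => j _; rewrite sqrtr_ge0.
have [->//|P0] := eqVneq (Phi n) 0.
have Pp : 0 < Phi n by rewrite lt_neqAle eq_sym P0 Phi_ge0.
rewrite -(ler_pM2l Pp).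
apply: le_trans (@Qf_bound n (fun w => m w) (fun w => cmod_ge0 _)).
have := t_pd (sphere I n) (fun w => Num.conj (t w)).
have -> : \sum_(w <- sphere I n) Num.conj (t w) * t w = (Phi n)%:C.
  by rewrite rmorph_sum/=; apply: eq_bigr => w _; rewrite mulJ.
rewrite cmod_real ger0_norm ?Phi_ge0// expr2 => h; apply: le_trans h _.
by apply: ler_sum => v _; apply: ler_sum => w _; rewrite !cmod_conj.
Qed.

Lemma t_conj b w : t (b :: rcons w (linv b)) = t w.
Proof.
by rewrite -cats1 -cat_cons t_trace /= -{2}(linvK b) t_cancel.
Qed.

(** For reduced nonempty w, these are the letters b such that b w b^-1 is reduced; for empty w the
    default of [last] makes it false. *)
Definition ext b w := ok b w && (b != last b w).

(** The two forbidden letters, the inverse of the first letter of w and its last letter, coincide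
    exactly when w is not cyclically reduced. *)
Lemma card_ext w : w != [::] ->
  (q%:R - (cyc w)%:R : R) <= #|[pred b | ext b w]|%:R.
Proof.
case: w => // a w _; rewrite /ext /=.
have e : #|[pred b | b != linv a]| = q := card_neq _.
case: (boolP (last a w != linv a)) => [h|/negPn/eqP h].
- rewrite lerBlDr -natrD ler_nat -e (cardD1 (last a w)).
  rewrite addnC; apply: leq_add; last exact: leq_b1.
  by apply: eq_leq; apply: eq_card => b; rewrite !inE andbC.
- rewrite subr0 ler_nat -e.
  by apply: eq_leq; apply: eq_card => b; rewrite !inE h andbb.
Qed.

(** Conjugating w of length n + 1 by the letters of [ext] produces pairwise distinct words of length
    n + 3 that are not cyclically reduced, with the same value of t; [card_ext] counts them. *)
Lemma Phi_step n : Psi n.+3 + q%:R * Phi n.+1 - Psi n.+1 <= Phi n.+3.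
Proof.
have hE : \sum_(w <- sphere I n.+1) \sum_(b | ext b w) m w ^+ 2 <=
    \sum_(w <- sphere I n.+3 | ~~ cyc w) m w ^+ 2.
  pose E := [seq p.2 :: rcons p.1 (linv p.2) | p <-
    [seq p <- [seq (w, b) | w <- sphere I n.+1, b <- enum letter] | ext p.2 p.1]].
  have -> : \sum_(w <- sphere I n.+1) \sum_(b | ext b w) m w ^+ 2 =
      \sum_(x <- E) m x ^+ 2.
    rewrite big_map big_filter [RHS]big_mkcond big_allpairs_dep/=.
    apply: eq_bigr => w _; rewrite big_enum/= big_mkcond.
    by apply: eq_bigr => b _; rewrite t_conj.
  rewrite -[leRHS]big_filter; apply: ler_sum_sub => [x||x]; first exact: sqr_ge0.
    rewrite map_inj_uniq.
      apply: filter_uniq; apply: allpairs_uniq.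
      - exact: sphere_pre_uniq.
      - exact: enum_uniq.
      - by move=> [a b] [c d] _ _ [-> ->].
    move=> [w b] [w' b'] /= [e1 /rcons_inj[e2 _]].
    by rewrite e1 e2; reflexivity.
  move=> /mapP[[w b]]; rewrite mem_filter/= => /andP[bw].
  move=> /allpairsP[[w1 b1]/= [h1 _ [e1 e2]]] ->; subst w1 b1.
  move: h1; rewrite mem_sphere => /andP[rw /eqP sw].
  case: w sw rw bw => // a w [sw] rw /andP[h1 h2].
  have : reduced (rcons (a :: w) (linv b)).
    by rewrite lastI reduced_rcons2 -lastI linvK rw eq_sym.
  rewrite mem_filter mem_sphere/= last_rcons eqxx/= size_rcons sw eqxx andbT => ->.
  by rewrite andbT.
rewrite /Phi [leRHS](bigID (@cyc))/= -/(Psi n.+3) -addrA lerD2l.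
apply: le_trans _ hE.
rewrite mulr_sumr /Psi [X in _ - X]big_mkcond -sumrB big_seq [leRHS]big_seq.
apply: ler_sum => w; rewrite mem_sphere => /andP[_ /eqP sw].
have w0 : w != [::] by case: w sw.
rewrite sumr_const -[leRHS]mulr_natl.
apply: le_trans (ler_wpM2r (sqr_ge0 _) (card_ext w0)).
by rewrite mulrBl; case: cyc; rewrite ?mul1r ?mul0r.
Qed.

Lemma t_cancel_mid u a v : t (u ++ linv a :: a :: v) = t (u ++ v).
Proof. by rewrite t_trace /= -{2}(linvK a) t_cancel t_trace. Qed.

Lemma cat_sandwich (a b c : letter) v w :
  (a :: rcons v b) ++ (c :: rcons w b) = a :: rcons (v ++ b :: c :: w) b.
Proof. by rewrite /= cat_rcons rcons_cat. Qed.

(** * Averages over conjugates of one word *)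

Section Conjugates.
Variables (y : letter) (w1' : seq letter).
Local Notation w1 := (y :: w1').
Hypothesis w1_red : reduced w1.
(** With first and last letters inverse to each other, the conditions at the two ends of g w1 g^-1
    are the same, and this word is reduced as soon as g w1 is. *)
Hypothesis w1_last : last y w1' = linv y.
Implicit Types (g h : seq letter).

Definition conj_word g := g ++ w1 ++ winv g.

Lemma conj_word_cons a g : conj_word (a :: g) = a :: rcons (conj_word g) (linv a).
Proof. by rewrite /conj_word winv_cons -!cats1 !catA. Qed.

Lemma winv_conj_word_cons a g : winv (conj_word (a :: g)) = a :: rcons (winv (conj_word g)) (linv a).
Proof. by rewrite conj_word_cons winv_cons /winv map_rcons rev_rcons linvK. Qed.

Lemma size_conj_word g : size (conj_word g) = (2 * size g + size w1)%N.
Proof. by rewrite !size_cat size_winv addnC -addnA mul2n -addnn addnC addnAC. Qed.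

Lemma t_winv_conj_word g : t (winv (conj_word g)) = t (winv w1).
Proof.
elim: g => [|a g IH]; first by rewrite /conj_word /= cats0.
by rewrite winv_conj_word_cons t_conj.
Qed.

Lemma conj_word_reduced g : reduced (g ++ w1) -> reduced (conj_word g).
Proof.
(* The induction also carries that the last letter is inverse to the first, which [w1_last] provides
   at the start. *)
suff H : reduced (g ++ w1) -> reduced (conj_word g) /\
    exists a x, [/\ conj_word g = a :: x, last a x = linv a &
                  forall b, ok b (conj_word g) = ok b (g ++ w1)].
  by move=> /H[].
elim: g => [|a g IH].
  by move=> _; rewrite /conj_word /= cats0; split=> //; exists y, w1'.
rewrite cat_cons => /andP[ag /IH[rg [c [x [E cx okE]]]]]; rewrite conj_word_cons; split; last first.
  by exists a, (rcons (conj_word g) (linv a)); rewrite last_rcons.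
have ag' : ok a (conj_word g) by rewrite okE.
rewrite E in rg ag' *.
suff : ok a (c :: x) && reduced (rcons (c :: x) (linv a)) by [].
by rewrite ag' lastI reduced_rcons2 -lastI linvK cx rg eq_sym.
Qed.

Definition Zf n : R := \sum_(g <- sphere_pre w1 n) \sum_(h <- sphere_pre w1 n)
  m (conj_word g ++ winv (conj_word h)).

Lemma Zf0 : Zf 0 <= 1.
Proof. by rewrite /Zf !big_seq1 t_le1. Qed.

(** [t_pd] with unit coefficients on the words (g w1 g^-1)^-1, where t is constant; with these
    inverses [winv v ++ w] becomes the summand of [Zf]. *)
Lemma Zf_ge n : (m (winv w1) * q%:R ^+ n) ^+ 2 <= Zf n.
Proof.
have := t_pd [seq winv (conj_word g) | g <- sphere_pre w1 n] (fun=> 1).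
rewrite !big_map.
have -> : \sum_(g <- sphere_pre w1 n) 1 * t (winv (conj_word g)) =
    (q%:R ^+ n)%:C * t (winv w1).
  under eq_bigr do rewrite mul1r t_winv_conj_word.
  rewrite big_const_seq count_predT size_sphere_pre// iter_addr_0.
  by rewrite rmorphXn/= rmorph_nat -natrX mulr_natl.
rewrite cmodM cmod_real ger0_norm ?exprn_ge0// mulrC => h; apply: le_trans h _.
apply: ler_sum => g _; rewrite big_map; apply: ler_sum => h _.
by rewrite cmod1 !mul1r winvK.
Qed.

(** Distinct first letters of g and h give distinct cyclically reduced words, to which [pair_CS]
    applies with unit weights. A common first letter disappears by conjugation invariance, and q
    letters can precede a given shorter g. *)
Lemma Zf_step n : Zf n.+1 <=
  q%:R ^+ n.+1 * Num.sqrt (Psi (4 * n.+1 + 2 * size w1)) + q%:R * Zf n.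
Proof.
have -> : Zf n.+1 = \sum_(v <- sphere_pre w1 n.+1) \sum_(w <- sphere_pre w1 n.+1 | hd_neq v w)
    1 * 1 * m (conj_word v ++ winv (conj_word w)) + 
   \sum_(v <- sphere_pre w1 n.+1) \sum_(w <- sphere_pre w1 n.+1 | ~~ hd_neq v w)
    m (conj_word v ++ winv (conj_word w)).
  rewrite -big_split/=; apply: eq_bigr => v _.
  rewrite (bigID (hd_neq v))/=; congr (_ + _).
  by apply: eq_bigr => w _; rewrite !mul1r.
apply: lerD.
  have -> : q%:R ^+ n.+1 = \sum_(w <- sphere_pre w1 n.+1) (fun=> 1 : R) w ^+ 2.
    under eq_bigr do rewrite expr1n.
    by rewrite big_const_seq count_predT size_sphere_pre// iter_addr_0 natrX.
  rewrite /Psi; apply: (@pair_CS _ (sphere I (4 * n.+1 + 2 * size w1)) _ (fun=> 1)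
     (fun v w => conj_word v ++ winv (conj_word w)) cyc); first exact: sphere_pre_uniq.
  - move=> v w; rewrite !(mem_sphere_pre _ _ w1_red) => /andP[rv /eqP sv] /andP[rw /eqP sw] vw.
    rewrite mem_sphere -{1}(winvK (conj_word v)) reduced_winv_cat ?reduced_winv ?conj_word_reduced//=.
      rewrite size_cat size_winv !size_conj_word sv sw.
      apply/andP; split; first by rewrite addnn -mul2n mulnDr mulnA.
      case: v rv sv vw => // a v rv [sv]; case: w rw sw => // b w rw [sw] ab.
      rewrite winv_conj_word_cons conj_word_cons /= last_cat /= last_rcons.
      by apply: contraNneq ab => /(can_inj (@linvK _)) ->.
    case: v rv sv vw => // a v rv [sv]; case: w rw sw => // b w rw [sw] ab.
    by rewrite !winv_conj_word_cons.
  - move=> v w; rewrite mem_sphere_pre// => /andP[_ /eqP sv]; rewrite mem_sphere_pre// => /andP[_ /eqP sw].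
    move=> v' w'; rewrite mem_sphere_pre// => /andP[_ /eqP sv']; rewrite mem_sphere_pre// => /andP[_ /eqP sw'].
    move=> /eqP; rewrite eqseq_cat ?size_conj_word ?sv ?sv'// => /andP[/eqP e1 /eqP e2].
    move/eqP: e1; rewrite eqseq_cat ?sv ?sv'// => /andP[/eqP -> _].
    move/(can_inj (@winvK _))/eqP: e2; rewrite eqseq_cat ?sw ?sw'//.
    by move=> /andP[/eqP -> _].
have -> : \sum_(v <- sphere_pre w1 n.+1) \sum_(w <- sphere_pre w1 n.+1 | ~~ hd_neq v w)
    m (conj_word v ++ winv (conj_word w)) =
   \sum_a \sum_(g <- sphere_pre w1 n | ok a (g ++ w1))
      \sum_(h <- sphere_pre w1 n | ok a (h ++ w1)) m (conj_word g ++ winv (conj_word h)).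
  rewrite big_sphere_pre_exch; apply: eq_bigr => a _; apply: eq_bigr => g ag.
  rewrite big_mkcond big_sphere_pre_exch (big_only1 a)//; last first.
    by move=> b ba _; rewrite big1// => h _; rewrite /hd_neq eq_sym ba.
  apply: eq_bigr => h _; rewrite /hd_neq eqxx.
  by rewrite winv_conj_word_cons conj_word_cons cat_sandwich t_conj t_cancel_mid.
rewrite (exchange_big_dep predT)//= /Zf mulr_sumr; apply: ler_sum => g _.
rewrite mulr_sumr.
apply: le_trans (_ : \sum_(a | ok a (g ++ w1)) \sum_(h <- sphere_pre w1 n)
   m (conj_word g ++ winv (conj_word h)) <= _).
  apply: ler_sum => a _; rewrite [leLHS]big_mkcond.
  by apply: ler_sum => h _; case: ifP => // _; rewrite cmod_ge0.
rewrite sumr_const -mulr_sumr mulr_natl.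
by case: g => [|b g]; rewrite /= ?(card_ok y w1') ?(card_ok b (g ++ w1)).
Qed.

Hypothesis I2 : (2 <= #|I|)%N.
Variable C : R.
Local Notation rho := (Num.sqrt (q%:R : R)).
Hypothesis growth : forall n, Phi n <= C * n.+1%:R * rho ^+ n.

Let q_ge3 : 3 <= (q%:R : R) := q_ge3 R I2.
Let rho2 : rho ^+ 2 = q%:R := rho2 R I.
Let rho_gt : 3 / 2 <= rho := rho_gt R I2.
Let rho_gt0 : 0 < rho := rho_gt0 R I2.
Let rhoX_gt0 n : 0 < rho ^+ n := rhoX_gt0 R I2 n.

Lemma C_ge0 : 0 <= C.
Proof. by have := le_trans (Phi_ge0 0) (growth 0); rewrite expr0 !mulr1. Qed.

Lemma sum_rho n : \sum_(0 <= j < n.+1) rho ^+ j <= 3 * rho ^+ n.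
Proof.
elim: n => [|n IH]; first by rewrite big_nat1 expr0; lra.
rewrite big_nat_recr//= exprS.
have := rho_gt; have := rhoX_gt0 n; nra.
Qed.

(** The square roots in [Phi_le_sum] are linearised by C x <= (d x + C / d)^2, where the slope d is
    as small as desired. *)
Lemma Phi_small (e : R) : 0 < e ->
  exists2 D, 0 <= D & forall n, Phi n <= (e * n%:R + D) * rho ^+ n.
Proof.
(* 6 = 3 * 2: [sum_rho] contributes 3, and the index 2j under the square root doubles the slope. *)
move=> e0; pose d := e / 6%:R.
have d0 : 0 < d by rewrite divr_gt0.
have C0 := C_ge0.
have Cd : 0 <= C / d by rewrite divr_ge0// ltW.
exists (3 * (d + C / d)) => [|n]; first by have := ltW d0; lra.
apply: le_trans (Phi_le_sum n) _.
apply: le_trans (_ : \sum_(0 <= j < n.+1) (d * (2 * n + 1)%:R + C / d) * rho ^+ j <= _).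
  rewrite big_nat [leRHS]big_nat; apply: ler_sum => j /andP[_ jn].
  pose x : R := (2 * j).+1%:R.
  have x0 : 0 <= x by rewrite ler0n.
  have h : C * x <= (d * x + C / d) ^+ 2.
    have -> : (d * x + C / d) ^+ 2 = (d * x) ^+ 2 + 2 * (C * x) + (C / d) ^+ 2.
      by field; rewrite gt_eqF.
    have := sqr_ge0 (d * x); have := sqr_ge0 (C / d); have := mulr_ge0 C0 x0; lra.
  have h0 : 0 <= d * x + C / d by rewrite addr_ge0// mulr_ge0// ltW.
  apply: le_trans (_ : (d * x + C / d) * rho ^+ j <= _).
    apply: sqrt_le; first by rewrite mulr_ge0// ltW// rhoX_gt0.
    rewrite exprMn -exprM (mulnC j) (le_trans (growth _))//.
    by apply: ler_wpM2r => //; exact: ltW (rhoX_gt0 _).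
  rewrite ler_wpM2r ?(ltW (rhoX_gt0 _))// lerD2r ler_wpM2l ?(ltW d0)//.
  by rewrite ler_nat addn1 ltnS leq_pmul2l.
rewrite -mulr_sumr.
have k0 : 0 <= d * (2 * n + 1)%:R + C / d by rewrite addr_ge0// mulr_ge0// ltW.
apply: le_trans (ler_wpM2l k0 (sum_rho n)) _.
rewrite mulrCA mulrA ler_wpM2r ?(ltW (rhoX_gt0 _))//.
by rewrite natrD natrM /d; lra.
Qed.

Definition psi L : R := Psi L / rho ^+ L.

Lemma psi_ge0 L : 0 <= psi L.
Proof. by rewrite divr_ge0 ?Psi_ge0// ltW// rhoX_gt0. Qed.

(** Dividing [Phi_step] by rho^(L+2) gives Phi(L+2)/rho^(L+2) >= Phi(L)/rho^L + psi(L+2) - psi(L)/q,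
    which is summed; 2/3 <= 1 - 1/q since q >= 3. *)
Lemma sum_psi n k :
  2 / 3 * \sum_(0 <= i < k.+1) psi (n.+1 + 2 * i) <=
  Phi (n.+1 + 2 * k) / rho ^+ (n.+1 + 2 * k).
Proof.
(* The last psi keeps its full weight: its loss psi / q is charged only by the next step. *)
suff : psi (n.+1 + 2 * k) / q%:R +
    (1 - q%:R^-1) * \sum_(0 <= i < k.+1) psi (n.+1 + 2 * i) <=
    Phi (n.+1 + 2 * k) / rho ^+ (n.+1 + 2 * k).
  apply: le_trans.
  have S0 : 0 <= \sum_(0 <= i < k.+1) psi (n.+1 + 2 * i).
    by rewrite sumr_ge0// => i _; rewrite psi_ge0.
  have h : 0 <= psi (n.+1 + 2 * k) / q%:R by rewrite divr_ge0 ?psi_ge0.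
  have : q%:R^-1 <= 3^-1 :> R by rewrite lef_pV2 ?posrE ?q_ge3// (lt_le_trans _ q_ge3).
  move=> hu; have h3 : 0 <= 3^-1 - q%:R^-1 :> R by rewrite subr_ge0.
  have := mulr_ge0 h3 S0; rewrite !mulrBl mul1r; lra.
have q0 : (q%:R : R) != 0 by rewrite gt_eqF// (lt_le_trans _ q_ge3).
elim: k => [|k IH].
  rewrite big_nat1 muln0 addn0 mulrBl mul1r addrC mulrC subrK /psi.
  rewrite ler_wpM2r ?invr_ge0 ?(ltW (rhoX_gt0 _))//.
  by rewrite /Psi /Phi [leRHS](bigID (@cyc))/= lerDl sumr_ge0// => w _; rewrite sqr_ge0.
rewrite big_nat_recr//=.
have -> : (n.+1 + 2 * k.+1)%N = (n + 2 * k).+3 by rewrite mulnS addnCA.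
have := Phi_step (n + 2 * k).
rewrite addSn in IH *; set L := (n + 2 * k)%N in IH *.
set S := \sum_(0 <= i < k.+1) _ in IH *.
rewrite /psi in IH *; have r0 := rhoX_gt0 L.+1.
have -> : rho ^+ L.+3 = q%:R * rho ^+ L.+1 by rewrite (exprD _ 2 L.+1) rho2.
set r := rho ^+ L.+1 in IH r0 *.
have qr0 : 0 < q%:R * r by rewrite mulr_gt0// (lt_le_trans _ q_ge3).
move=> h.
have := ler_wpM2r (ltW (_ : 0 < (q%:R * r)^-1)) h; rewrite invr_gt0 => /(_ qr0).
have -> : (Psi L.+3 + q%:R * Phi L.+1 - Psi L.+1) / (q%:R * r) =
   Psi L.+3 / (q%:R * r) + Phi L.+1 / r - Psi L.+1 / r / q%:R.
  by field; rewrite q0 gt_eqF.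
set A := Psi L.+3 / _; set B := Psi L.+1 / r / q%:R in IH *.
move: IH; rewrite mulrDr; lra.
Qed.

Definition zf n : R := Zf n / q%:R ^+ (2 * n).

Lemma zf_step n : zf n.+1 <=
  rho ^+ size w1 * Num.sqrt (psi (4 * n.+1 + 2 * size w1)) + zf n / q%:R.
Proof.
have q0 : 0 < (q%:R : R) by rewrite (lt_le_trans _ q_ge3).
rewrite /zf ler_pdivrMr ?exprn_gt0//.
apply: le_trans (Zf_step n) _; rewrite mulrDl; apply: lerD; last first.
  have -> : q%:R ^+ (2 * n.+1) = q%:R * q%:R * q%:R ^+ (2 * n) :> R.
    by rewrite mulnS exprD expr2.
  rewrite le_eqVlt; apply/orP; left; apply/eqP; field.
  by rewrite !gt_eqF ?exprn_gt0.
set L := (4 * n.+1 + 2 * size w1)%N.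
have e : rho ^+ L = (rho ^+ size w1 * q%:R ^+ n.+1) ^+ 2.
  have -> : (q%:R : R) ^+ n.+1 = rho ^+ (2 * n.+1) by rewrite exprM rho2.
  by rewrite -exprD -exprM; congr (_ ^+ _); rewrite /L; lia.
have -> : Psi L = psi L * (rho ^+ size w1 * q%:R ^+ n.+1) ^+ 2.
  by rewrite -e /psi divfK// gt_eqF// rhoX_gt0.
rewrite sqrtrM ?psi_ge0// sqrtr_sqr ger0_norm; last first.
  by rewrite mulr_ge0 ?exprn_ge0 ?sqrtr_ge0.
rewrite mulnC exprM expr2 le_eqVlt; apply/orP; left; apply/eqP; ring.
Qed.

Lemma zf_ge n : m (winv w1) ^+ 2 <= zf n.
Proof.
have q0 : 0 < (q%:R : R) by rewrite (lt_le_trans _ q_ge3).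
rewrite /zf ler_pdivlMr ?exprn_gt0//.
by have := Zf_ge n; rewrite exprMn -exprM mulnC.
Qed.

(** If c = |t(w1^-1)| were positive, the sum S of the first k averages would be at least c^2 k.
    Summing [zf_step], with each sqrt(psi) at most th + psi / th, bounds 2/3 of S by c^2 k / 3 plus
    a constant, which fails for large k. *)
Lemma t_winv_eq0 : t (winv w1) = 0.
Proof.
apply: cmod_eq0; apply/eqP; apply: contraT => c0.
pose c := m (winv w1); have cp : 0 < c by rewrite lt_neqAle eq_sym c0 cmod_ge0.
have c2 : 0 < c ^+ 2 by rewrite exprn_gt0.
pose l := size w1; pose K := rho ^+ l.
have K0 : 0 < K := rhoX_gt0 l.
(* Both error terms get slope c^2 / 6 in k: K th = c^2 / 6, and s k has slope at most 6 e with 6 e K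
   / th = c^2 / 6. *)
pose th := c ^+ 2 / (6%:R * K); have th0 : 0 < th by rewrite divr_gt0// mulr_gt0.
pose e := c ^+ 2 * th / (36%:R * K).
have e0 : 0 < e by apply: divr_gt0; apply: mulr_gt0.
have [D D0 hD] := Phi_small e0.
have q0 : 0 < (q%:R : R) by rewrite (lt_le_trans _ q_ge3).
pose s k : R := \sum_(0 <= n < k) psi (4 * n.+1 + 2 * l).
have s_le k : s k <= 3 / 2 * (e * (2 * l + 4 * k)%:R + D).
  have l0 : (2 * l)%N = (2 * l).-1.+1 by [].
  have := sum_psi (2 * l).-1 (2 * k); rewrite -l0.
  have : s k <= \sum_(0 <= i < (2 * k).+1) psi (2 * l + 2 * i).
    elim: k => [|k IH]; first by rewrite /s big_geq// sumr_ge0// => i _; rewrite psi_ge0.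
    have -> : (2 * k.+1).+1 = (2 * k).+3 by rewrite mulnS.
    rewrite /s big_nat_recr//= -/(s k).
    rewrite [leRHS]big_nat_recr//= [X in _ <= X + _]big_nat_recr//=.
    have -> : (4 * k.+1 + 2 * l = 2 * l + 2 * (2 * k).+2)%N.
      by rewrite -[(2 * k).+2]/(2 + 2 * k)%N -mulnS mulnA addnC.
    by rewrite lerD2r (le_trans IH)// lerDl psi_ge0.
  have : Phi (2 * l + 2 * (2 * k)) / rho ^+ (2 * l + 2 * (2 * k)) <=
      e * (2 * l + 4 * k)%:R + D.
    by rewrite ler_pdivrMr ?rhoX_gt0// mulnA hD.
  lra.
pose S k : R := \sum_(0 <= n < k) zf n.+1.
have S_ge k : c ^+ 2 * k%:R <= S k.
  elim: k => [|k IH]; first by rewrite /S big_geq// mulr0.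
  rewrite /S big_nat_recr//= -/(S k) -natr1 mulrDr mulr1 lerD//.
  exact: zf_ge.
have S_le k : S k <= K * (th * k%:R + s k / th) + (1 + S k) / q%:R.
  (* The averages with indices 0 to k - 1 sum to zf 0 + S k - zf k, whence the extra term, dropped
     afterwards. *)
  suff : S k + zf k / q%:R <= K * (th * k%:R + s k / th) + (1 + S k) / q%:R.
    apply: le_trans; rewrite lerDl; apply: divr_ge0; last exact: ltW.
    exact: le_trans (sqr_ge0 _) (zf_ge k).
  elim: k => [|k IH].
    have -> : S 0%N = 0 by rewrite /S big_geq.
    have -> : s 0%N = 0 by rewrite /s big_geq.
    rewrite mul0r mulr0 !addr0 mulr0 !add0r.
    apply: ler_wpM2r; first by rewrite invr_ge0 ltW.
    by rewrite /zf muln0 expr0 divr1; exact: Zf0.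
  rewrite /S /s !big_nat_recr//= -/(S k) -/(s k).
  have := zf_step k; rewrite -/l -/K; set p := psi _; set z := zf k.+1.
  have : Num.sqrt p <= th + p / th.
    have p0 : 0 <= p := psi_ge0 _.
    have h0 : 0 <= th + p / th := addr_ge0 (ltW th0) (divr_ge0 p0 (ltW th0)).
    apply: sqrt_le => //.
    have -> : (th + p / th) ^+ 2 = th ^+ 2 + 2 * p + (p / th) ^+ 2.
      by field; rewrite gt_eqF.
    have := sqr_ge0 th; have := sqr_ge0 (p / th); lra.
  move=> /(ler_wpM2l (ltW K0)) h1 h2.
  rewrite -natr1; move: IH h1 h2; move: (S k) (s k) (zf k) z p (Num.sqrt p).
  move: (k%:R : R) (q%:R^-1 : R) (th^-1) => {}k u v S' s' z' z p sp; nra.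
have main k : c ^+ 2 / 3 * k%:R <=
    K / th * (3 / 2) * (e * (2 * l)%:R + D) + 3^-1.
  have h1 := S_ge k; have h2 := S_le k; have h3 := s_le k.
  have h4 : q%:R^-1 <= 3^-1 :> R by rewrite lef_pV2 ?posrE ?q_ge3.
  have S0 : 0 <= S k by apply: le_trans h1; rewrite mulr_ge0// ltW.
  have h5 : (1 + S k) / q%:R <= (1 + S k) / 3.
    by rewrite ler_wpM2l// addr_ge0.
  have Kt : 0 < K / th by rewrite divr_gt0.
  have h6 := ler_wpM2l (ltW Kt) h3.
  have e1 : K * (th * k%:R + s k / th) = c ^+ 2 / 6%:R * k%:R + K / th * s k.
    by rewrite /th; field; rewrite !gt_eqF.
  have e2 : K / th * (3 / 2 * (e * (2 * l + 4 * k)%:R + D)) =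
     K / th * (3 / 2) * (e * (2 * l)%:R + D) + c ^+ 2 / 6%:R * k%:R.
    by rewrite natrD [(4 * k)%:R]natrM /e; field; rewrite !gt_eqF.
  rewrite e1 in h2; rewrite e2 in h6; lra.
by case: (archi_false (divr_gt0 c2 (ltr0Sn R 2)) main).
Qed.

End Conjugates.

Lemma avoid2 (b c : letter) : (2 <= #|I|)%N -> exists y, (y != b) && (y != c).
Proof.
move=> I2; apply/existsP; apply: contraTT I2; rewrite negb_exists => /forallP h.
have : (#|letter| <= #|pred2 b c|)%N.
  apply: subset_leq_card; apply/fintype.subsetP => y _; have := h y.
  by rewrite negb_and !negbK inE.
have := card2 b c; rewrite card_letter; case: (_ != _); lia.
Qed.

(** The inverse of w is conjugated by a letter y that cancels at neither end; such a y exists among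
    at least four letters. The result has the shape required by [t_winv_eq0], and t is invariant
    under conjugation. *)
Lemma character_vanish (C : R) : (2 <= #|I|)%N ->
  (forall n, Phi n <= C * n.+1%:R * Num.sqrt q%:R ^+ n) ->
  forall w, reduced w -> w != [::] -> t w = 0.
Proof.
move=> I2 growth w rw w0.
have : winv w != [::] by apply: contraNneq w0 => e; rewrite -(winvK w) e.
have : reduced (winv w) by rewrite reduced_winv.
case E : (winv w) => [|b v]// rv _.
have [y /andP[y1 y2]] := avoid2 (linv b) (last b v) I2.
have r1 : reduced (y :: rcons (b :: v) (linv y)).
  suff : ok y (b :: v) && reduced (rcons (b :: v) (linv y)) by [].
  apply/andP; split; first exact: y1.
  by rewrite lastI reduced_rcons2 -lastI linvK rv eq_sym y2.
have := t_winv_eq0 r1 _ I2 growth; rewrite last_rcons => /(_ erefl).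
rewrite winv_cons /winv map_rcons rev_rcons linvK rcons_cons.
by rewrite -/(winv (b :: v)) t_conj -E winvK.
Qed.

End Character.

(** * Tensor products of isometries *)

Section Tensor.
Context (R : realType) (H K : hilbertType R) (L : hilbert_tensor H K).
Implicit Types (s : seq (H * K)) (v w : L).

Definition tsum s : L := \sum_(p <- s) ht L p.1 p.2.

Lemma htZl (c : R[i]) h k : ht L (c *: h) k = c *: ht L h k.
Proof. exact: linearZl_LR. Qed.

Lemma tsum_cat s1 s2 : tsum (s1 ++ s2) = tsum s1 + tsum s2.
Proof. by rewrite /tsum big_cat. Qed.

Lemma tsumZ (c : R[i]) s : tsum [seq (c *: p.1, p.2) | p <- s] = c *: tsum s.
Proof. by rewrite /tsum big_map scaler_sumr; apply: eq_bigr => p _; rewrite htZl. Qed.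

Lemma ip_ht h k h' k' : ip (ht L h k) (ht L h' k') = ip h h' * ip k k'.
Proof. exact: ht_dot. Qed.

Lemma nm_ht h k : nm (ht L h k) = nm h * nm k.
Proof.
apply/eqP; rewrite -(eqrXn2 (n := 2)) ?nm_ge0 ?mulr_ge0 ?nm_ge0//; apply/eqP.
by rewrite exprMn nm_sqr ip_ht !ipxx -rmorphM.
Qed.

Lemma tsum_dense v (e : R) : 0 < e -> exists s, nm (v - tsum s) <= e.
Proof.
move=> e0; have : closure [set \sum_(p <- s) ht L p.1 p.2 |
    s in [set: seq (H * K)]] v by rewrite ht_dense.
have e1 : 0 < e%:C :> R[i] by rewrite ltcR.
move=> /(_ (ball v e%:C))[|_ [[s _ <-]]]; first exact: nbhsx_ballx.
by rewrite -ball_normE/= nmE ltcR => /ltW h; exists s.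
Qed.

(** Sums of pure tensors, without coefficients, are already dense, so additivity and boundedness
    determine F. *)
Lemma tensor_functional_eq0 (F : L -> R[i]) (C : R) :
  (forall v w, F (v + w) = F v + F w) -> (forall v, cmod (F v) <= C * nm v) ->
  (forall h k, F (ht L h k) = 0) -> forall v, F v = 0.
Proof.
move=> FD FC F0 v.
have F00 : F 0 = 0.
  by apply: cmod_eq0; apply/eqP; rewrite eq_le cmod_ge0 (le_trans (FC _))// nm0 mulr0.
have Fs s : F (tsum s) = 0.
  by rewrite /tsum; elim/big_rec : _ => // p x _ h; rewrite FD F0 h addr0.
apply: cmod_eq0; apply/eqP; rewrite eq_le cmod_ge0 andbT.
apply/ler_addgt0Pr => e e0; rewrite add0r.
have C1 : 0 < `|C| + 1 by rewrite ltr_wpDl.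
have [s hs] := tsum_dense v (divr_gt0 e0 C1).
rewrite -(subrK (tsum s) v) FD Fs addr0 (le_trans (FC _))//.
apply: le_trans (_ : (`|C| + 1) * nm (v - tsum s) <= _).
  rewrite ler_wpM2r ?nm_ge0// (le_trans (ler_norm _))// lerDl//.
by rewrite mulrC -ler_pdivlMr.
Qed.

Section Isometry.
Variables (a : H -> H) (b : K -> K).
Hypothesis al : linear a.
Hypothesis aiso : forall x y, ip (a x) (a y) = ip x y.
Hypothesis biso : forall x y, ip (b x) (b y) = ip x y.

Let g s := tsum [seq (a p.1, b p.2) | p <- s].

Let ip_g s s' : ip (g s) (g s') = ip (tsum s) (tsum s').
Proof.
rewrite /g /tsum !big_map !ip_suml; apply: eq_bigr => p _.
rewrite !ip_sumr; apply: eq_bigr => p' _.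
by rewrite !ip_ht aiso biso.
Qed.

Let g_dist s s' : nm (g s - g s') = nm (tsum s - tsum s').
Proof.
apply/eqP; rewrite -(eqrXn2 (n := 2)) ?nm_ge0//; apply/eqP.
by rewrite !nm_sqr !ipBl !ipBr !ip_g.
Qed.

Lemma tensor_isometry_exists : exists T : L -> L, bounded_op T /\
  forall h k, T (ht L h k) = ht L (a h) (b k).
Proof.
(* The value at v is specified by a distance inequality against every finite sum. Well-definedness,
   linearity and the norm bound all follow from it, although g depends on the list and not only on
   its sum. *)
have hT v : exists l : L, forall s, nm (l - g s) <= nm (v - tsum s).
  have pn n : 0 < n.+1%:R^-1 :> R by rewrite invr_gt0 ltr0Sn.
  have [s hs] := choice (fun n => tsum_dense v (pn n)).
  have inv_small (e : R) : 0 < e -> exists n0, forall n, (n0 <= n)%N -> n.+1%:R^-1 <= e.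
    move=> e0; exists (Num.bound e^-1) => n hn.
    rewrite invf_ple ?posrE//.
    have e1 : 0 <= e^-1 by rewrite invr_ge0 ltW.
    rewrite (le_trans (ltW (archi_boundP e1)))// ler_nat; exact: leqW.
  have [|l hl] := @lim_exists _ _ (fun n => g (s n)).
    move=> e e0; have [n0 hn0] := inv_small (e / 2) (divr_gt0 e0 (ltr0Sn _ 1)).
    exists n0 => n n' hn hn'; rewrite g_dist.
    rewrite -(subrKA v) (le_trans (nmD _ _))// -(nmN (tsum _ - v)) opprB.
    have := le_trans (hs n) (hn0 n hn); have := le_trans (hs n') (hn0 n' hn').
    lra.
  exists l => s'; apply/ler_addgt0Pr => e e0.
  have [n1 hn1] := hl (e / 2) (divr_gt0 e0 (ltr0Sn _ 1)).
  have [n2 hn2] := inv_small (e / 2) (divr_gt0 e0 (ltr0Sn _ 1)).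
  pose n := maxn n1 n2.
  rewrite -(subrKA (g (s n))) (le_trans (nmD _ _))//.
  have h1 := hn1 n (leq_maxl _ _).
  have h2 := le_trans (hs n) (hn2 n (leq_maxr _ _)).
  rewrite g_dist.
  have := nmD (tsum (s n) - v) (v - tsum s'); rewrite subrKA.
  rewrite -(nmN (tsum _ - v)) opprB; lra.
have [T hT'] := choice hT.
have Tt s : T (tsum s) = g s.
  apply/eqP; rewrite -subr_eq0; apply/eqP/nm_eq0/eqP.
  by rewrite eq_le nm_ge0 andbT (le_trans (hT' _ s))// subrr nm0.
have gl c s s' : g ([seq (c *: p.1, p.2) | p <- s] ++ s') = c *: g s + g s'.
  rewrite /g map_cat tsum_cat -map_comp -tsumZ -map_comp; congr (_ + _).
  by congr tsum; apply: eq_map => p /=; rewrite linZ.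
exists T; split; last first.
  move=> h k; have := Tt [:: (h, k)].
  by rewrite /g /tsum /= !big_seq1.
apply/bounded_opP; split.
  move=> c v w; apply/eqP; rewrite -subr_eq0; apply/eqP/le0_eq => e e0.
  pose D := 2 * cmod c + 2.
  have D0 : 0 < D by have := cmod_ge0 c; rewrite /D; lra.
  have [s hs] := tsum_dense v (divr_gt0 e0 D0).
  have [s' hs'] := tsum_dense w (divr_gt0 e0 D0).
  pose s2 := [seq (c *: p.1, p.2) | p <- s] ++ s'.
  have -> : T (c *: v + w) - (c *: T v + T w) =
    (T (c *: v + w) - g s2) - (c *: (T v - g s) + (T w - g s')).
    rewrite gl scalerBr [in RHS]addrACA -opprD opprB [RHS]addrA.
    by rewrite -(addrA (T _)) addNr addr0.
  apply: le_trans (nmB _ _) _.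
  apply: le_trans (lerD (hT' _ _) (nmD _ _)) _; rewrite nmZ.
  have h1 : nm (c *: v + w - tsum s2) <= cmod c * (e / D) + e / D.
    rewrite tsum_cat tsumZ opprD addrACA -scalerBr (le_trans (nmD _ _))//.
    by rewrite nmZ lerD// ler_wpM2l ?cmod_ge0.
  have h2 := ler_wpM2l (cmod_ge0 c) (le_trans (hT' v s) hs).
  have h3 := le_trans (hT' w s') hs'.
  have h4 : (cmod c * (e / D) + e / D) + (cmod c * (e / D) + e / D) = e.
    by rewrite /D; field; rewrite gt_eqF.
  rewrite -h4; lra.
exists 1 => // v; rewrite mul1r; apply/ler_addgt0Pr => e e0.
have [s hs] := tsum_dense v (divr_gt0 e0 (ltr0Sn _ 1)).
have h1 := nmD (T v - g s) (g s); rewrite subrK in h1.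
have h2 := hT' v s.
have h3 : nm (g s) = nm (tsum s).
  by have := g_dist s [::]; rewrite /g /tsum /= !big_nil !subr0.
have h4 := nmD (tsum s - v) v; rewrite subrK -(nmN (_ - v)) opprB in h4.
lra.
Qed.

Lemma op_tensorP : bounded_op (op_tensor L a b) /\
  forall h k, op_tensor L a b (ht L h k) = ht L (a h) (b k).
Proof.
rewrite /op_tensor; case: xgetP => [T _ //|/(_ _) h].
by have [T hT] := tensor_isometry_exists; have := h T.
Qed.

End Isometry.
End Tensor.

(** * The unitaries and their words *)

Section Representation.
Context (R : realType) (H : hilbertType R) (M : set (H -> H)).
Hypothesis hM : von_neumann M.
Variables (I : finType) (u : I -> H -> H).
Hypothesis hu : forall i, M (u i) /\ unitary_op (u i).
Local Notation letter := (letter I).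
Implicit Types (a : letter) (w v : seq letter) (x y : H).
Implicit Types (l : seq (R[i] * seq letter)).

Definition letter_op a : H -> H := if a.2 then u a.1 else adj (u a.1).

Definition word_op w : H -> H := foldr (fun a f => letter_op a \o f) id w.

Lemma e_vn a : M (letter_op a).
Proof.
rewrite /letter_op; case: a => i [] /=; first by case: (hu i).
by apply: vn_adj => //; case: (hu i).
Qed.

Lemma e_adj a : adj (letter_op a) = letter_op (linv a).
Proof.
rewrite /letter_op; case: a => i [] //=; rewrite (vn_adjK hM)//.
by case: (hu i).
Qed.

Lemma eK a x : letter_op a (letter_op (linv a) x) = x.
Proof.
have [_ [h1 h2]] := hu a.1.
rewrite /letter_op; case: a h1 h2 => i [] /= h1 h2.
- by rewrite -[LHS]/((u i \o adj (u i)) x) h2.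
- by rewrite -[LHS]/((adj (u i) \o u i) x) h1.
Qed.

Lemma e_ip a x y : ip (letter_op a x) y = ip x (letter_op (linv a) y).
Proof. by rewrite (vn_adjP hM (e_vn a)) e_adj. Qed.

Lemma e_iso a x y : ip (letter_op a x) (letter_op a y) = ip x y.
Proof. by rewrite e_ip -{2}(linvK a) eK. Qed.

Lemma ev_vn w : M (word_op w).
Proof.
elim: w => [|a w IH] /=; first exact: vn_id.
by apply: vn_comp => //; exact: e_vn.
Qed.

Lemma ev_lin w : linear (word_op w).
Proof. exact: vn_lin (ev_vn w). Qed.

Lemma ev_cat w v : word_op (w ++ v) = word_op w \o word_op v.
Proof. by elim: w => //= a w ->. Qed.

Lemma ev_adj w : adj (word_op w) = word_op (winv w).
Proof.
elim: w => [|a w IH] /=; first exact: vn_adj_id.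
rewrite (vn_adj_comp hM (e_vn a) (ev_vn w)) IH e_adj.
by rewrite winv_cons -cats1 ev_cat.
Qed.

Lemma ev_cancel a w : word_op (a :: linv a :: w) = word_op w.
Proof. by apply/funext => x /=; rewrite eK. Qed.

Lemma ev_nm w x : nm (word_op w x) = nm x.
Proof.
apply/eqP; rewrite -(eqrXn2 (n := 2)) ?nm_ge0//; apply/eqP; rewrite !nm_sqr.
by congr complex.Re; elim: w => //= a w <-; rewrite e_iso.
Qed.

(** The list may repeat words and contain unreduced ones, which makes product and adjoint plain
    operations on lists. *)
Definition lincomb l : H -> H := fun x => \sum_(p <- l) p.1 *: word_op p.2 x.

Lemma comb_cons p l : lincomb (p :: l) = p.1 *: word_op p.2 + lincomb l.
Proof. by apply/funext => x; rewrite /lincomb big_cons. Qed.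

Lemma comb_nil : lincomb [::] = 0.
Proof. by apply/funext => x; rewrite /lincomb big_nil. Qed.

Lemma comb_vn l : M (lincomb l).
Proof.
elim: l => [|p l IH]; first by rewrite comb_nil; exact: vn_zero.
by rewrite comb_cons; apply: vn_linear => //; exact: ev_vn.
Qed.

Lemma comb1 w : lincomb [:: (1, w)] = word_op w.
Proof. by apply/funext => x; rewrite /lincomb big_seq1 scale1r. Qed.

Lemma comb_cat l1 l2 : lincomb (l1 ++ l2) = lincomb l1 + lincomb l2.
Proof. by apply/funext => x; rewrite /lincomb big_cat. Qed.

Lemma combZ (c : R[i]) l : lincomb [seq (c * p.1, p.2) | p <- l] = c *: lincomb l.
Proof.
apply/funext => x; rewrite -[RHS]/(c *: lincomb l x) /lincomb big_map scaler_sumr.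
by apply: eq_bigr => p _; rewrite scalerA.
Qed.

Definition comb_mul l1 l2 := [seq (p.1 * r.1, p.2 ++ r.2) | p <- l1, r <- l2].

Lemma comb_comp l1 l2 : lincomb l1 \o lincomb l2 = lincomb (comb_mul l1 l2).
Proof.
apply/funext => x; rewrite -[LHS]/(lincomb l1 (lincomb l2 x)) /lincomb big_allpairs_dep/=.
apply: eq_bigr => p _; rewrite (lin_sum _ _ _ (ev_lin _)) scaler_sumr.
by apply: eq_bigr => r _; rewrite (linZ _ _ (ev_lin _)) scalerA ev_cat.
Qed.

Definition comb_star l := [seq (Num.conj p.1, winv p.2) | p <- l].

Lemma comb_adj l : adj (lincomb l) = lincomb (comb_star l).
Proof.
apply: adj_eq => x y; rewrite /lincomb ip_suml ip_sumr big_map.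
apply: eq_bigr => p _; rewrite ipZl ipZr conjCK -ev_adj.
by rewrite (vn_adjP hM (ev_vn _)).
Qed.

Lemma comb_star_algebra : unital_star_algebra (range lincomb).
Proof.
split.
- by exists [:: (1, [::])] => //; rewrite comb1.
- move=> c _ _ [l1 _ <-] [l2 _ <-].
  by exists ([seq (c * p.1, p.2) | p <- l1] ++ l2) => //; rewrite comb_cat combZ.
- move=> _ _ [l1 _ <-] [l2 _ <-].
  by exists (comb_mul l1 l2) => //; rewrite comb_comp.
- by move=> _ [l _ <-]; exists (comb_star l) => //; rewrite comb_adj.
Qed.

Variable tau : (H -> H) -> R[i].
Hypothesis htau : normal_faithful_tracial_state M tau.

Definition word_trace w : R[i] := tau (word_op w).

Lemma tau_comb l : tau (lincomb l) = \sum_(p <- l) p.1 * word_trace p.2.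
Proof.
elim: l => [|p l IH]; first by rewrite comb_nil big_nil (tau0 hM htau).
rewrite comb_cons big_cons -IH (trace_linear htau)//; first exact: ev_vn.
exact: comb_vn.
Qed.

Lemma tau_comb_sqr l : tau (adj (lincomb l) \o lincomb l) =
  \sum_(p <- l) \sum_(r <- l) Num.conj p.1 * r.1 * word_trace (winv p.2 ++ r.2).
Proof. by rewrite comb_adj comb_comp tau_comb big_allpairs_dep/= big_map. Qed.

Lemma tw_trace v w : word_trace (v ++ w) = word_trace (w ++ v).
Proof. by rewrite /word_trace !ev_cat (trace_comp htau)//; exact: ev_vn. Qed.

Lemma tw_cancel a w : word_trace (a :: linv a :: w) = word_trace w.
Proof. by rewrite /word_trace ev_cancel. Qed.

Lemma tw_nil : word_trace [::] = 1.
Proof. exact: trace_id htau. Qed.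

Lemma tw_le1 w : cmod (word_trace w) <= 1.
Proof.
apply: (tau_bounded hM htau (ev_vn w)) => // x.
by rewrite ev_nm mul1r.
Qed.

Lemma tw_pd (s : seq (seq letter)) (f : seq letter -> R[i]) :
  cmod (\sum_(w <- s) f w * word_trace w) ^+ 2 <=
  \sum_(v <- s) \sum_(w <- s) cmod (f v) * cmod (f w) * cmod (word_trace (winv v ++ w)).
Proof.
have := tau_CS hM htau (comb_vn [seq (f w, w) | w <- s]).
rewrite tau_comb_sqr tau_comb !big_map /= => h; apply: le_trans h _.
apply: le_trans (Re_le_md _) _; apply: le_trans (cmod_sum _ _ _) _.
apply: ler_sum => v _; rewrite big_map; apply: le_trans (cmod_sum _ _ _) _.
by apply: ler_sum => w _; rewrite !cmodM cmod_conj.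
Qed.

Variable L : hilbert_tensor H (conjsp H).
Implicit Types (z : L).

Lemma ip_conj (x y : conjsp H) : ip x y = ip (y : H) (x : H).
Proof. by []. Qed.

Lemma nm_conj (x : conjsp H) : nm x = nm (x : H).
Proof. by []. Qed.

(** Since u^op acts on [conjsp H] as the adjoint of u, its own adjoint acts as u: both legs carry
    the same map. *)
Definition Pi a : L -> L := op_tensor L (letter_op a) (letter_op a : conjsp H -> conjsp H).

Let PiP a := @op_tensorP R H (conjsp H) L (letter_op a) (letter_op a) (vn_lin hM (e_vn a))
  (e_iso a) (fun x y => e_iso a y x).

Lemma Pi_bounded a : bounded_op (Pi a).
Proof. by case: (PiP a). Qed.

Lemma Pi_lin a : linear (Pi a).
Proof. by case: (Pi_bounded a). Qed.

Lemma Pi_ht a x (k : conjsp H) : Pi a (ht L x k) = ht L (letter_op a x) (letter_op a k : conjsp H).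
Proof. by have [_ h] := PiP a; exact: h. Qed.

Lemma Pi_adj a z z' : ip (Pi a z) z' = ip z (Pi (linv a) z').
Proof.
have /bounded_opP[l1 [C C0 hC]] := Pi_bounded a.
have /bounded_opP[l2 [D D0 hD]] := Pi_bounded (linv a).
have bnd (y y' : L) : cmod (ip (Pi a y) y' - ip y (Pi (linv a) y')) <=
    (C + D) * (nm y * nm y').
  apply: le_trans (cmodD _ _) _; rewrite cmodN mulrDl; apply: lerD.
    apply: le_trans (cauchy_schwarz _ _) _.
    by rewrite mulrA ler_wpM2r ?nm_ge0.
  apply: le_trans (cauchy_schwarz _ _) _.
  by rewrite mulrCA ler_wpM2l ?nm_ge0.
apply/eqP; rewrite -subr_eq0; apply/eqP.
pose F1 (y : L) := ip (Pi a y) z' - ip y (Pi (linv a) z').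
rewrite -/(F1 z).
apply: (tensor_functional_eq0 (C := (C + D) * nm z')).
- by move=> y y'; rewrite /F1 linD// !ipDl opprD addrACA.
- by move=> y; rewrite -mulrA (mulrC (nm z')); exact: bnd.
move=> x k; rewrite /F1 {F1}.
pose F2 (y : L) := ip y (Pi a (ht L x k)) - ip (Pi (linv a) y) (ht L x k).
suff E : F2 z' = 0.
  rewrite [X in X - _]ipC [X in _ - X]ipC -rmorphB/= -/(F2 z') E.
  exact: rmorph0.
apply: (tensor_functional_eq0 (C := (C + D) * nm (ht L x k))).
- by move=> y y'; rewrite /F2 linD// !ipDl opprD addrACA.
- move=> y; have := bnd (ht L x k) y.
  rewrite -cmod_conj rmorphB/= -!ipC -mulrA; exact.
move=> x' k'; rewrite /F2 !Pi_ht !ip_ht !ip_conj.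
by rewrite (e_ip (linv a)) linvK (e_ip a k) subrr.
Qed.

End Representation.

(** * The Laplacian of a representation of the free group *)

(** If x > y > 0, Bernoulli's inequality makes (x / y)^n unbounded. Cofinally many n suffice, which
    later allows powers of two. *)
Lemma pow_compare (R : realType) (x y a b : R) : 0 < a -> 0 <= x -> 0 <= y ->
  (forall k : nat, exists2 n, (k <= n)%N & x ^+ n * a <= y ^+ n * b) -> x <= y.
Proof.
move=> a0 x0 y0 h; rewrite leNgt; apply/negP => yx.
have {}y0 : 0 < y.
  rewrite lt_neqAle y0 andbT; apply/eqP => y00; have [n n1] := h 1%N.
  rewrite -y00 expr0n eqn0Ngt n1 mul0r leNgt mulr_gt0// exprn_gt0//.
  by rewrite y00.
pose d := x / y - 1.
have d0 : 0 < d by rewrite subr_gt0 ltr_pdivlMr// mul1r.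
have hd : 1 + d = x / y by rewrite /d addrC subrK.
have bern n : 1 + d * n%:R <= (x / y) ^+ n.
  elim: n => [|n IH]; first by rewrite mulr0 addr0 expr0.
  rewrite exprS -natr1 -hd; rewrite -hd in IH.
  have dn : 0 <= d * n%:R by rewrite mulr_ge0// ltW.
  nra.
apply: (@archi_false R d (b / a)) => // k.
have [n kn hn] := h k.
have h1 : (x / y) ^+ n <= b / a.
  rewrite exprMn exprVn ler_pdivrMr ?exprn_gt0// mulrAC ler_pdivlMr//.
  by rewrite (mulrC b).
apply: le_trans h1; apply: le_trans (bern n).
have : (k%:R : R) <= n%:R by rewrite ler_nat.
move=> /(ler_wpM2l (ltW d0)); lra.
Qed.

Section Laplacian.
Context (R : realType) (I : finType) (L : hilbertType R).
Local Notation letter := (letter I).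
Local Notation q := (branching I).
Local Notation rho := (Num.sqrt (q%:R : R)).
Variable Pi : letter -> L -> L.
Hypothesis Pi_lin : forall a, linear (Pi a).
Hypothesis Pi_adj : forall a z z', ip (Pi a z) z' = ip z (Pi (linv a) z').
Hypothesis PiK : forall a z, Pi a (Pi (linv a) z) = z.
Implicit Types (z : L) (a : letter) (w : seq letter).

Lemma Pi_nm a z : nm (Pi a z) = nm z.
Proof.
apply/eqP; rewrite -(eqrXn2 (n := 2)) ?nm_ge0//; apply/eqP; rewrite !nm_sqr.
by rewrite Pi_adj -{2}(linvK a) PiK.
Qed.

Definition pw w z := foldr Pi z w.

Lemma pw_nm w z : nm (pw w z) = nm z.
Proof. by elim: w => //= a w IH; rewrite Pi_nm. Qed.

Lemma pw_cat w v z : pw (w ++ v) z = pw w (pw v z).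
Proof. exact: foldr_cat. Qed.

Definition lap z : L := \sum_a Pi a z.
Definition sph n z : L := \sum_(w <- sphere I n) pw w z.

Lemma lap_lin : linear lap.
Proof.
move=> c z z'; rewrite /lap scaler_sumr -big_split; apply: eq_bigr => a _.
exact: Pi_lin.
Qed.

Lemma lap_sa z z' : ip (lap z) z' = ip z (lap z').
Proof.
rewrite /lap ip_suml ip_sumr (reindex_inj (can_inj (@linvK I))).
by apply: eq_bigr => a _; rewrite Pi_adj linvK.
Qed.

Lemma lap_nm z : nm (lap z) <= #|letter|%:R * nm z.
Proof.
apply: le_trans (nm_sum _ _ _) _.
by under eq_bigr do rewrite Pi_nm; rewrite sumr_const mulr_natl.
Qed.

Lemma sph0 z : sph 0 z = z.
Proof. by rewrite /sph big_seq1. Qed.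

Lemma sph1 z : sph 1 z = lap z.
Proof. by rewrite /sph big_sphere big_seq1. Qed.

(** The empty word is reached by cancellation from each of the q + 1 letters, a longer word in q
    ways. *)
Definition deg n : nat := if n is 0 then #|letter| else q.

Lemma lap_sph n z : lap (sph n.+1 z) = sph n.+2 z + (deg n)%:R *: sph n z.
Proof.
rewrite /lap /sph (eq_bigr (fun a => \sum_(w <- sphere I n.+1) pw (a :: w) z)); last first.
  by move=> a _; rewrite lin_sum.
rewrite exchange_big/= [in RHS]big_sphere.
under eq_bigr => w _ do rewrite (bigID (fun a => ok a w))/=.
rewrite big_split/=; congr (_ + _).
rewrite big_sphere scaler_sumr [LHS]big_seq [RHS]big_seq; apply: eq_bigr => w.
rewrite mem_sphere => /andP[_ /eqP sw].
rewrite (eq_bigr (fun _ => pw w z)) => [|a _]; last first.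
  rewrite (big_pred1 (linv a)) => [|b]; last by rewrite /= negbK.
  by rewrite /= -{2}(linvK a) PiK.
rewrite sumr_const scaler_nat; congr (_ *+ _).
case: w sw => [|b w] <- /=; first by apply: eq_card => x; rewrite !inE.
by rewrite -(card_ok b w); apply: eq_card => x; rewrite !inE.
Qed.

Lemma sph_nm n z : nm (sph n z) <= (size (sphere I n))%:R * nm z.
Proof.
apply: le_trans (nm_sum _ _ _) _.
under eq_bigr do rewrite pw_nm.
by rewrite big_const_seq count_predT iter_addr_0 mulr_natl.
Qed.

(** * Growth of the sphere operators under the norm bound *)

Section Upper.
Hypothesis I2 : (2 <= #|I|)%N.
Hypothesis lap_le : forall z, nm (lap z) <= 2 * rho * nm z.

(** The quadratic form that the recursion S_{n+3} = T S_{n+2} - q S_{n+1} multiplies by q. It starts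
    at S_1, past the exceptional value of [deg]. *)
Definition energy z n : R := nm (sph n.+2 z) ^+ 2 + q%:R * nm (sph n.+1 z) ^+ 2
  - complex.Re (ip (sph n.+2 z) (lap (sph n.+1 z))).

Let rho_gt0 : 0 < rho := rho_gt0 R I2.
Let rho2 : rho ^+ 2 = q%:R := rho2 R I.

Lemma energyS z n : energy z n.+1 = q%:R * energy z n.
Proof.
rewrite /energy; set a := sph n.+1 z; set b := sph n.+2 z; set c := sph n.+3 z.
have E : lap b = c + q%:R *: a := lap_sph n.+1 z.
have c_E : c = lap b - q%:R *: a by rewrite E addrK.
have h1 : complex.Re (ip c (lap b)) = nm c ^+ 2 + q%:R * complex.Re (ip c a).
  rewrite E ipDr ipZr conjC_nat ipxx ReD/=; congr (_ + _).
  by rewrite -(rmorph_nat (real_complex R)) Re_realM.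
have h2 : complex.Re (ip c a) = complex.Re (ip b (lap a)) - q%:R * nm a ^+ 2.
  rewrite c_E ipBl lap_sa ipZl ipxx ReB -(rmorph_nat (real_complex R)).
  by rewrite Re_realM.
rewrite h1 h2; ring.
Qed.

Lemma energyE z n : energy z n = rho ^+ (2 * n) * energy z 0.
Proof.
elim: n => [|n IH]; first by rewrite mul1r.
by rewrite energyS IH mulrA mulnS exprD rho2.
Qed.

(** Because ||T|| <= 2 rho, completing the square bounds ||S_{n+2} z - T S_{n+1} z / 2||^2 by the
    energy, of order rho^(2n). The error thus grows at the same rate rho^n as the homogeneous
    solution, which creates the factor n in [sph_growth]. *)
Lemma energy_step z n :
  nm (sph n.+2 z) <= rho ^+ n * Num.sqrt (energy z 0) + rho * nm (sph n.+1 z).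
Proof.
set a := sph n.+1 z; set b := sph n.+2 z.
have h : nm (b - (2^-1)%:C *: lap a) ^+ 2 <= energy z n.
  rewrite nmB_sqr ipZr conj_realc Re_realM nmZ cmod_real ger0_norm ?invr_ge0//.
  rewrite /energy -/a -/b.
  have : nm (lap a) ^+ 2 <= (2 * rho * nm a) ^+ 2.
    by rewrite lerXn2r ?nnegrE ?nm_ge0// !mulr_ge0 ?nm_ge0// ltW.
  rewrite !exprMn rho2; lra.
have h1 : nm (b - (2^-1)%:C *: lap a) <= rho ^+ n * Num.sqrt (energy z 0).
  rewrite -[leRHS]ger0_norm; last by rewrite mulr_ge0 ?sqrtr_ge0// exprn_ge0// ltW.
  rewrite -(ger0_norm (nm_ge0 _)) -!sqrtr_sqr ler_wsqrtr//.
  have e0 : 0 <= energy z 0.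
    have := le_trans (sqr_ge0 _) h; rewrite energyE pmulr_rge0// exprn_gt0//.
  by rewrite exprMn sqr_sqrtr// -exprM mulnC -energyE.
have h2 : nm ((2^-1)%:C *: lap a) <= rho * nm a.
  rewrite nmZ cmod_real ger0_norm ?invr_ge0//; have := lap_le a; lra.
have := nmD (b - (2^-1)%:C *: lap a) ((2^-1)%:C *: lap a); rewrite subrK.
lra.
Qed.

Lemma sph_growth : exists C : R, 0 <= C /\
  forall n z, nm (sph n z) <= C * n.+1%:R * rho ^+ n * nm z.
Proof.
pose W1 : R := (size (sphere I 1))%:R; pose W2 : R := (size (sphere I 2))%:R.
have W10 : 0 <= W1 by rewrite ler0n. have W20 : 0 <= W2 by rewrite ler0n.
pose E := W2 ^+ 2 + q%:R * W1 ^+ 2 + W2 * (2 * rho * W1).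
have r1 : 1 <= rho by have := rho_gt R I2; lra.
have E0 : 0 <= E.
  by rewrite !addr_ge0 ?mulr_ge0 ?sqr_ge0 ?ler0n// ltW.
pose C := 1 + W1 + Num.sqrt E.
have sE0 : 0 <= Num.sqrt E := sqrtr_ge0 _.
have en z : Num.sqrt (energy z 0) <= Num.sqrt E * nm z.
  apply: sqrt_le; first by rewrite mulr_ge0 ?nm_ge0.
  rewrite exprMn sqr_sqrtr// /energy /E.
  have h1 := sph_nm 1 z; have h2 := sph_nm 2 z.
  have h3 : nm (sph 2 z) ^+ 2 <= (W2 * nm z) ^+ 2.
    by rewrite lerXn2r ?nnegrE ?nm_ge0// mulr_ge0 ?nm_ge0.
  have h4 : nm (sph 1 z) ^+ 2 <= (W1 * nm z) ^+ 2.
    by rewrite lerXn2r ?nnegrE ?nm_ge0// mulr_ge0 ?nm_ge0.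
  have h5 : - complex.Re (ip (sph 2 z) (lap (sph 1 z))) <=
      W2 * nm z * (2 * rho * (W1 * nm z)).
    rewrite -ReN -ipNl; apply: le_trans (Re_ip_le _ _) _; rewrite nmN.
    apply: ler_pM; rewrite ?nm_ge0//; apply: le_trans (lap_le _) _.
    by rewrite ler_wpM2l// mulr_ge0// ltW.
  have h6 := ler_wpM2l (ler0n R q) h4.
  move: h3 h6; rewrite !exprMn; lra.
have key n z : nm (sph n.+1 z) <= rho ^+ n.+1 * (W1 + n%:R * Num.sqrt E) * nm z.
  have z0 := nm_ge0 z.
  elim: n => [|n IH].
    rewrite mul0r addr0 expr1; apply: le_trans (sph_nm 1 z) _.
    by rewrite ler_wpM2r// ler_peMl.
  apply: le_trans (energy_step z n) _.
  have p0 : 0 <= rho ^+ n by rewrite exprn_ge0// ltW.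
  have h1 := ler_wpM2l p0 (en z).
  have h2 := ler_wpM2l (ltW rho_gt0) IH.
  have h3 : rho ^+ n * (Num.sqrt E * nm z) <= rho ^+ n.+2 * (Num.sqrt E * nm z).
    by rewrite ler_wpM2r ?mulr_ge0// ler_weXn2l// leqW.
  have -> : rho ^+ n.+2 * (W1 + n.+1%:R * Num.sqrt E) * nm z =
     rho ^+ n.+2 * (Num.sqrt E * nm z) +
     rho * (rho ^+ n.+1 * (W1 + n%:R * Num.sqrt E) * nm z).
    by rewrite -natr1 (exprS _ n.+1); ring.
  lra.
exists C; split; first by rewrite /C; lra.
case=> [|n] z.
  rewrite sph0 expr0 !mulr1 ler_peMl ?nm_ge0// /C; lra.
apply: le_trans (key n z) _.
rewrite ler_wpM2r ?nm_ge0// mulrC ler_wpM2r ?exprn_ge0 ?(ltW rho_gt0)//.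
rewrite /C -[n.+2%:R]natr1 -[n.+1%:R]natr1.
have n0 : 0 <= (n%:R : R) := ler0n _ _.
have := mulr_ge0 n0 W10; have := mulr_ge0 n0 sE0; lra.
Qed.

End Upper.

(** * Lower bound for the norm of the Laplacian *)

Section Lower.
Variables (r : R) (eta : L).
Hypothesis r0 : 0 <= r.
Hypothesis I2 : (2 <= #|I|)%N.
Hypothesis lap_le : forall z, nm (lap z) <= r * nm z.
Hypothesis eta_neq0 : eta != 0.
Hypothesis eta_pos : forall w, 0 <= complex.Re (ip (pw w eta) eta).

Let s n k : R := complex.Re (ip (iter n lap (sph k eta)) eta).

Fixpoint all_words n : seq (seq letter) :=
  if n is n'.+1 then [seq a :: w | a <- enum letter, w <- all_words n']
  else [:: [::]].

Lemma iter_lap n z : iter n lap z = \sum_(w <- all_words n) pw w z.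
Proof.
elim: n => [|n IH]; first by rewrite /= big_seq1.
rewrite iterS IH /= big_allpairs_dep/= big_enum/=; apply: eq_bigr => a _.
by rewrite lin_sum.
Qed.

Let s_ge0 n k : 0 <= s n k.
Proof.
rewrite /s iter_lap ip_suml Re_sum; apply: sumr_ge0 => w _.
rewrite /sph -/(pw w _).
have lin_pw : linear (pw w).
  by elim: w => //= a w IH c x y; rewrite -[LHS]/(Pi a (pw w (c *: x + y))) IH Pi_lin.
rewrite lin_sum// ip_suml Re_sum; apply: sumr_ge0 => v _.
by rewrite -pw_cat.
Qed.

Let iter_lap_lin n : linear (iter n lap).
Proof.
elim: n => [|n IH] c x y //=.
by rewrite IH lap_lin.
Qed.

Let s0 n : s n.+1 0 = s n 1.
Proof. by rewrite /s iterSr sph0 sph1. Qed.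

(** Only an inequality, because at k = 0 the recursion carries q + 1 in place of q and s is
    nonnegative. *)
Let sS n k : s n k.+2 + q%:R * s n k <= s n.+1 k.+1.
Proof.
rewrite /s iterSr lap_sph (linD _ _ (iter_lap_lin n)) (linZ _ _ (iter_lap_lin n)).
rewrite ipDl ReD lerD2l ipZl -(rmorph_nat (real_complex R)) Re_realM.
rewrite ler_wpM2r ?s_ge0// ler_nat; case: k => //=.
by rewrite /branching leq_pred.
Qed.

(** The weights c are the tent 1, 2, ..., p, ..., 2, 1. Neighbours add up to 2 c_k off the peak and
    to 2(p - 1) at it, whence the factor 1 - 1/p. Paired with the scaled moments F, the tent grows
    by at least 2 rho (1 - 1/p) per power of T, while its growth rate is at most r. *)
Lemma lap_lower_kappa p : (0 < p)%N -> 2 * rho * (1 - p%:R^-1) <= r.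
Proof.
move=> p0; pose c k : R := (minn k.+1 (2 * p - 1 - k))%:R.
pose c' k : R := if k is k'.+1 then c k' else 0.
(* One index beyond the support of c, so that boundary terms of the shifted sums vanish. *)
pose m := (2 * p)%N.
have rp : 0 < rho := rho_gt0 R I2.
have r2 : rho ^+ 2 = q%:R := rho2 R I.
have c_ineq k : 2 * (1 - p%:R^-1) * c k <= c' k + c k.+1.
  have pR : 0 < p%:R :> R by rewrite ltr0n.
  rewrite -(ler_pM2r pR).
  have -> : 2 * (1 - p%:R^-1) * c k * p%:R = 2 * (p%:R - 1) * c k.
    by field; rewrite gt_eqF.
  have -> : p%:R - 1 = p.-1%:R :> R by case: (p) p0 => // p' _; rewrite -natr1 addrK.
  rewrite /c' /c; case: k => [|k]; rewrite -?natrD ?add0r -!natrM ler_nat; nia.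
pose F n k := s n k / rho ^+ k.
have F0 n k : 0 <= F n k by rewrite divr_ge0 ?s_ge0// exprn_ge0// ltW.
pose sg n := \sum_(0 <= k < m) c k * F n k.
have F_S n k : rho * (F n k.+2 + F n k) <= F n.+1 k.+1.
  rewrite /F ler_pdivlMr ?exprn_gt0//; apply: le_trans (sS n k).
  rewrite le_eqVlt; apply/orP; left; apply/eqP.
  have -> : q%:R * s n k = rho ^+ 2 * s n k by rewrite r2.
  have rk : 0 < rho ^+ k by rewrite exprn_gt0.
  rewrite !exprS expr0; move: (rho) rp (rho ^+ k) rk => x x0 y y0; field.
  by rewrite !gt_eqF.
have F_0 n : rho * F n 1 <= F n.+1 0.
  rewrite /F s0 expr0 expr1 divr1 mulrCA divff ?mulr1//.
  by rewrite gt_eqF.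
have k0 : 0 <= 1 - p%:R^-1 :> R by rewrite subr_ge0 invf_le1 ?ltr0n// ler1n.
have c0 k : 0 <= c k by exact: ler0n.
have [m2 mE] : exists m2, m = m2.+2 by exists m.-2; rewrite /m; lia.
have cm k : (m2 < k)%N -> c k = 0.
  by move=> mk; rewrite /c; have -> : minn k.+1 (2 * p - 1 - k) = 0%N by lia.
have step n : 2 * rho * (1 - p%:R^-1) * sg n <= sg n.+1.
  have h1 : 2 * (1 - p%:R^-1) * sg n <= \sum_(0 <= k < m) (c' k + c k.+1) * F n k.
    rewrite mulr_sumr; apply: ler_sum => k _.
    by rewrite mulrA ler_wpM2r.
  have h2 : \sum_(0 <= k < m) c' k * F n k <=
      c 0%N * F n 1%N + \sum_(0 <= k < m2.+1) c k.+1 * F n k.+2.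
    rewrite mE big_nat_recl//= mul0r add0r big_nat_recl//= lerD2l.
    by rewrite [leRHS]big_nat_recr//= lerDl mulr_ge0.
  have h3 : \sum_(0 <= k < m) c k.+1 * F n k = \sum_(0 <= k < m2.+1) c k.+1 * F n k.
    by rewrite mE big_nat_recr//= (cm m2.+2)// mul0r addr0.
  have h4 : rho * (c 0%N * F n 1%N + \sum_(0 <= k < m2.+1) c k.+1 * F n k.+2 +
      \sum_(0 <= k < m2.+1) c k.+1 * F n k) <= sg n.+1.
    have -> : sg n.+1 = c 0%N * F n.+1 0%N +
        \sum_(0 <= k < m2.+1) c k.+1 * F n.+1 k.+1.
      by rewrite /sg mE big_nat_recl.
    rewrite -[X in rho * X]addrA mulrDr; apply: lerD.
      by rewrite mulrCA ler_wpM2l.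
    rewrite -big_split mulr_sumr; apply: ler_sum => k _.
    by rewrite /= -mulrDr mulrCA ler_wpM2l.
  apply: le_trans h4.
  have -> : 2 * rho * (1 - p%:R^-1) * sg n = rho * (2 * (1 - p%:R^-1) * sg n) by ring.
  rewrite ler_wpM2l ?(ltW rp)//; apply: le_trans h1 _.
  under eq_bigr do rewrite mulrDl.
  by rewrite big_split/= h3 lerD2r.
have iter_step n : (2 * rho * (1 - p%:R^-1)) ^+ n * sg 0%N <= sg n.
  elim: n => [|n IH]; first by rewrite mul1r.
  apply: le_trans (step n); rewrite exprS -mulrA ler_wpM2l//.
  by rewrite !mulr_ge0 ?(ltW rp).
have sg0 : 0 < sg 0%N.
  rewrite /sg mE big_nat_recl//= ltr_pwDl//; last first.
    by apply: sumr_ge0 => k _; rewrite mulr_ge0.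
  rewrite mulr_gt0//; first by rewrite /c ltr0n; lia.
  rewrite /F /s/= sph0 expr0 divr1 -nm_sqr exprn_gt0// lt_neqAle nm_ge0 andbT.
  by apply: contraNneq eta_neq0 => /esym/nm_eq0 ->.
have it_nm n z : nm (iter n lap z) <= r ^+ n * nm z.
  elim: n => [|n IH]; first by rewrite mul1r.
  by rewrite iterS exprS -mulrA (le_trans (lap_le _))// ler_wpM2l.
pose B := \sum_(0 <= k < m) c k * (nm (sph k eta) * nm eta / rho ^+ k).
apply: (@pow_compare _ _ _ (sg 0%N) B) => //.
  by rewrite !mulr_ge0 ?(ltW rp).
move=> n; exists n => //; apply: le_trans (iter_step n) _.
rewrite /B mulr_sumr; apply: ler_sum => k _.
rewrite [leRHS]mulrCA ler_wpM2l//.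
rewrite /F [leRHS]mulrA ler_wpM2r ?invr_ge0 ?exprn_ge0 ?(ltW rp)//.
apply: le_trans (Re_ip_le _ _) _.
by rewrite mulrA ler_wpM2r ?nm_ge0.
Qed.

Lemma lap_lower : 2 * rho <= r.
Proof.
rewrite leNgt; apply/negP => h.
have d0 : 0 < 2 * rho - r by rewrite subr_gt0.
apply: (archi_false (B := 2 * rho) d0) => -[|k].
  by rewrite mulr0 mulr_ge0// sqrtr_ge0.
have := lap_lower_kappa (ltn0Sn k).
have kp : 0 < (k.+1%:R : R) := ltr0Sn R k.
move=> /(ler_wpM2r (ltW kp)).
have -> : 2 * rho * (1 - k.+1%:R^-1) * k.+1%:R = 2 * rho * k.+1%:R - 2 * rho.
  by move: (k.+1%:R) kp (rho) => x x0 y; field; rewrite gt_eqF.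
lra.
Qed.

End Lower.
End Laplacian.

(** * The random walk on the free group *)

Section FreeGroup.
Variable I : finType.
Local Notation letter := (letter I).
Implicit Types (a b : letter) (w v g : seq letter).

Definition act a w :=
  if w is b :: w' then if a == linv b then w' else a :: w else [:: a].

Definition acts v w := foldr act w v.

Definition red w := acts w [::].

Lemma act_reduced a w : reduced w -> reduced (act a w).
Proof.
case: w => // b w rw; rewrite /act; case: eqVneq => [_|ab].
  by case/andP: rw.
by apply/andP.
Qed.

Lemma act_linv a w : reduced w -> act a (act (linv a) w) = w.
Proof.
case: w => [|b w] rw /=; first by rewrite linvK eqxx.
case: eqVneq => [e|ab]; last by rewrite /= linvK eqxx.
have -> : a = b by rewrite -(linvK a) e linvK.
by case: w rw => [|c w] //= /andP[/negbTE -> _].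
Qed.

Lemma act_linv' a w : reduced w -> act (linv a) (act a w) = w.
Proof. by move=> rw; rewrite -{2}(linvK a) act_linv. Qed.

Lemma acts_reduced v w : reduced w -> reduced (acts v w).
Proof. by move=> rw; elim: v => //= a v; exact: act_reduced. Qed.

Lemma red_reduced w : reduced (red w).
Proof. exact: acts_reduced. Qed.

Lemma red_cat v w : red (v ++ w) = acts v (red w).
Proof. exact: foldr_cat. Qed.

Section Schur.
Variable R : realType.
Hypothesis I2 : (2 <= #|I|)%N.
Local Notation q := (branching I).
Local Notation rho := (Num.sqrt (q%:R : R)).
Implicit Types (f : seq letter -> R).

(* [f] restricted to reduced words has squared l2-norm at most [K] *)
Definition l2_bound f (K : R) := forall G, uniq G -> all (@reduced I) G ->
  \sum_(g <- G) f g ^+ 2 <= K.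

Definition walk f g : R := \sum_a f (act (linv a) g).

Let rho0 : 0 < rho := rho_gt0 R I2.
Let rho_sqr : rho ^+ 2 = q%:R := rho2 R I.
Let sig := Num.sqrt rho.
Let sig0 : 0 < sig. Proof. by rewrite sqrtr_gt0. Qed.
Let sig_sqr : sig ^+ 2 = rho. Proof. by rewrite sqr_sqrtr// ltW. Qed.
Let h g : R := (rho ^+ size g)^-1.
Let h0 g : 0 < h g. Proof. by rewrite invr_gt0 exprn_gt0. Qed.

(** Away from the identity this is an equality: the shorter neighbour contributes rho, the q longer
    ones q / rho = rho. At the identity, (q + 1) / rho <= 2 rho. *)
Let h_superharmonic g : \sum_a h (act a g) <= 2 * rho * h g.
Proof.
have q1 : 1 <= (q%:R : R) by have := q_ge3 R I2; lra.
case: g => [|b g].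
  rewrite (eq_bigr (fun=> rho^-1)) => [|a _]; last by rewrite /h expr1.
  rewrite sumr_const /h expr0 invr1 mulr1 -[leLHS]mulr_natr ler_pdivrMl//.
  have -> : rho * (2 * rho) = 2 * rho ^+ 2 by ring.
  rewrite rho_sqr.
  have -> : #|letter| = q.+1.
    by rewrite /branching prednK// card_letter; move: I2; lia.
  by rewrite -natr1; lra.
rewrite (bigD1 (linv b))//= eqxx (eq_bigr (fun=> (rho ^+ (size g).+2)^-1)); last first.
  by move=> a /negbTE ->.
rewrite sumr_const card_neq /h /= -[X in _ + X <= _]mulr_natr -[X in _ * X]rho_sqr.
have r0 : 0 < rho ^+ size g by rewrite exprn_gt0.
rewrite le_eqVlt; apply/orP; left; apply/eqP; rewrite !exprS expr0.
move: (rho) rho0 (rho ^+ size g) r0 => x x0 y y0; field.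
by rewrite !gt_eqF.
Qed.

(** Schur test with weight h. Superharmonicity is used twice, after Cauchy-Schwarz at each g and
    again for the sum over the neighbours of each k, giving one factor 2 rho each time. *)
Lemma walk_l2 f K : l2_bound f K -> l2_bound (walk f) ((2 * rho) ^+ 2 * K).
Proof.
move=> fK G uG rG.
(* Cauchy-Schwarz for the factorisation f = h^(1/2) (f h^(-1/2)), where h^(1/2) is a negative power
   of [sig]. *)
have CS g : walk f g ^+ 2 <= 2 * rho * h g *
    \sum_a (f (act (linv a) g) ^+ 2 / h (act (linv a) g)).
  have -> : walk f g = \sum_a (sig ^+ size (act (linv a) g))^-1 *
      (f (act (linv a) g) * sig ^+ size (act (linv a) g)).
    apply: eq_bigr => a _; rewrite mulrC mulfK// gt_eqF// exprn_gt0//.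
  apply: le_trans (sumr_CS _ _ _ _) _.
  have -> : \sum_a (f (act (linv a) g) * sig ^+ size (act (linv a) g)) ^+ 2 =
      \sum_a (f (act (linv a) g) ^+ 2 / h (act (linv a) g)).
    by apply: eq_bigr => a _; rewrite exprMn -exprM mulnC exprM sig_sqr /h invrK.
  apply: ler_wpM2r.
    by apply: sumr_ge0 => a _; rewrite divr_ge0 ?sqr_ge0// ltW.
  apply: le_trans (h_superharmonic g).
  rewrite [leRHS](reindex_inj (can_inj (@linvK I)))/=; apply: ler_sum => a _.
  by rewrite exprVn -exprM mulnC exprM sig_sqr.
pose phi a k := f k ^+ 2 / h k * h (act a k).
have phi0 a k : 0 <= phi a k.
  by rewrite /phi mulr_ge0 ?divr_ge0 ?sqr_ge0// ltW.
(* A single finite set that receives G injectively under every letter. *)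
pose G' := undup (flatten [seq [seq act (linv a) g | g <- G] | a <- enum letter]).
have rG' : all (@reduced I) G'.
  apply/allP => k; rewrite mem_undup => /flatten_mapP[a _ /mapP[g gG ->]].
  by apply: act_reduced; exact: (allP rG).
apply: le_trans (_ : 2 * rho * \sum_a \sum_(g <- G) phi a (act (linv a) g) <= _).
  rewrite exchange_big/= mulr_sumr big_seq [leRHS]big_seq; apply: ler_sum => g gG.
  apply: le_trans (CS g) _; rewrite -mulrA ler_wpM2l ?mulr_ge0 ?(ltW rho0)//.
  rewrite mulr_sumr; apply: ler_sum => a _.
  by rewrite /phi act_linv ?(allP rG)// mulrC.
apply: le_trans (_ : 2 * rho * \sum_a \sum_(k <- G') phi a k <= _).
  rewrite ler_wpM2l ?mulr_ge0 ?(ltW rho0)//; apply: ler_sum => a _.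
  rewrite -[leLHS](big_map (act (linv a)) xpredT).
  apply: ler_sum_sub => //.
    rewrite map_inj_in_uniq// => g g' gG g'G e.
    by rewrite -(act_linv a (allP rG _ gG)) e act_linv ?(allP rG).
  move=> k kG; rewrite mem_undup; apply/flatten_mapP; exists a => //.
  by rewrite mem_enum.
rewrite exchange_big/= expr2 -!mulrA ler_wpM2l// ler_wpM2l ?(ltW rho0)//.
apply: le_trans (_ : 2 * rho * \sum_(k <- G') f k ^+ 2 <= _); last first.
  by rewrite mulrA ler_wpM2l ?mulr_ge0 ?(ltW rho0)// fK// undup_uniq.
rewrite mulr_sumr; apply: ler_sum => k _.
rewrite -mulr_sumr; apply: le_trans (_ : f k ^+ 2 / h k * (2 * rho * h k) <= _).
  by rewrite ler_wpM2l// divr_ge0 ?sqr_ge0// ltW.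
rewrite le_eqVlt; apply/orP; left; apply/eqP.
by move: (h k) (h0 k) => x x0; field; rewrite gt_eqF.
Qed.

Lemma walks_l2 f K n : l2_bound f K ->
  l2_bound (fun g => \sum_(s <- all_words I n) f (acts (winv s) g))
           ((2 * rho) ^+ (2 * n) * K).
Proof.
move=> fK; elim: n => [|n IH].
  by rewrite expr0 mul1r => G uG rG; under eq_bigr do rewrite big_seq1; exact: fK.
have := walk_l2 IH; rewrite mulrA -exprD -[(2 + _)%N]mulnS.
set f1 := walk _; set f2 := fun g => _.
suff -> : f2 = f1 by [].
apply/funext => g; rewrite /f1 /f2 /walk /= big_allpairs_dep/= big_enum/=.
apply: eq_bigr => a _; apply: eq_bigr => s _.
by rewrite winv_cons /acts foldr_rcons.
Qed.

End Schur.
End FreeGroup.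

Section ActionInverse.
Variable I : finType.
Implicit Types (w g s : seq (letter I)).

Lemma actsK s w : reduced w -> acts (winv s) (acts s w) = w.
Proof.
move=> rw; elim: s => // a s IH; rewrite winv_cons /acts foldr_rcons/=.
by rewrite act_linv' ?IH//; exact: acts_reduced.
Qed.

Lemma acts_eq s w g : reduced w -> reduced g ->
  (acts s w == g) = (w == acts (winv s) g).
Proof.
move=> rw rg; apply/eqP/eqP => [<-|->]; first by rewrite actsK.
by rewrite -{1}(winvK s) actsK.
Qed.

End ActionInverse.

(** * Norm of the Laplacian when t vanishes on nontrivial reduced words *)

Section Regular.
Context (R : realType) (H : hilbertType R) (M : set (H -> H)).
Hypothesis hM : von_neumann M.
Variables (I : finType) (u : I -> H -> H).
Hypothesis hu : forall i, M (u i) /\ unitary_op (u i).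
Variable tau : (H -> H) -> R[i].
Hypothesis htau : normal_faithful_tracial_state M tau.
Local Notation letter := (letter I).
Local Notation q := (branching I).
Local Notation rho := (Num.sqrt (q%:R : R)).
Local Notation e := (letter_op u).
Local Notation ev := (word_op u).
Local Notation comb := (lincomb u).
Local Notation tw := (word_trace u tau).
Implicit Types (a : letter) (w v g : seq letter) (x y : H).
Implicit Types (l : seq (R[i] * seq letter)).

Lemma ev_act a w : ev (act a w) = e a \o ev w.
Proof.
case: w => // b w; rewrite /act; case: eqVneq => // ->.
by apply/funext => x /=; rewrite -{2}(linvK b) (eK hu).
Qed.

Lemma ev_red w : ev (red w) = ev w.
Proof. by elim: w => // a w IH; rewrite -[red _]/(act a (red w)) ev_act IH. Qed.

Hypothesis tw0 : forall w, reduced w -> w != [::] -> tw w = 0.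

Lemma tw_orth w v : reduced w -> reduced v -> tw (winv w ++ v) = (w == v)%:R.
Proof.
elim: w v => [|a w IH] [|b v] rw rv.
- exact: tw_nil htau.
- exact: tw0.
- by rewrite cats0 tw0 ?reduced_winv// -size_eq0 size_winv.
- rewrite eqseq_cons; case: eqVneq => [->|ab].
    rewrite (t_cancel_common (tw_trace hM hu htau) (tw_cancel hu tau)) IH//.
      by case/andP: rw.
    by case/andP: rv.
  rewrite tw0 ?reduced_winv_cat//.
  by rewrite -size_eq0 size_cat addnC.
Qed.

Lemma tw_orth_red w v : tw (winv w ++ v) = (red w == red v)%:R.
Proof.
rewrite -tw_orth ?red_reduced//; congr tau.
by rewrite !ev_cat -!(ev_adj hM hu) !ev_red.
Qed.

(** Reduced words being orthonormal for tau, these are the L^2(tau) coordinates of [lincomb u l]. *)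
Definition beta l g : R[i] := \sum_(p <- l | red p.2 == g) p.1.
Definition supp l := undup [seq red p.2 | p <- l].

Lemma sum_supp (V : nmodType) l (X : R[i] * seq letter -> V) :
  \sum_(p <- l) X p = \sum_(g <- supp l) \sum_(p <- l | red p.2 == g) X p.
Proof.
rewrite (exchange_big_dep xpredT)//= big_seq [RHS]big_seq; apply: eq_bigr => p pl.
rewrite -big_filter (_ : [seq g <- _ | _] = [:: red p.2]) ?big_seq1//.
rewrite -(filter_pred1_uniq (undup_uniq [seq red p.2 | p <- l])); last first.
  by rewrite mem_undup (map_f (fun p => red p.2)).
by apply: eq_filter => g; rewrite /= eq_sym.
Qed.

Lemma tau_comb_l2 l : tau (adj (comb l) \o comb l) =
  (\sum_(g <- supp l) cmod (beta l g) ^+ 2)%:C.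
Proof.
rewrite (tau_comb_sqr hM hu htau) sum_supp rmorph_sum/=; apply: eq_bigr => g _.
rewrite -mulJ /beta rmorph_sum/= mulr_suml; apply: eq_bigr => p /eqP pg.
rewrite mulr_sumr [RHS]big_mkcond/=; apply: eq_bigr => r _.
by rewrite tw_orth_red pg eq_sym; case: eqP; rewrite ?mulr1 ?mulr0.
Qed.

Lemma beta_l2 l : l2_bound (fun g => cmod (beta l g))
  (complex.Re (tau (adj (comb l) \o comb l))).
Proof.
rewrite tau_comb_l2/= => G uG _.
rewrite (bigID (fun g => g \in supp l))/= [X in _ + X]big1 ?addr0; last first.
  move=> g gl; rewrite /beta big_seq_cond big1 ?cmod0 ?expr0n// => p /andP[pl /eqP e].
  by move: gl; rewrite mem_undup -e (map_f (fun p => red p.2)).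
rewrite -big_filter; apply: ler_sum_sub => [g||g]; first exact: sqr_ge0.
  exact: filter_uniq.
by rewrite mem_filter => /andP[].
Qed.

Lemma beta_mul n (f : seq letter -> R[i]) l g : reduced g ->
  beta (comb_mul [seq (f s, s) | s <- all_words I n] l) g =
  \sum_(s <- all_words I n) f s * beta l (acts (winv s) g).
Proof.
move=> rg; rewrite /beta big_mkcond big_allpairs_dep/= big_map.
apply: eq_bigr => s _; rewrite -big_mkcond mulr_sumr; apply: eq_bigl => p /=.
by rewrite red_cat acts_eq// red_reduced.
Qed.

Hypothesis I2 : (2 <= #|I|)%N.

(** The coordinates of the product with [comb l] are at most F times the n-step walk applied to
    |beta l|. [walks_l2] bounds their l2-norm and [tau_norm_bound] passes to H. *)
Lemma words_norm n (f : seq letter -> R[i]) (F : R) : 0 <= F ->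
  (forall s, cmod (f s) <= F) -> forall x,
  nm (comb [seq (f s, s) | s <- all_words I n] x) <= F * (2 * rho) ^+ n * nm x.
Proof.
move=> F0 fF.
have r0 : 0 <= (2 * rho) ^+ n by rewrite exprn_ge0// mulr_ge0// sqrtr_ge0.
apply: (tau_norm_bound hM htau (comb_star_algebra hM hu)).
- by move=> _ [l _ <-]; exact: comb_vn.
- by exists [seq (f s, s) | s <- all_words I n].
- exact: mulr_ge0.
move=> _ [l _ <-]; rewrite (comb_comp hM hu).
set l' := comb_mul _ _; set K := complex.Re (tau (adj (comb l) \o _)).
rewrite tau_comb_l2/=.
pose N g := \sum_(s <- all_words I n) cmod (beta l (acts (winv s) g)).
have rs : all (@reduced I) (supp l').
  by apply/allP => g; rewrite mem_undup => /mapP[p _ ->]; exact: red_reduced.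
apply: le_trans (_ : \sum_(g <- supp l') (F * N g) ^+ 2 <= _).
  rewrite big_seq [leRHS]big_seq; apply: ler_sum => g gl.
  rewrite lerXn2r ?nnegrE ?cmod_ge0//.
    by rewrite mulr_ge0// sumr_ge0// => s _; exact: cmod_ge0.
  rewrite /l' beta_mul ?(allP rs)//; apply: le_trans (cmod_sum _ _ _) _.
  rewrite mulr_sumr; apply: ler_sum => s _; rewrite cmodM ler_wpM2r ?cmod_ge0//.
under eq_bigr do rewrite exprMn.
rewrite -mulr_sumr [(F * _) ^+ 2]exprMn -[leRHS]mulrA ler_wpM2l ?sqr_ge0// -exprM mulnC.
exact: (walks_l2 I2 n (@beta_l2 l)) (undup_uniq _) rs.
Qed.

Variable L : hilbert_tensor H (conjsp H).
Local Notation Pi := (@Pi R H I u L).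
Local Notation T := (lap Pi).

Lemma pw_ht w x (k : conjsp H) : pw Pi w (ht L x k) = ht L (ev w x) (ev w k : conjsp H).
Proof. by elim: w => //= a w ->; rewrite (Pi_ht hM hu). Qed.

Lemma PiK a (z : L) : Pi a (Pi (linv a) z) = z.
Proof.
apply: ip_eq => z'; apply/eqP; rewrite -subr_eq0; apply/eqP.
have /bounded_opP[l1 [C C0 hC]] := Pi_bounded hM hu L a.
have /bounded_opP[l2 [D D0 hD]] := Pi_bounded hM hu L (linv a).
pose F (y : L) := ip (Pi a (Pi (linv a) y)) z' - ip y z'; rewrite -/(F z).
apply: (tensor_functional_eq0 (C := (C * D + 1) * nm z')).
- by move=> y y'; rewrite /F !linD// !ipDl opprD addrACA.
- move=> y; apply: le_trans (cmodD _ _) _; rewrite cmodN.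
  apply: le_trans (lerD (cauchy_schwarz _ _) (cauchy_schwarz _ _)) _.
  rewrite -mulrDl mulrAC ler_wpM2r ?nm_ge0// mulrDl mul1r lerD2r.
  apply: le_trans (hC _) _; rewrite -mulrA; exact: ler_wpM2l.
- move=> h k; rewrite /F !(Pi_ht hM hu) (eK hu).
  by rewrite -[X in ht L h X]/(_ : H) (eK hu) subrr.
Qed.

(** The second leg only contributes scalars f(s) = <s k, k'>, bounded by ||k|| ||k'||. What remains
    is a matrix coefficient of sum f(s) s(u), covered by [words_norm]. *)
Lemma iter_lap_ht n x x' (k k' : conjsp H) :
  cmod (ip (iter n T (ht L x k)) (ht L x' k')) <=
  nm k * nm k' * (2 * rho) ^+ n * nm x * nm x'.
Proof.
rewrite (iter_lap (Pi_lin hM hu (L := L))) ip_suml.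
pose f s : R[i] := ip (ev s k : conjsp H) k'.
have -> : \sum_(s <- all_words I n) ip (pw Pi s (ht L x k)) (ht L x' k') =
    ip (comb [seq (f s, s) | s <- all_words I n] x) x'.
  rewrite /lincomb big_map ip_suml; apply: eq_bigr => s _.
  by rewrite pw_ht ip_ht ipZl mulrC.
apply: le_trans (cauchy_schwarz _ _) _; rewrite ler_wpM2r ?nm_ge0//.
apply: words_norm => [|s]; first by rewrite mulr_ge0 ?nm_ge0.
by rewrite /f ip_conj mulrC (le_trans (cauchy_schwarz _ _))// (ev_nm hM hu).
Qed.

(** Self-adjointness gives ||T^n v||^2 <= ||T^(2n) v|| ||v||, so by doubling ||T^n v|| >= la^n ||v||
    for n = 2^k, where la = ||T v|| / ||v||. The moments are at most B (2 rho)^n with B depending on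
    v, and large n removes B. *)
Lemma lap_norm_tsum (s : seq (H * conjsp H)) :
  nm (T (tsum L s)) <= 2 * rho * nm (tsum L s).
Proof.
set v := tsum L s; pose B := \sum_(p <- s) \sum_(p' <- s)
  nm p.2 * nm p'.2 * (nm p.1 * nm p'.1).
have r0 : 0 <= 2 * rho by rewrite mulr_ge0// sqrtr_ge0.
have Tl : linear T := lap_lin (Pi_lin hM hu (L := L)).
have itl n : linear (iter n T).
  by elim: n => [|n IH] c x y //=; rewrite IH Tl.
have Tsa z z' : ip (T z) z' = ip z (T z') := lap_sa (Pi_adj hM hu (L := L)) z z'.
have itsa n z z' : ip (iter n T z) z' = ip z (iter n T z').
  elim: n z z' => //= n IH z z'; rewrite Tsa IH.
  by rewrite -iterS iterSr.
have mom n : complex.Re (ip (iter n T v) v) <= (2 * rho) ^+ n * B.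
  apply: le_trans (Re_le_md _) _.
  rewrite {1}/v /tsum lin_sum// ip_suml.
  apply: le_trans (cmod_sum _ _ _) _; rewrite mulr_sumr; apply: ler_sum => p _.
  rewrite /v /tsum ip_sumr; apply: le_trans (cmod_sum _ _ _) _.
  rewrite mulr_sumr; apply: ler_sum => p' _.
  apply: le_trans (iter_lap_ht n _ _ _ _) _.
  by rewrite le_eqVlt; apply/orP; left; apply/eqP; ring.
have [->|v0] := eqVneq v 0; first by rewrite lin0// !nm0 mulr0.
have nv : 0 < nm v.
  by rewrite lt_neqAle nm_ge0 andbT; apply: contraNneq v0 => /esym/nm_eq0 ->.
pose la := nm (T v) / nm v.
have la0 : 0 <= la by rewrite divr_ge0 ?nm_ge0.
have pw2 k : la ^+ (2 ^ k) * nm v <= nm (iter (2 ^ k) T v).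
  elim: k => [|k IH]; first by rewrite expr1 /= divfK// gt_eqF.
  set n := (2 ^ k)%N in IH *; have -> : (2 ^ k.+1)%N = (n + n)%N.
    by rewrite expnS mul2n addnn.
  have h1 : nm (iter n T v) ^+ 2 <= nm (iter (n + n) T v) * nm v.
    by rewrite nm_sqr -itsa -iterD; exact: Re_ip_le.
  have h2 : (la ^+ n * nm v) ^+ 2 <= nm (iter n T v) ^+ 2.
    by rewrite lerXn2r ?nnegrE ?nm_ge0// mulr_ge0 ?nm_ge0// exprn_ge0.
  rewrite -(ler_pM2r nv); apply: le_trans (le_trans h2 h1).
  by rewrite le_eqVlt; apply/orP; left; apply/eqP; rewrite exprD; ring.
rewrite -ler_pdivrMr// -/la.
apply: (@pow_compare _ _ _ (nm v ^+ 2) B) => //; first exact: exprn_gt0.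
move=> k; exists (2 ^ k.+1)%N.
  by apply: ltnW; apply: ltn_trans (ltnSn k) _; exact: ltn_expl.
set n := (2 ^ k)%N; have -> : (2 ^ k.+1)%N = (n + n)%N.
  by rewrite expnS mul2n addnn.
apply: le_trans (mom _).
have -> : complex.Re (ip (iter (n + n) T v) v) = nm (iter n T v) ^+ 2.
  by rewrite iterD itsa nm_sqr.
rewrite exprD -expr2 -exprMn lerXn2r ?nnegrE ?nm_ge0 ?pw2//.
by rewrite mulr_ge0 ?nm_ge0// exprn_ge0.
Qed.

Lemma lap_norm (z : L) : nm (T z) <= 2 * rho * nm z.
Proof.
have r0 : 0 <= 2 * rho by rewrite mulr_ge0// sqrtr_ge0.
have Tl : linear T := lap_lin (Pi_lin hM hu (L := L)).
apply/ler_addgt0Pr => d d0.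
pose K := #|letter|%:R + 2 * rho + 1.
have K0 : 0 < K by rewrite ltr_wpDl// addr_ge0// ler0n.
have [s hs] := tsum_dense z (divr_gt0 d0 K0).
have h1 : nm (T (z - tsum L s)) <= #|letter|%:R * nm (z - tsum L s).
  exact: (lap_nm (Pi_adj hM hu (L := L)) PiK).
have h2 := lap_norm_tsum s.
have h3 := nmD (T (z - tsum L s)) (T (tsum L s)).
rewrite -(linD _ _ Tl) subrK in h3.
have h4 := nmD (tsum L s - z) z; rewrite subrK -(nmN (_ - z)) opprB in h4.
have h5 := ler_wpM2l r0 h4.
have h6 : (#|letter|%:R + 2 * rho) * nm (z - tsum L s) <= d.
  apply: le_trans (_ : K * nm (z - tsum L s) <= _).
    by rewrite ler_wpM2r ?nm_ge0// lerDl.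
  by rewrite mulrC -ler_pdivlMr.
rewrite mulrDl in h6; rewrite mulrDr in h5; lra.
Qed.

End Regular.

(** * Growth of the character under the norm bound *)

Section Growth.
Context (R : realType) (H : hilbertType R) (M : set (H -> H)).
Hypothesis hM : von_neumann M.
Variables (I : finType) (u : I -> H -> H).
Hypothesis hu : forall i, M (u i) /\ unitary_op (u i).
Variable tau : (H -> H) -> R[i].
Hypothesis htau : normal_faithful_tracial_state M tau.
Local Notation letter := (letter I).
Local Notation q := (branching I).
Local Notation rho := (Num.sqrt (q%:R : R)).
Local Notation ev := (word_op u).
Local Notation comb := (lincomb u).
Local Notation tw := (word_trace u tau).
Hypothesis I2 : (2 <= #|I|)%N.
Variable L : hilbert_tensor H (conjsp H).
Local Notation Pi := (@Pi R H I u L).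
Local Notation T := (lap Pi).

Lemma ip_pw_diag w x : ip (pw Pi w (ht L x (x : conjsp H))) (ht L x (x : conjsp H)) =
  (cmod (ip (ev w x) x) ^+ 2)%:C.
Proof.
by rewrite (pw_ht hM hu) ip_ht ip_conj [X in _ * X]ipC mulrC mulJ.
Qed.

(** Phi is quadratic in tau, so the bound for vector states is first made linear through D = sum
    conj(t(w)) w: tau(D) = Phi(n) = P, while Cauchy-Schwarz gives Re <D x, x> <= sqrt(P B)
    ||x||^2. *)
Lemma tw_growth : (forall z, nm (T z) <= 2 * rho * nm z) ->
  exists C : R, forall n, Phi tw n <= C * n.+1%:R * rho ^+ n.
Proof.
move=> hT.
have [C [C0 hC]] := sph_growth (Pi_lin hM hu (L := L))
  (Pi_adj hM hu (L := L)) (PiK hM hu (L := L)) I2 hT.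
exists C => n; set B := C * _ * _.
have B0 : 0 <= B by rewrite !mulr_ge0// exprn_ge0// sqrtr_ge0.
have vec x : \sum_(w <- sphere I n) cmod (ip (ev w x) x) ^+ 2 <= B * (nm x ^+ 2) ^+ 2.
  pose z := ht L x (x : conjsp H).
  have -> : \sum_(w <- sphere I n) cmod (ip (ev w x) x) ^+ 2 = complex.Re (ip (sph Pi n z) z).
    rewrite /sph ip_suml Re_sum; apply: eq_bigr => w _.
    by rewrite ip_pw_diag.
  apply: le_trans (Re_ip_le _ _) _.
  have nz : nm z = nm x ^+ 2 by rewrite nm_ht nm_conj -expr2.
  by rewrite -nz [nm z ^+ 2]expr2 mulrA ler_wpM2r ?nm_ge0.
set P := Phi tw n; have P0 : 0 <= P := Phi_ge0 _ _.
pose s := Num.sqrt P * Num.sqrt B.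
pose l := [seq (Num.conj (tw w), w) | w <- sphere I n].
have tD : tau (comb l) = P%:C.
  rewrite (tau_comb hM hu htau) big_map rmorph_sum/=.
  by apply: eq_bigr => w _; rewrite mulJ.
have bnd x : complex.Re (ip (comb l x) x) <= s * nm x ^+ 2.
  rewrite /lincomb big_map ip_suml; apply: le_trans (Re_le_md _) _.
  apply: le_trans (cmod_sum _ _ _) _.
  under eq_bigr do rewrite ipZl cmodM cmod_conj.
  have CS := sumr_CS (sphere I n) xpredT (fun w => cmod (tw w)) (fun w => cmod (ip (ev w x) x)).
  have h : (\sum_(w <- sphere I n) cmod (tw w) * cmod (ip (ev w x) x)) ^+ 2 <= (s * nm x ^+ 2) ^+ 2.
    apply: le_trans CS _; rewrite /s !exprMn !sqr_sqrtr// -mulrA.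
    by rewrite ler_wpM2l.
  rewrite -(ler_pXn2r (n := 2)) ?nnegrE//.
    by rewrite sumr_ge0// => w _; rewrite mulr_ge0 ?cmod_ge0.
  by rewrite mulr_ge0 ?sqr_ge0// mulr_ge0 ?sqrtr_ge0.
have ML := comb_vn hM hu l; have ML' := vn_adj hM ML.
(* The form of 2 s - D - D* is nonnegative, so [tau_pos] yields P <= s = sqrt(P B), that is P <=
   B. *)
pose k : H -> H := (-1) *: comb l + ((-1) *: adj (comb l) + ((2 * s)%:C *: id + 0)).
have M4 : M ((2 * s)%:C *: id + 0) by apply: vn_linear => //; [exact: vn_id|exact: vn_zero].
have M3 : M ((-1) *: adj (comb l) + ((2 * s)%:C *: id + 0)) by exact: vn_linear.
have Mk : M k by exact: vn_linear.
have : 0 <= tau k.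
  apply: (tau_pos hM htau Mk) => x.
  rewrite -[k x]/((-1) *: comb l x + ((-1) *: adj (comb l) x + ((2 * s)%:C *: x + 0))).
  rewrite addr0 !ipDl !ipZl !mulN1r (vn_adjP' hM ML) ipxx.
  rewrite [X in _ + (- X + _)]ipC.
  set z := ip _ _; have := bnd x; rewrite -/z -rmorphM/=.
  case: z => a b /= h; rewrite lecE/=; apply/andP; split; first by apply/eqP; ring.
  by lra.
rewrite (trace_linear htau)// (trace_linear htau)// (trace_linear htau)//; last 2 first.
- exact: vn_id.
- exact: vn_zero.
rewrite (tau0 hM htau) (trace_id htau) (tau_adj hM htau)// tD conj_realc.
rewrite addr0 mulr1 !mulN1r -!rmorphN -!rmorphD/= ler0c => h.
have [->//|Pn0] := eqVneq P 0.
have sP : 0 < Num.sqrt P by rewrite sqrtr_gt0 lt_neqAle eq_sym Pn0.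
have : Num.sqrt P * Num.sqrt P <= Num.sqrt P * Num.sqrt B.
  by rewrite -expr2 sqr_sqrtr// -/s; lra.
by rewrite ler_pM2l// ler_sqrt.
Qed.

End Growth.

(** * The operator norm and freeness *)

Section OperatorNorm.
Context (R : realType) (H K : hilbertType R) (a : H -> K).

Lemma nm_le1 (x : H) : (`|x| <= 1) = (nm x <= 1).
Proof. by rewrite nmE -lecR. Qed.

Lemma opnorm_le (B : R) : 0 <= B -> (forall x, nm (a x) <= B * nm x) ->
  opnorm a <= B.
Proof.
move=> B0 aB; apply: sup_le_ub.
  by exists (nm (a 0)), 0 => //=; rewrite normr0.
move=> _ [x /= + <-]; rewrite nm_le1 => x1.
by apply: le_trans (aB x) _; rewrite ler_piMr.
Qed.

Lemma le_opnorm (x : H) : bounded_op a -> nm (a x) <= opnorm a * nm x.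
Proof.
move=> /bounded_opP[al [C C0 aC]].
have [->|x0] := eqVneq x 0; first by rewrite lin0// !nm0 mulr0.
have nx : 0 < nm x.
  by rewrite lt_neqAle nm_ge0 andbT; apply: contraNneq x0 => /esym/nm_eq0 ->.
pose y := ((nm x)^-1)%:C *: x.
have ny (z : K) : nm (((nm x)^-1)%:C *: z) = nm z / nm x.
  by rewrite nmZ cmod_real ger0_norm ?invr_ge0 ?nm_ge0// mulrC.
rewrite -ler_pdivrMr// -ny -linZ//; apply: sup_upper_bound; last first.
  exists y => //=; rewrite nm_le1 /y nmZ cmod_real ger0_norm ?invr_ge0 ?nm_ge0//.
  by rewrite mulVf// gt_eqF.
split; first by exists (nm (a 0)), 0 => //=; rewrite normr0.
exists C => _ [z /= + <-]; rewrite nm_le1 => z1.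
by apply: le_trans (aC z) _; rewrite ler_piMr.
Qed.

Lemma opnorm_ge0 : bounded_op a -> 0 <= opnorm a.
Proof.
move=> /bounded_opP[al [C C0 aC]]; apply: sup_upper_bound.
  split; first by exists (nm (a 0)), 0 => //=; rewrite normr0.
  exists C => _ [z /= + <-]; rewrite nm_le1 => z1.
  by apply: le_trans (aC z) _; rewrite ler_piMr.
by exists 0 => /=; rewrite ?normr0// lin0// normr0.
Qed.

End OperatorNorm.

(** * Freeness in terms of reduced words *)

Section Blocks.
Variable I : finType.
Implicit Types (w : seq (letter I)) (i : I).

(** The exponent is stored minus one, so that every block is a nonzero power. *)
Definition block (p : letter I * nat) := nseq p.2.+1 p.1.

(** The blocks are maximal powers of a letter. Adjacent ones differ even in the index of the
    generator, as a letter never meets its inverse in a reduced word. *)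
Lemma reduced_blocks w : reduced w -> exists bl : seq (letter I * nat),
  w = flatten [seq block p | p <- bl] /\
  sorted (fun p r => p.1.1 != r.1.1) bl.
Proof.
elim: w => [|a w IH]; first by exists [::].
move=> /= /andP[aw /IH[bl [wE bls]]].
case: bl wE bls => [|[b k] bl] wE bls; first by exists [:: (a, 0%N)]; rewrite wE.
have [ab|ab] := eqVneq a b.
  by exists ((a, k.+1) :: bl); rewrite wE ab; split=> //; case: (bl) bls.
exists ((a, 0%N) :: (b, k) :: bl); split; first by rewrite wE.
apply/andP; split; last exact: bls.
move: aw; rewrite wE /=; apply: contraNneq.
case: a b ab {wE bls} => [i c] [j d] /= + ij; rewrite -ij => ab.
by rewrite /linv xpair_eqE eqxx/=; case: c d ab => [] [] //=; rewrite eqxx.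
Qed.

Lemma reduced_nseq n (a : letter I) : reduced (nseq n a).
Proof.
elim: n => //= n ->; rewrite andbT; case: n => //= n.
by rewrite eq_sym linv_neq.
Qed.

Definition on_index i w := all (fun a : letter I => a.1 == i) w.

Lemma on_index_red i w : on_index i w -> on_index i (red w).
Proof.
elim: w => // a w IH /andP[ai /IH].
have -> : red (a :: w) = act a (red w) by [].
case: (red w) => [|b v]; first by rewrite /= ai.
move=> /andP[bi vi]; rewrite /act; case: ifP => // _.
by apply/and3P.
Qed.

Lemma reduced_cat_index i w b v : reduced w -> on_index i w -> reduced (b :: v) ->
  b.1 != i -> reduced (w ++ b :: v).
Proof.
move=> + + rv bi; elim: w => // a w IH /= /andP[aw rw] /andP[/eqP ai wi].
rewrite IH// andbT ok_cat; case: w {IH rw wi} aw => // _.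
rewrite /ok; apply: contraNneq bi => abi.
by move: ai; rewrite abi => <-.
Qed.

End Blocks.

Section Freeness.
Context (R : realType) (H : hilbertType R) (M : set (H -> H)).
Hypothesis hM : von_neumann M.
Variables (I : finType) (u : I -> H -> H).
Hypothesis hu : forall i, M (u i) /\ unitary_op (u i).
Variable tau : (H -> H) -> R[i].
Hypothesis htau : normal_faithful_tracial_state M tau.
Local Notation ev := (word_op u).
Local Notation comb := (lincomb u).
Local Notation tw := (word_trace u tau).

Lemma opexpz_ev i (k : int) : opexpz (u i) k =
  match k with
  | Posz n => ev (nseq n (i, true))
  | Negz n => ev (nseq n.+1 (i, false))
  end.
Proof.
by case: k => n /=; apply/funext => x; elim: n => //= n; rewrite /= => ->.
Qed.

(** Blocks are centered by the Haar condition and lie in the algebras of alternating indices, so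
    freeness applies to their product. *)
Lemma free_tw0 : free_haar_unitaries tau u ->
  forall w, reduced w -> w != [::] -> tw w = 0.
Proof.
move=> [haar free] w /reduced_blocks[bl [-> bls]] w0.
have bl0 : (0 < size bl)%N by case: bl w0 {bls}.
have [p0 _] : exists p0, p0 \in bl.
  by case: bl bl0 {bls w0} => // p bl _; exists p; rewrite mem_head.
have evE : ev (flatten [seq block p | p <- bl]) =
    \big[comp/id]_(p <- bl) ev (block p).
  elim: bl {bls w0 bl0} => [|p bl IH]; first by rewrite big_nil.
  by rewrite big_cons -IH -[flatten _]/(block p ++ _) ev_cat.
rewrite /word_trace evE (big_nth p0).
apply: (free (size bl) (fun k => (nth p0 bl k).1.1)
             (fun k => ev (block (nth p0 bl k)))) => //.
- move=> k _; case: (nth p0 bl k) => [[i b] m]; split.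
    move=> S [[S1 Sl Sc Sa] uS].
    have Se : S (letter_op u (i, b)) by case: (b); [exact: uS | apply: (Sa); exact: uS].
    have Sn n : S (ev (nseq n (i, b))) by elim: n => // n IH; apply: (Sc).
    exact: Sn.
  case: b; [have := (haar i).2 (Posz m.+1) | have := (haar i).2 (Negz m)];
    by rewrite opexpz_ev; apply.
- move=> k kn; apply/eqP.
  by move/(sortedP p0): bls => /(_ k kn).
Qed.

Hypothesis tw0 : forall w, reduced w -> w != [::] -> tw w = 0.

(** An explicit algebra containing u_i, hence the one that u_i generates; its elements are
    combinations of words in u_i and its adjoint. *)
Lemma index_algebra i : unital_star_algebra
  [set comb l | l in [set l | all (fun p => on_index i p.2) l]].
Proof.
split.
- by exists [:: (1, [::])] => //; rewrite comb1.
- move=> c _ _ [l1 /= h1 <-] [l2 /= h2 <-].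
  exists ([seq (c * p.1, p.2) | p <- l1] ++ l2); last by rewrite comb_cat combZ.
  by rewrite /= all_cat h2 andbT all_map.
- move=> _ _ [l1 /= h1 <-] [l2 /= h2 <-].
  exists (comb_mul l1 l2); last by rewrite (comb_comp hM hu).
  apply/allP => _ /allpairsP[[p r] [/= pl rl ->]] /=.
  by rewrite /on_index all_cat; apply/andP; split;
    [exact: (allP h1 _ pl) | exact: (allP h2 _ rl)].
- move=> _ [l /= h <-]; exists (comb_star l); last by rewrite (comb_adj hM hu).
  rewrite /= all_map; apply: sub_all h => p /=.
  by rewrite /on_index /winv all_rev all_map.
Qed.

(** All nonempty reduced words have trace 0, so the coefficients on words reducing to the empty one
    add up to tau a = 0 and these terms drop out. *)
Lemma centered_comb i a : smallest (@unital_star_algebra R H) [set u i] a ->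
  tau a = 0 -> exists l, a = comb l /\
    all (fun p => [&& reduced p.2, on_index i p.2 & p.2 != [::]]) l.
Proof.
move=> ha a0.
have [l /= hl aE] : [set comb l | l in [set l | all (fun p => on_index i p.2) l]] a.
  apply: ha; split; first exact: index_algebra.
  move=> _ ->; exists [:: (1, [:: (i, true)])]; first by rewrite /= eqxx.
  by rewrite comb1; apply/funext.
exists [seq (p.1, red p.2) | p <- l & red p.2 != [::]]; split; last first.
  apply/allP => p /mapP[r]; rewrite mem_filter => /andP[r0 rl] -> /=.
  by rewrite red_reduced r0 andbT on_index_red// (allP hl).
rewrite -aE; apply/funext => x; rewrite /lincomb big_map big_filter.
rewrite (bigID (fun p => red p.2 != [::]))/=.
rewrite [X in _ + X](_ : _ = 0) ?addr0.
  by apply: eq_bigr => p _; rewrite (ev_red hu).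
rewrite (eq_bigr (fun p => p.1 *: x)) => [|p]; last first.
  by rewrite negbK -(ev_red hu) => /eqP ->.
rewrite -scaler_suml.
suff -> : \sum_(p <- l | ~~ (red p.2 != [::])) p.1 = tau a by rewrite a0 scale0r.
rewrite -aE (tau_comb hM hu htau) big_mkcond; apply: eq_bigr => p _.
have -> : tw p.2 = tw (red p.2) by rewrite /word_trace (ev_red hu).
case: eqVneq => [->|r0]; first by rewrite (tw_nil u htau) mulr1.
by rewrite tw0 ?mulr0// red_reduced.
Qed.

(** Nonempty reduced words with distinct indices concatenate without cancellation. The induction
    records the index of the first letter, which controls the junction with the next factor on the
    left. *)
Lemma alternating_comb n (i : nat -> I) (a : nat -> H -> H) :
  (forall k, (k < n.+1)%N ->
     smallest (@unital_star_algebra R H) [set u (i k)] (a k) /\ tau (a k) = 0) ->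
  (forall k, (k.+1 < n.+1)%N -> i k <> i k.+1) ->
  exists l, \big[comp/id]_(0 <= k < n.+1) a k = comb l /\
    all (fun p => reduced p.2 &&
      (if p.2 is b :: _ then b.1 == i 0%N else false)) l.
Proof.
elim: n i a => [|n IH] i a ha hi;
    have [l [aE hl]] := centered_comb (ha 0%N isT).1 (ha 0%N isT).2.
  exists l; split; first by rewrite big_ltn// big_geq.
  apply: sub_all hl => -[c [|b w]] //= /and3P[-> + _].
  by rewrite /on_index /= => /andP[-> _].
rewrite big_ltn// big_add1.
have [l' [bE hl']] := IH (fun k => i k.+1) (fun k => a k.+1)
  (fun k hk => ha k.+1 hk) (fun k hk => hi k.+1 hk).
exists (comb_mul l l'); split; first by rewrite bE aE (comb_comp hM hu).
apply/allP => _ /allpairsP[[p r] [/= pl rl ->]] /=.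
have /and3P[rp ip p0] := allP hl _ pl.
have := allP hl' _ rl => /=; case: (r.2) => [|b v]; first by [].
move=> /andP[rv bi]; rewrite (reduced_cat_index rp ip rv).
  case: (p.2) p0 ip => //= c w _; by case/andP.
by rewrite (eqP bi); apply/eqP => /esym; apply: hi.
Qed.

Lemma tw0_free : free_haar_unitaries tau u.
Proof.
split=> [i|].
  split; first by case: (hu i).
  move=> k k0; rewrite opexpz_ev; case: k k0 => [[|n]|n] // _;
    by apply: tw0; first exact: reduced_nseq.
move=> [|n] i a // _ ha hi; have [l [-> hl]] := alternating_comb ha hi.
rewrite (tau_comb hM hu htau) big_seq big1// => p pl.
have := allP hl _ pl; case: (p.2) => [|b w]; first by [].
by move=> /andP[rw _]; rewrite tw0 ?mulr0.
Qed.

End Freeness.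

Theorem theorem1p1 (R : realType) (H : hilbertType R) (M : set (H -> H))
    (tau : (H -> H) -> R[i])
    (hM : von_neumann M) (hfin : finite_vN M)
    (htau : normal_faithful_tracial_state M tau)
    (L : hilbert_tensor H (conjsp H))
    (N : nat) (hN : (1 < N)%N)
    (u : 'I_N -> H -> H) (hu : forall i, M (u i) /\ unitary_op (u i)) :
  free_haar_unitaries tau u <->
  opnorm (\sum_(i < N) (op_tensor L (u i) (adj (op_elt (u i)))
                        + op_tensor L (adj (u i)) (op_elt (u i))))
  = 2 * Num.sqrt (2 * N%:R - 1).
Proof.
have I2 : (2 <= #|'I_N|)%N by rewrite card_ord.
have rhoE : Num.sqrt (2 * N%:R - 1) = Num.sqrt ((branching 'I_N)%:R : R).
  congr Num.sqrt; rewrite /branching card_letter card_ord.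
  have -> : (2 * N)%N = (2 * N).-1.+1 by lia.
  by rewrite -natrM -[in LHS](prednK (n := 2 * N)) -?natr1 ?addrK//; lia.
have adjop i : adj (op_elt (u i)) = u i :> (conjsp H -> conjsp H).
  apply: adj_eq => x y; rewrite !ip_conj /op_elt.
  by rewrite (vn_adjP hM (hu i).1).
(* The two summands for i are [Pi] at the letters (i, true) and (i, false). *)
have -> : \sum_(i < N) (op_tensor L (u i) (adj (op_elt (u i)))
              + op_tensor L (adj (u i)) (op_elt (u i))) = lap (@Pi R H _ u L).
  apply/funext => z; rewrite fct_sumE /lap.
  rewrite -(pair_bigA _ (fun i b => Pi u (i, b) z))/=; apply: eq_bigr => i _.
  by rewrite big_bool /= adjop.
have Plin := Pi_lin hM hu (L := L).
have Padj := Pi_adj hM hu (L := L).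
have PK := PiK hM hu (L := L).
have bT : bounded_op (lap (@Pi R H _ u L)).
  apply/bounded_opP; split; first exact: lap_lin Plin.
  exists #|letter 'I_N|%:R => [|z]; first exact: ler0n.
  exact: lap_nm Padj PK z.
(* A zero space would contradict tau id = 1. The vector x tensor x is the test vector of the lower
   bound: its matrix coefficients under words are |<w x, x>|^2. *)
have [x x0] : exists x : H, x != 0.
  apply: contrapT => h; have id0 : (id : H -> H) = 0.
    by apply/funext => x; apply: contrapT => /eqP xn; apply: h; exists x.
  have := trace_id htau; rewrite id0 (tau0 hM htau) => /esym/eqP.
  by rewrite oner_eq0.
rewrite rhoE; split=> [free|norm].
  have tw0 := free_tw0 free.
  apply/eqP; rewrite eq_le; apply/andP; split.
    apply: opnorm_le; first by rewrite mulr_ge0// sqrtr_ge0.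
    by move=> z; exact: (lap_norm hM hu htau tw0 I2 z).
  have low := lap_lower Plin PK (opnorm_ge0 bT) I2 (fun z => le_opnorm z bT)
    (eta := ht L x (x : conjsp H)).
  apply: low.
    apply: contraNneq x0 => e0; have := nm_ht L x (x : conjsp H).
    rewrite e0 nm0 => /esym/eqP; rewrite mulf_eq0 orbb => /eqP/nm_eq0 ->.
    by [].
  by move=> w; rewrite (ip_pw_diag hM hu) sqr_ge0.
apply: (tw0_free hM hu htau).
have [C hC] : exists C : R, forall n,
    Phi (word_trace u tau) n <= C * n.+1%:R * Num.sqrt (branching 'I_N)%:R ^+ n.
  apply: (tw_growth hM hu htau I2 (L := L)) => z.
  by rewrite -norm; exact: le_opnorm.
exact: (character_vanish (tw_trace hM hu htau) (tw_cancel hu tau)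
  (tw_pd hM hu htau) (tw_nil u htau) (tw_le1 hM hu htau) I2 hC).
Qed.
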